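(* Let $G$ be an undirected graph with $n$ vertices and $m$ edges and let $T$ be a DFS tree of $G$. Then $G$ can be preprocessed to build a data structure in $O(m\log n)$ time such that any subtree $T'$ of $T$ can be rerooted at any vertex of $T'$ in $O(|T'|\log^3 n)$ time.
   Context: A DFS tree of an undirected graph rooted at $r$ is a rooted spanning tree in which every non-tree edge joins a vertex to one of its ancestors. A subtree $T'$ of $T$ means $T(x)$, the subtree of $T$ rooted at some vertex $x$ (consisting of $x$ and all its descendants); $T(x)$ is a DFS tree of the subgraph of $G$ induced by its vertex set. Rerooting $T'$ at a vertex $r'\in T'$ means computing a DFS tree, rooted at $r'$, of the subgraph of $G$ induced by the vertices of $T'$. $|T'|$ is the number of vertices of $T'$. *)

(* Defs.v *)
From mathcomp Require Import all_boot.

Set Implicit Arguments.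
Unset Strict Implicit.
Unset Printing Implicit Defensive.

(* A rooted tree is given by its parent function; the root is its own parent.
   Hence [fconnect T v u] ("u is reached from v by iterating T") says that u is
   an ancestor of v, every vertex being an ancestor of itself. *)
Definition ancestor n (T : 'I_n -> 'I_n) (u v : 'I_n) : bool := fconnect T v u.

(* T, restricted to S, is a DFS tree rooted at r of the subgraph of the graph e
   induced by S; the values of T outside S are irrelevant. *)
Record dfs_tree n (e : rel 'I_n) (S : {set 'I_n}) (r : 'I_n)
    (T : 'I_n -> 'I_n) : Prop := DfsTree {
  dfs_root_in : r \in S;
  dfs_root : T r = r;
  dfs_edge : forall v, v \in S -> v != r -> (T v \in S) && e v (T v);
  dfs_spanning : forall v, v \in S -> ancestor T r v;
  dfs_nontree : forall u v, u \in S -> v \in S -> e u v ->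
    T u != v -> T v != u -> ancestor T u v || ancestor T v u
}.

Definition subtree n (T : 'I_n -> 'I_n) (x : 'I_n) : {set 'I_n} :=
  [set v | ancestor T x v].

Definition edges n (e : rel 'I_n) : {set {set 'I_n}} :=
  [set [set p.1; p.2] | p in [pred p : 'I_n * 'I_n | e p.1 p.2]].

(* A unit-cost word RAM. A program uses finitely many arrays, named by numerals; a scalar variable is
   cell 0 of an array.  Interleaving the arrays in one flat memory changes
   running times by a constant factor only. *)
Definition memory := nat -> nat -> nat.

Definition upd (s : memory) (a i v : nat) : memory :=
  fun b j => if (b == a) && (j == i) then v else s b j.

Inductive binop := OpAdd | OpSub | OpMul | OpDiv | OpLt | OpEq.

Inductive expr :=
  | Cst of nat
  | Get of nat & expr              (* array, index *)
  | Op of binop & expr & expr.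

Inductive cmd :=
  | Skip
  | Assign of nat & expr & expr      (* array, index, value *)
  | Seq of cmd & cmd
  | If of expr & cmd & cmd
  | While of expr & cmd.

Definition binop_sem (o : binop) (x y : nat) : nat :=
  match o with
  | OpAdd => x + y
  | OpSub => x - y
  | OpMul => x * y
  | OpDiv => x %/ y
  | OpLt => x < y
  | OpEq => x == y
  end.

(* On words, OpSub truncates at 0 and OpDiv by 0 gives 0.  Words have w bits:
   computed values, in particular all computed indices, are reduced
   modulo 2 ^ w. *)
Fixpoint eval (w : nat) (s : memory) (x : expr) : nat :=
  match x with
  | Cst k => k %% 2 ^ w
  | Get a i => s a (eval w s i)
  | Op o x1 x2 => binop_sem o (eval w s x1) (eval w s x2) %% 2 ^ w
  end.

Fixpoint cost (x : expr) : nat :=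
  match x with
  | Cst _ => 1
  | Get _ i => (cost i).+1
  | Op _ x1 x2 => (cost x1 + cost x2).+1
  end.

(* [exec w p s t s']: started in memory s, the program p halts after t steps
   with memory s'. *)
Inductive exec (w : nat) : cmd -> memory -> nat -> memory -> Prop :=
  | ExecSkip s : exec w Skip s 1 s
  | ExecAssign s a i x :
      exec w (Assign a i x) s (cost i + cost x).+1
        (upd s a (eval w s i) (eval w s x))
  | ExecSeq p q s t1 s1 t2 s2 :
      exec w p s t1 s1 -> exec w q s1 t2 s2 -> exec w (Seq p q) s (t1 + t2) s2
  | ExecIfTrue b p q s t s' :
      eval w s b != 0 -> exec w p s t s' ->
      exec w (If b p q) s (cost b + t).+1 s'
  | ExecIfFalse b p q s t s' :
      eval w s b = 0 -> exec w q s t s' ->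
      exec w (If b p q) s (cost b + t).+1 s'
  | ExecWhileTrue b p s t1 s1 t2 s2 :
      eval w s b != 0 -> exec w p s t1 s1 -> exec w (While b p) s1 t2 s2 ->
      exec w (While b p) s (cost b + t1 + t2).+1 s2
  | ExecWhileFalse b p s :
      eval w s b = 0 -> exec w (While b p) s (cost b).+1 s.

(* In running-time bounds the integer logarithm is within a factor 2 of the
   real one for n >= 2. *)
Definition log (n : nat) : nat := trunc_log 2 n.

Definition word_size (c n : nat) : nat := c * (log n).+1.

Definition adjacency_lists n (e : rel 'I_n) (adj : 'I_n -> seq 'I_n) : Prop :=
  forall v, uniq (adj v) /\ adj v =i e v.

(* Array 0 holds n; array 2 holds the concatenated adjacency lists, the list of
   v occupying the cells from offset v (included) to offset v + 1 (excluded),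
   where the n + 1 offsets are in array 1; array 3 holds the parents in T.
   All other cells are 0. *)
Definition input_mem n (adj : 'I_n -> seq 'I_n) (T : 'I_n -> 'I_n) : memory :=
  let lists := [seq [seq val u | u <- adj v] | v <- enum 'I_n] in
  let offsets := [seq sumn (take k (shape lists)) | k <- iota 0 n.+1] in
  let parents := [seq val (T v) | v <- enum 'I_n] in
  let data := [:: [:: n]; offsets; flatten lists; parents] in
  fun a i => nth 0 (nth [::] data a) i.

(* The query "reroot T(x) at r'" is passed in the first two cells of array 4. *)
Definition query_mem n (s : memory) (x r' : 'I_n) : memory :=
  upd (upd s 4 0 x) 4 1 r'.

(* The rerooted tree is returned as a parent array, in array 5; the cells of
   vertices outside S are irrelevant. *)
Definition answers n (e : rel 'I_n) (S : {set 'I_n}) (r' : 'I_n) (s : memory) :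
    Prop :=
  exists2 T' : 'I_n -> 'I_n,
    dfs_tree e S r' T' & forall v, v \in S -> s 5 v = T' v.

(* Main.v *)
Require Import Defs.
From mathcomp Require Import all_boot zify.

(** Number the vertices in preorder, so that subtrees are intervals.  To reroot T(y)
    at w, reverse the path from w up to y.  An edge from a subtree T(c) hanging off
    this path to the rest of T(y) joins T(c) to an ancestor of c, hence to a path
    vertex.  Take such an edge wa, with w in T(c), for which a is topmost, and reroot
    T(c) at w below a: the vertices of T(c) then have all path vertices from a down
    as ancestors, in particular all their neighbours on the path.  A vertex is the
    root of at most one hanging subtree, so that rerooting T(x) takes at most |T(x)|
    searches for a topmost edge.  If the edges ua are coded as a * n + u and listed by
    u, such a search asks for the least code from y * n on in an interval of the
    list; a wavelet matrix, built in O(m log n) time, answers it in O(log n) time. *)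

Set Implicit Arguments.
Unset Strict Implicit.
Unset Printing Implicit Defensive.

(** * A program logic for the word RAM *)

(** Preorder numbers increase along every path down from the root, so topmost means smallest, and in
    a code a * n + u the endpoint a decides. The lower bound y * n discards the edges that leave
    T(y) upwards; these are settled by the attachment of T(y) itself, which was chosen topmost for
    all of T(y). Some edge always qualifies, namely the one from c to its parent. The language has
    no procedures, so the recursion becomes a stack of pending requests. Serving a request changes
    only entries of its own subtree, and the pending subtrees are disjoint, so the order of service
    does not matter. Each vertex lies on exactly one reversed path, and scanning the children of
    path vertices meets each hanging subtree once; the total is O(|T'| log n), within the required
    bound. Arithmetic is modulo a power of two, so every step must also be shown not to overflow.
    For the stack pointer this is not evident from the program: the credits that pay for the running
    time also bound the number of pending requests. *)

Notation "'var' a" := (Get a (Cst 0)) (at level 9, a at level 8).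
Notation "x [+] y" := (Op OpAdd x y) (at level 50, left associativity).
Notation "x [-] y" := (Op OpSub x y) (at level 50, left associativity).
Notation "x [*] y" := (Op OpMul x y) (at level 40, left associativity).
Notation "x [/] y" := (Op OpDiv x y) (at level 40, left associativity).
Notation "x [<] y" := (Op OpLt x y) (at level 70, no associativity).
Notation "x [==] y" := (Op OpEq x y) (at level 70, no associativity).
Notation "a <~ x" := (Assign a (Cst 0) x) (at level 80, no associativity).
Notation "p ;; q" := (Seq p q) (at level 90, right associativity).

(** Evaluation in unbounded arithmetic. Programs are reasoned about with it; [fits] bounds the
    intermediate values, so that no reduction modulo [2 ^ w] takes effect. *)
Fixpoint ieval (s : memory) (x : expr) : nat :=
  match x with
  | Cst k => k
  | Get a i => s a (ieval s i)
  | Op o x1 x2 => binop_sem o (ieval s x1) (ieval s x2)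
  end.

(** A test is kept as a boolean comparison instead of a number compared with 0, so that branch
    conditions reach linear arithmetic in usable form. *)
Definition icond (s : memory) (x : expr) : bool :=
  match x with
  | Op OpLt x1 x2 => ieval s x1 < ieval s x2
  | Op OpEq x1 x2 => ieval s x1 == ieval s x2
  | _ => ieval s x != 0
  end.

Lemma icondE s x : icond s x = (ieval s x != 0).
Proof. by case: x => // -[] //= x y; case: (X in nat_of_bool X). Qed.

(** Literals below 64 are words as soon as words have 6 bits, whatever the input. *)
Fixpoint small_csts (x : expr) : bool :=
  match x with
  | Cst k => k < 64
  | Get _ i => small_csts i
  | Op _ x1 x2 => small_csts x1 && small_csts x2
  end.

(* No operation in the expression overflows a word below B; constants are dealt
   with by [small_csts]. *)
Fixpoint fits (B : nat) (s : memory) (x : expr) : Prop :=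
  match x with
  | Cst _ => True
  | Get _ i => fits B s i
  | Op o x1 x2 =>
    [/\ fits B s x1, fits B s x2 &
     match o with
     | OpAdd => ieval s x1 + ieval s x2 < B
     | OpMul => ieval s x1 * ieval s x2 < B
     | OpSub | OpDiv => ieval s x1 < B
     | _ => True
     end]
  end.

Fixpoint loop_free (p : cmd) : bool :=
  match p with
  | Skip => true
  | Assign _ i x => small_csts i && small_csts x
  | Seq p q => loop_free p && loop_free q
  | If b p q => [&& small_csts b, loop_free p & loop_free q]
  | While _ _ => false
  end.

Fixpoint wp (B : nat) (p : cmd) (s : memory) (Q : memory -> Prop) : Prop :=
  match p with
  | Skip => Q s
  | Assign a i x =>
    [/\ fits B s i, fits B s x & Q (upd s a (ieval s i) (ieval s x))]
  | Seq p q => wp B p s (fun s' => wp B q s' Q)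
  | If b p q => fits B s b /\ if icond s b then wp B p s Q else wp B q s Q
  | While _ _ => False
  end.

Arguments upd s a i v b j /.

Fixpoint max_cost (p : cmd) : nat :=
  match p with
  | Skip => 1
  | Assign _ i x => (cost i + cost x).+1
  | Seq p q => max_cost p + max_cost q
  | If b p q => (cost b + maxn (max_cost p) (max_cost q)).+1
  | While _ _ => 0
  end.

Fixpoint modified (p : cmd) : seq nat :=
  match p with
  | Skip => [::]
  | Assign a _ _ => [:: a]
  | Seq p q | If _ p q => modified p ++ modified q
  | While _ p => modified p
  end.

(** Framing goes by whole arrays: scalars being arrays of their own, the footprint of a program is
    read off its syntax. *)
Definition frame (l : seq nat) (s s' : memory) : Prop :=
  forall a, a \notin l -> s' a =1 s a.

Lemma frame_trans l l' s s1 s2 : all (mem l) l' ->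
  frame l s s1 -> frame l' s1 s2 -> frame l s s2.
Proof.
move=> /allP sub F F' a Ha j; rewrite F' ?F //.
by apply: contraNN Ha; apply: sub.
Qed.

Lemma exec_frame w p s t s' : exec w p s t s' -> frame (modified p) s s'.
Proof.
elim=> {p s t s'} //=.
- by move=> s a i x b; rewrite inE /upd => /negPf-> j.
- move=> p q s t1 s1 t2 s2 _ F1 _ F2 a.
  by rewrite mem_cat => /norP[/F1 E1 /F2 E2] j; rewrite E2 E1.
- by move=> b p q s t s' _ _ F a; rewrite mem_cat => /norP[/F E1 _].
- by move=> b p q s t s' _ _ F a; rewrite mem_cat => /norP[_ /F E1].
- by move=> b p s t1 s1 t2 s2 _ _ F1 _ F2 a Ha j; rewrite F2 // F1.
Qed.

(* A product that linear arithmetic treats as an atom. *)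
Definition times (i k : nat) : nat := i * k.
Arguments times : simpl never.

Lemma timesS i k : times i.+1 k = times i k + k.
Proof. by rewrite /times mulSn addnC. Qed.

Lemma timesD i k l : times i (k + l) = times i k + times i l.
Proof. exact: mulnDr. Qed.

Lemma leq_times i j k : i <= j -> times i k <= times j k.
Proof. by move=> ij; rewrite leq_mul2r ij orbT. Qed.

Lemma subnSK_times m j k : j < m -> times (m - j) k = times (m - j.+1) k + k.
Proof. by move=> lt_jm; rewrite -timesS subnSK. Qed.

Ltac vc :=
  repeat match goal with
  | |- True => constructor
  | |- _ /\ _ => split
  | |- and3 _ _ _ => split
  end.

Section Run.

Context (w : nat) (w_ge6 : 5 < w).

(* Credits: p halts within phi steps, and Q holds of some part of the unused
   credits and of the final memory. *)
Definition run (p : cmd) (phi : nat) (s : memory) (Q : nat -> memory -> Prop) :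
    Prop :=
  exists t s' phi',
    [/\ exec w p s t s', t + phi' <= phi, Q phi' s' & frame (modified p) s s'].

Lemma ltn_word k : k < 64 -> k < 2 ^ w.
Proof.
move=> Hk; apply: leq_trans Hk _.
by rewrite (_ : 64 = 2 ^ 6) // leq_exp2l.
Qed.

Lemma eval_ieval s x : small_csts x -> fits (2 ^ w) s x ->
  eval w s x = ieval s x.
Proof.
elim: x => [k|a i IH|o x IHx y IHy] /=.
- by move=> Hk _; rewrite modn_small // ltn_word.
- by move=> Hi Fi; rewrite IH.
- move=> /andP[Hx Hy] [Fx Fy Fo]; rewrite IHx // IHy //.
  have B1 (b : bool) : b < 2 ^ w by apply: ltn_word; case: b.
  case: o Fo => //= Fo; rewrite modn_small ?B1 //.
    exact: leq_ltn_trans (leq_subr _ _) Fo.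
  exact: leq_ltn_trans (leq_div _ _) Fo.
Qed.

Lemma exec_wp p s Q : loop_free p -> wp (2 ^ w) p s Q ->
  exists t s', [/\ t <= max_cost p, exec w p s t s' & Q s'].
Proof.
elim: p s Q => [|a i x|p IHp q IHq|b p IHp q IHq|//] s Q /=.
- by move=> _ Qs; exists 1, s; split=> //; constructor.
- move=> /andP[Ci Cx] [Fi Fx HQ]; exists (cost i + cost x).+1; eexists.
  by split; last exact: HQ; rewrite // -!(eval_ieval Ci Fi) -(eval_ieval Cx Fx); constructor.
- move=> /andP[Cp Cq] /(IHp _ _ Cp)[t1 [s1 [H1 E1 /(IHq _ _ Cq)[t2 [s2 [H2 E2 Q2]]]]]].
  by exists (t1 + t2), s2; split; [rewrite leq_add | econstructor; eassumption |].
- move=> /and3P[Cb Cp Cq] [Fb]; rewrite icondE.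
  have [b0 /(IHq _ _ Cq)|b1 /(IHp _ _ Cp)] := eqVneq (ieval s b) 0.
    move=> [t [s' [Ht E HQ]]]; exists (cost b + t).+1, s'; split=> //; first by lia.
    by apply: ExecIfFalse; rewrite // eval_ieval.
  move=> [t [s' [Ht E HQ]]]; exists (cost b + t).+1, s'; split=> //; first by lia.
  by apply: ExecIfTrue; rewrite // eval_ieval.
Qed.

Lemma run_block p phi phi' s (Q : nat -> memory -> Prop) :
  loop_free p -> max_cost p + phi' <= phi -> wp (2 ^ w) p s (Q phi') ->
  run p phi s Q.
Proof.
move=> Lp Hphi /(exec_wp Lp)[t [s' [Ht E HQ]]].
by exists t, s', phi'; split=> //; [lia | apply: exec_frame E].
Qed.

Lemma run_seq p q phi s (R Q : nat -> memory -> Prop) :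
  run p phi s R ->
  (forall phi1 s1, R phi1 s1 -> frame (modified p) s s1 -> run q phi1 s1 Q) ->
  run (p ;; q) phi s Q.
Proof.
move=> [t1 [s1 [phi1 [E1 H1 R1 F1]]]] /(_ _ _ R1 F1).
move=> [t2 [s2 [phi2 [E2 H2 R2 F2]]]].
have E : exec w (p ;; q) s (t1 + t2) s2 by econstructor; eassumption.
by exists (t1 + t2), s2, phi2; split=> //; [lia | apply: exec_frame E].
Qed.

Lemma run_block_seq p q phi phi1 s (Q : nat -> memory -> Prop) :
  loop_free p -> max_cost p + phi1 <= phi ->
  wp (2 ^ w) p s (fun s1 => frame (modified p) s s1 -> run q phi1 s1 Q) ->
  run (p ;; q) phi s Q.
Proof.
move=> Lp Hphi Hq; pose R x s1 := frame (modified p) s s1 -> run q x s1 Q.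
have : run p phi s R by apply: run_block Hphi _.
move/run_seq; apply=> x s1 H F.
exact: H.
Qed.

Lemma run_if b p q phi phi1 s (Q : nat -> memory -> Prop) :
  small_csts b -> fits (2 ^ w) s b -> cost b + 1 + phi1 <= phi ->
  (if icond s b then run p phi1 s Q else run q phi1 s Q) ->
  run (If b p q) phi s Q.
Proof.
move=> Cb Fb Hphi; rewrite icondE -(eval_ieval Cb Fb).
case: ifPn => Hb [t [s' [phi' [E Ht HQ F]]]].
  exists (cost b + t).+1, s', phi'; split=> //; first by constructor.
    by rewrite addnC in Ht *; lia.
  by move=> a; rewrite /= mem_cat => /norP[/F ? _].
exists (cost b + t).+1, s', phi'; split=> //.
- by apply: ExecIfFalse E; apply/eqP; rewrite -[_ == _]negbK.
- by lia.
- by move=> a; rewrite /= mem_cat => /norP[_ /F ?].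
Qed.

Lemma run_conseq p phi phi1 s (R Q : nat -> memory -> Prop) :
  run p phi1 s R -> phi1 <= phi ->
  (forall phi' s', R phi' s' -> frame (modified p) s s' ->
     Q (phi' + (phi - phi1)) s') ->
  run p phi s Q.
Proof.
move=> [t [s' [phi' [E H HR F]]]] Hphi HQ.
by exists t, s', (phi' + (phi - phi1)); split=> //; [lia | apply: HQ].
Qed.

(** For a callee with a worst-case bound: its left-over credits are dropped, and what follows starts
    from the fixed amount [phi2]. Amortised parts use [run_seq], which passes the rest on. *)
Lemma run_call p q phi phi1 phi2 s (R : memory -> Prop) (Q : nat -> memory -> Prop) :
  run p phi1 s (fun _ => R) -> phi1 + phi2 <= phi ->
  (forall s1, R s1 -> frame (modified p) s s1 -> run q phi2 s1 Q) ->
  run (p ;; q) phi s Q.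
Proof.
move=> [t [s1 [phi' [E H HR F]]]] Hphi Hq.
apply: (run_seq (R := fun x s2 => x = phi2 /\ R s2)).
  by exists t, s1, phi2; split=> //; lia.
by move=> _ s2 [-> R2]; apply: Hq.
Qed.

Lemma run_last p phi phi1 phi2 s (R : memory -> Prop) (Q : nat -> memory -> Prop) :
  run p phi1 s (fun _ => R) -> phi1 + phi2 <= phi ->
  (forall s1, R s1 -> frame (modified p) s s1 -> Q phi2 s1) ->
  run p phi s Q.
Proof.
move=> [t [s1 [phi' [E H HR F]]]] Hphi HQ.
by exists t, s1, phi2; split=> //; [lia | apply: HQ].
Qed.

(** The credits serve as the variant: every test takes at least one, so a loop that can pay for its
    turns terminates. *)
Lemma run_while b p (I Q : nat -> memory -> Prop) phi s :
  small_csts b -> I phi s ->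
  (forall phi1 s1, I phi1 s1 -> frame (modified p) s s1 ->
    fits (2 ^ w) s1 b /\
    exists2 phi2, cost b + 1 + phi2 <= phi1 &
      if icond s1 b then run p phi2 s1 I else Q phi2 s1) ->
  run (While b p) phi s Q.
Proof.
move=> Cb I0 step.
have F0 : frame (modified p) s s by [].
elim/ltn_ind: phi {-2}s I0 F0 => phi IH s1 I1 F1.
have [Fb [phi2 Hphi]] := step _ _ I1 F1.
rewrite icondE -(eval_ieval Cb Fb); case: ifPn => Hb; last first.
  exists (cost b).+1, s1, phi2; split=> //; last by lia.
  by constructor; apply/eqP; rewrite -[_ == _]negbK.
move=> [t2 [s2 [phi3 [E2 H2 I2 F2]]]].
have F3 : frame (modified p) s s2.
  by move=> a Ha j; rewrite F2 // F1.
have [|t3 [s3 [phi4 [E3 H3 Q3 F4]]]] := IH phi3 _ s2 I2 F3; first by lia.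
have E : exec w (While b p) s1 (cost b + t2 + t3).+1 s3.
  by apply: ExecWhileTrue Hb E2 E3.
by exists (cost b + t2 + t3).+1, s3, phi4; split=> //; [lia | apply: exec_frame E].
Qed.

Lemma run_for b p (J : nat -> memory -> Prop) i m K s :
  small_csts b -> i <= m -> J i s ->
  (forall j s1, i <= j <= m -> J j s1 -> frame (modified p) s s1 ->
    [/\ fits (2 ^ w) s1 b, icond s1 b = (j < m)
      & j < m -> run p K s1 (fun _ => J j.+1)]) ->
  run (While b p) (times (m - i) (K + cost b + 1) + cost b + 1) s (fun _ => J m).
Proof.
move=> Cb le_im J0 step.
pose I (phi : nat) (s1 : memory) := exists2 j, i <= j <= m &
  J j s1 /\ times (m - j) (K + cost b + 1) + cost b + 1 <= phi.
apply: (@run_while _ _ I) => //; first by exists i; rewrite ?leqnn.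
move=> phi1 s1 [j j_in [J1 Hphi]] F; have [Fb -> Hp] := step _ _ j_in J1 F.
split=> //; exists (phi1 - (cost b + 1)); first by lia.
case: ltnP Hp => [lt_jm /(_ isT) Hp|le_mj _]; last first.
  by have <- : j = m by lia.
rewrite subnSK_times // in Hphi.
apply: (run_last Hp (phi2 := times (m - j.+1) (K + cost b + 1) + cost b + 1)).
  by lia.
by move=> s2 J2 _; exists j.+1; [lia | split].
Qed.

End Run.

(* Arrays 0 to 5 are the input, query and answer.  In terms of preorder numbers,
   arrays 6 to 10 hold the vertex with a given number, the number of a given vertex,
   its parent, the end of its subtree and the index of its first listed edge; arrays
   11 to 14 the wavelet matrix on the listed edges; array 50 the rerooted tree; and
   arrays 51 to 54 the stack of requests. *)
Notation a_n := 0 (only parsing).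
Notation a_off := 1 (only parsing).
Notation a_adj := 2 (only parsing).
Notation a_par := 3 (only parsing).
Notation a_query := 4 (only parsing).
Notation a_ans := 5 (only parsing).
Notation a_ord := 6 (only parsing).
Notation a_pre := 7 (only parsing).
Notation a_pp := 8 (only parsing).
Notation a_fin := 9 (only parsing).
Notation a_ps := 10 (only parsing).
Notation a_code := 11 (only parsing).
Notation a_rank := 12 (only parsing).
Notation a_m := 13 (only parsing).
Notation a_pw0 := 14 (only parsing).
Notation p_st := 20 (only parsing).
Notation p_sp := 21 (only parsing).
Notation p_v := 22 (only parsing).
Notation p_cnt := 23 (only parsing).
Notation p_k := 24 (only parsing).
Notation p_end := 25 (only parsing).
Notation p_u := 26 (only parsing).
Notation w_i := 27 (only parsing).
Notation p_i := 27 (only parsing).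
Notation p_q := 28 (only parsing).
Notation q_lower := 30 (only parsing).
Notation q_upper := 31 (only parsing).
Notation q_lo := 32 (only parsing).
Notation q_res := 33 (only parsing).
Notation q_pw := 34 (only parsing).
Notation q_base := 35 (only parsing).
Notation q_i := 36 (only parsing).
Notation q_j := 37 (only parsing).
Notation q_k := 38 (only parsing).
Notation q_ri := 39 (only parsing).
Notation q_rj := 40 (only parsing).
Notation q_bit := 41 (only parsing).
Notation a_out := 50 (only parsing).
Notation r_y := 51 (only parsing).
Notation r_w := 52 (only parsing).
Notation r_a := 53 (only parsing).
Notation r_sp := 54 (only parsing).
Notation v_y := 55 (only parsing).
Notation v_v := 56 (only parsing).
Notation v_prev := 57 (only parsing).
Notation v_c := 58 (only parsing).
Notation w_pw := 60 (only parsing).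
Notation w_base := 61 (only parsing).
Notation w_next := 62 (only parsing).
Notation w_z := 63 (only parsing).
Notation w_x := 64 (only parsing).
Notation w_bit := 65 (only parsing).
Notation w_nn := 66 (only parsing).

(** * Rerooting a tree numbered in preorder *)

(* A DFS tree of a graph on 0, ..., n-1 whose vertices are numbered in preorder:
   the vertices of the subtree of k are k, ..., fin k - 1. *)
Record preorder_tree (n : nat) (E : rel nat) (p fin : nat -> nat) : Prop := {
  ltn_fin : forall k, k < n -> k < fin k;
  leq_fin : forall k, k < n -> fin k <= n;
  parent_lt : forall k, 0 < k < n -> p k < k;
  subtree_parent : forall k j, k < n -> 0 < j < n -> j != k ->
    (k <= j < fin k) = (k <= p j < fin k);
  edge_bound : forall j k, E j k -> j < n;
  edge_sym : forall j k, E j k = E k j;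
  edge_subtree : forall j k, j < k -> E j k -> k < fin j;
  edge_parent : forall k, 0 < k < n -> E k (p k)
}.

Section Rerooting.

Context (n : nat) (E : rel nat) (p fin : nat -> nat).
Context (tree : preorder_tree n E p fin).

(** Induction on [i], replacing it by its parent until [j] is reached. *)
Lemma subtree_trans k j i : k < n -> k <= j < fin k -> j <= i < fin j ->
  k <= i < fin k.
Proof.
move=> Hk; elim/ltn_ind: i => i IH Hj Hi.
have finj : fin j <= n by apply: (leq_fin tree); have := leq_fin tree Hk; lia.
have [<-//|nij] := eqVneq j i.
have [->|nik] := eqVneq i k; first by rewrite leqnn (ltn_fin tree).
rewrite (subtree_parent tree Hk) //; last by lia.
apply: IH => //; first by apply: (parent_lt tree); lia.
by rewrite -(subtree_parent tree) //; lia.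
Qed.

Lemma fin_subtree k j : k < n -> k <= j < fin k -> fin j <= fin k.
Proof.
move=> Hk Hj; have kn := leq_fin tree Hk; have jn : j < n by lia.
have Hfj := ltn_fin tree jn.
by have := @subtree_trans k j (fin j).-1 Hk Hj; lia.
Qed.

Lemma child_toward v w : v < n -> v < w < fin v ->
  exists v', [/\ p v' = v, v < v' & v' <= w < fin v'].
Proof.
move=> Hv; elim/ltn_ind: w => w IH Hw; have vn := leq_fin tree Hv.
have [e|ne] := eqVneq (p w) v.
  by exists w; have := ltn_fin tree (k := w); split; lia.
have pw : v <= p w < fin v by rewrite -(subtree_parent tree) //; lia.
have pwlt : p w < w by apply: (parent_lt tree); lia.
have [//||v' [e lt sub]] := IH (p w); first by lia.
exists v'; split=> //; apply: (@subtree_trans v' (p w)) => //; first by lia.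
have wn : w < n by lia.
have -> : p w <= w < fin (p w).
  by rewrite (subtree_parent tree) ?leqnn ?(ltn_fin tree) //; lia.
by [].
Qed.

(** Two ancestors of [w] are comparable and numbers increase downwards, so an ancestor of [w] that
    is at least [y] lies in the subtree of [y]. *)
Definition on_path (y w v : nat) : bool := [&& y <= v, v <= w & w < fin v].

Definition hanging (y w c : nat) : bool :=
  [&& y < c < fin y, ~~ on_path y w c & on_path y w (p c)].

(* Edge wa joins the subtree of c to the topmost possible vertex below y. *)
Definition top_edge (y c w a : nat) : Prop :=
  [/\ c <= w < fin c, E w a, y <= a < c &
   forall u b, c <= u < fin c -> E u b -> y <= b -> a <= b].

(** The entry [out w] of the new root is left free: it is the attachment chosen from outside, as
    [out w'] is for a hanging subtree. *)
Inductive rerooted (out : nat -> nat) : nat -> nat -> Prop :=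
  Rerooted y w : y <= w < fin y ->
    (forall v, on_path y w v -> v != y -> out (p v) = v) ->
    (forall c, hanging y w c ->
      exists2 w', top_edge y c w' (out w') & rerooted out c w') ->
    rerooted out y w.

(** Climb from [v] until the parent lies on the path; the vertex reached roots a hanging subtree. *)
Lemma hanging_cover y w v : y < n -> y <= w < fin y -> y <= v < fin y ->
  ~~ on_path y w v -> exists2 c, hanging y w c & c <= v < fin c.
Proof.
move=> yn Hw; elim/ltn_ind: v => v IH Hv Nv; have yn' := leq_fin tree yn.
have nvy : v != y by apply: contraNneq Nv => ->; rewrite /on_path leqnn.
have pv : y <= p v < fin y by rewrite -(subtree_parent tree) //; lia.
have pvlt : p v < v by apply: (parent_lt tree); lia.
have vn : v < n by lia.
have [on|off] := boolP (on_path y w (p v)).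
  by exists v; rewrite /hanging ?on ?Nv ?leqnn ?(ltn_fin tree) //; lia.
have [c Hc sub] := IH _ pvlt pv off; exists c => //.
move: Hc; rewrite /hanging => /and3P[c_in _ _].
by rewrite (subtree_parent tree) //; lia.
Qed.

Section Out.

Context (out : nat -> nat).

Definition climbs (v u : nat) : Prop := exists k, iter k out v = u.

Lemma climbs_trans v u x : climbs v u -> climbs u x -> climbs v x.
Proof. by case=> k <- [l <-]; exists (l + k); rewrite iterD. Qed.

(** On the reversed path [out] leads down the old tree. The child [u'] of [u] towards [w] cannot lie
    beyond [v]: otherwise [v] would be an ancestor of [u'], hence of [u], against [u < v]. *)
Lemma climbs_path y w u v : y < n -> w < fin y ->
  (forall v, on_path y w v -> v != y -> out (p v) = v) ->
  on_path y w u -> on_path y w v -> u <= v -> climbs u v.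
Proof.
move=> yn Hw Hout.
have [m] := ubnP (v - u); elim: m u => // m IH u lt onu onv le_uv.
have [->|ne] := eqVneq u v; first by exists 0.
have un : u < n by have := leq_fin tree yn; move: onu; rewrite /on_path; lia.
have [//||u' [e lt' sub]] := @child_toward u w.
  by move: onu onv; rewrite /on_path; lia.
have onu' : on_path y w u' by move: onu; rewrite /on_path; lia.
have ou : out u = u' by rewrite -[in LHS]e Hout //; move: onu; rewrite /on_path; lia.
have le_uv' : u' <= v.
  have u'n : u' < n by have := leq_fin tree yn; move: onu'; rewrite /on_path; lia.
  rewrite leqNgt; apply/negP=> lt_vu'.
  have vn : v < n by lia.
  have : v <= u' < fin v by move: onv onu'; rewrite /on_path; lia.
  by rewrite (subtree_parent tree) ?e //; lia.
apply: (@climbs_trans _ u'); first by exists 1.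
by apply: IH => //; lia.
Qed.

(** Only the last claim needs topmost attachments. A DFS tree has no cross edges, so within the
    subtree of [y] an edge out of a hanging subtree ends on the path. The attachment is at or above
    this end in the old tree, hence at or below it in the new one. *)
Lemma rerooted_dfs y w : y < n -> rerooted out y w ->
  [/\ forall v, y <= v < fin y -> v != w -> y <= out v < fin y /\ E v (out v),
      forall v, y <= v < fin y -> climbs v w
    & forall u v, y <= u < fin y -> y <= v < fin y -> E u v ->
      climbs u v \/ climbs v u].
Proof.
have [m] := ubnP (fin y - y); elim: m y w => // m IH y w lt yn R.
case: R lt yn => {}y {}w Hw Hp Hh lt yn; have yn' := leq_fin tree yn.
have IHc c : hanging y w c ->
  exists w', [/\ c < n /\ top_edge y c w' (out w'), on_path y w (out w'),
  forall v, c <= v < fin c -> v != w' -> c <= out v < fin c /\ E v (out v),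
      forall v, c <= v < fin c -> climbs v w'
    & forall u v, c <= u < fin c -> c <= v < fin c -> E u v ->
      climbs u v \/ climbs v u].
  move=> Hc; have [w' top Rc] := Hh c Hc.
  move: (Hc) => /and3P[c_in offc onpc].
  have cn : c < n by lia.
  have Hcfin : fin c <= fin y by apply: fin_subtree => //; lia.
  have [||H1 H2 H3] := IH c w' _ _ Rc; try lia.
  exists w'; split=> //.
  case: top => [Hw' Ew' Ha _].
  (* The edge from [w'] to its attachment makes the latter an ancestor of [w']. Being smaller than
     [c], it is an ancestor of [c], hence of [p c], which lies on the path. *)
  have sub : c <= w' < fin (out w').
    have aw : out w' < w' by lia.
    by move: Ew'; rewrite (edge_sym tree) => /(edge_subtree tree aw); lia.
  have an : out w' < n by lia.
  have : out w' <= c < fin (out w') by lia.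
  rewrite (subtree_parent tree an) //; [|lia..] => sub'.
  rewrite /on_path; move: onpc; rewrite /on_path => onpc.
  have : out w' <= w < fin (out w') by apply: (@subtree_trans _ (p c)) => //; lia.
  by lia.
have cover v : y <= v < fin y -> on_path y w v \/ exists2 c, hanging y w c & c <= v < fin c.
  by move=> Hv; case: (boolP (on_path y w v)); [left | right; apply: hanging_cover].
have onw : on_path y w w by rewrite /on_path; have := ltn_fin tree (k := w); lia.
have toroot v : y <= v < fin y -> climbs v w.
  case/cover=> [on|[c /IHc[w' [_ on' _ reach _]] Hv]].
    by apply: (climbs_path yn _ Hp) => //; move: on; rewrite /on_path; lia.
  apply: (climbs_trans (reach v Hv)); apply: (@climbs_trans _ (out w')); first by exists 1.
  by apply: (climbs_path yn _ Hp) => //; move: on'; rewrite /on_path; lia.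
split=> //.
- move=> v Hv nvw; case/cover: (Hv) => [on|[c Hc Hvc]].
    have [||v' [e lt' sub]] := @child_toward v w; [lia| |].
      by move: on; rewrite /on_path; lia.
    have onv' : on_path y w v' by move: on; rewrite /on_path; lia.
    have -> : out v = v' by rewrite -[in LHS]e Hp //; move: on; rewrite /on_path; lia.
    split; first by lia.
    by rewrite -e (edge_sym tree) (edge_parent tree); lia.
  have [w' [[cn [Hw' Ew' Ha _]] on' H1 _ _]] := IHc c Hc.
  have [->|ne] := eqVneq v w'; first by split=> //; move: Hc; rewrite /hanging; lia.
  have [H2 H3] := H1 v Hvc ne; split=> //.
  by move/and3P: Hc => [Hc _ _]; have := @fin_subtree y c yn; lia.
- have : forall u v, u < v -> y <= u < fin y -> y <= v < fin y -> E u v -> climbs v u \/ climbs u v.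
    move=> u v lt_uv Hu Hv Euv; have Hvu := edge_subtree tree lt_uv Euv.
    have un : u < n by lia.
    case/cover: (Hv) => [on|[c Hc Hvc]].
      right; apply: (climbs_path yn _ Hp) => //; [lia| |lia].
      have : u <= w < fin u by apply: (@subtree_trans _ v) => //; move: on; rewrite /on_path; lia.
      by rewrite /on_path; lia.
    have [w' [[cn [Hw' Ew' Ha top]] on' _ reach H3]] := IHc c Hc.
    have [Huc|Huc] := boolP (c <= u < fin c).
      by case: (H3 u v Huc Hvc Euv); [right | left].
    left; have uc : u < c by lia.
    move/and3P: Hc => [Hc offc onpc].
    have : u <= c < fin u by lia.
    rewrite (subtree_parent tree) //; [|lia..] => subpc.
    have onu : u <= w < fin u by apply: (@subtree_trans _ (p c)) => //; move: onpc; rewrite /on_path; lia.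
    (* From [v] to [w'], across to the attachment, then along the path to [u], which by minimality
       is at least the attachment. *)
    apply: (climbs_trans (reach v Hvc)); apply: (@climbs_trans _ (out w')); first by exists 1.
    apply: (climbs_path yn _ Hp) => //; [lia|by rewrite /on_path; lia|].
    by apply: (top v) => //; [rewrite (edge_sym tree) | lia].
  move=> H u v Hu Hv Euv; have [lt_uv|lt_vu|<-] := ltngtP u v.
  + by case: (H u v lt_uv Hu Hv Euv); auto.
  + by apply: H => //; rewrite (edge_sym tree).
  + by left; exists 0.
Qed.

End Out.

Lemma first_child v : v < n -> v.+1 < fin v -> p v.+1 = v.
Proof.
move=> vn Hv; have vn' := leq_fin tree vn.
have : p v.+1 < v.+1 by apply: (parent_lt tree); lia.
by have := @subtree_parent _ _ _ _ tree v v.+1 vn; lia.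
Qed.

(** Children can thus be enumerated by jumping to the ends of subtrees, without stored lists. If the
    parent of [fin c] were a proper descendant of [v], it would precede [c], and its subtree,
    reaching beyond [c], would contain [c] but not the parent [v] of [c]. *)
Lemma next_sibling v c : v < n -> v < c < fin v -> p c = v -> fin c < fin v ->
  p (fin c) = v.
Proof.
move=> vn Hc e Hfc; have vn' := leq_fin tree vn; have cn : c < n by lia.
have gt_c := ltn_fin tree cn.
have lt_p : p (fin c) < fin c by apply: (parent_lt tree); lia.
have in_v : v <= p (fin c) < fin v by rewrite -(subtree_parent tree) //; lia.
have notin_c : ~~ (c <= p (fin c) < fin c) by rewrite -(subtree_parent tree) //; lia.
have [//|ne] := eqVneq (p (fin c)) v.
have pn : p (fin c) < n by lia.
have : p (fin c) <= fin c < fin (p (fin c)).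
  by rewrite (subtree_parent tree pn) ?leqnn ?(ltn_fin tree pn); lia.
move=> fin_in; have : p (fin c) <= c < fin (p (fin c)) by lia.
by rewrite (subtree_parent tree pn) ?e; lia.
Qed.

Lemma siblings_disjoint c c' : 0 < c -> c' < n -> p c = p c' -> c < c' -> fin c <= c'.
Proof.
move=> c0 c'n e lt; rewrite leqNgt; apply/negP=> lt'.
have cn : c < n by lia.
have : c <= c' < fin c by lia.
have := parent_lt tree (k := c).
by rewrite (subtree_parent tree cn) -?e; lia.
Qed.

(** A path vertex in the subtree of [c] would put [w] there too, and thus [c] on the path. *)
Lemma hanging_off_path y w c u : y < n -> fin y <= n -> hanging y w c ->
  on_path y w u -> ~~ (c <= u < fin c).
Proof.
move=> yn yn' /and3P[Hc off _] on; apply: contra off => Hu.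
have cn : c < n by lia.
have : c <= w < fin c by apply: (@subtree_trans _ u) => //; move: on; rewrite /on_path; lia.
by rewrite /on_path; lia.
Qed.

End Rerooting.

(** * Wavelet matrices *)

Definition bit (pw x : nat) : bool := odd (x %/ pw).

(* One level of a wavelet matrix: the elements with bit 0, followed by those
   with bit 1 in reverse order, so that one pass fills both ends. *)
Definition split_bit (pw : nat) (s : seq nat) : seq nat :=
  [seq x <- s | ~~ bit pw x] ++ rev [seq x <- s | bit pw x].

(** The numbers have [h + 1] bits, and the splits go from the most significant bit to the least. *)
Fixpoint wlevel (h : nat) (s : seq nat) (t : nat) : seq nat :=
  if t is t'.+1 then split_bit (2 ^ (h - t')) (wlevel h s t') else s.

Definition zeros (pw : nat) (s : seq nat) (i : nat) : nat :=
  count (fun x => ~~ bit pw x) (take i s).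

Definition segment (s : seq nat) (i j : nat) : seq nat := drop i (take j s).

Lemma size_split_bit pw s : size (split_bit pw s) = size s.
Proof.
by rewrite size_cat size_rev !size_filter addnC (count_predC (bit pw)).
Qed.

Lemma size_wlevel h s t : size (wlevel h s t) = size s.
Proof. by elim: t => //= t IH; rewrite size_split_bit. Qed.

Lemma perm_split_bit pw s : perm_eq (split_bit pw s) s.
Proof.
apply: perm_trans (_ : perm_eq _ ([seq x <- s | bit pw x] ++ [seq x <- s | ~~ bit pw x])) _.
  by rewrite perm_catC perm_cat2r perm_rev.
by rewrite perm_filterC.
Qed.

Lemma perm_wlevel h s t : perm_eq (wlevel h s t) s.
Proof. by elim: t => //= t; apply: perm_trans (perm_split_bit _ _). Qed.

Lemma count_take_C (a : pred nat) s i : i <= size s ->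
  count a (take i s) + count (fun x => ~~ a x) (take i s) = i.
Proof. by move=> Hi; rewrite (count_predC a) size_takel. Qed.

Lemma leq_zeros pw s i : i <= size s -> zeros pw s i <= i.
Proof. by move=> /(count_take_C (bit pw)); rewrite /zeros; lia. Qed.

Lemma ones_zeros pw s i : i <= size s ->
  count (bit pw) (take i s) = i - zeros pw s i.
Proof. by move=> /(count_take_C (bit pw)); rewrite /zeros; lia. Qed.

Lemma zerosS pw s i : i < size s ->
  zeros pw s i.+1 = zeros pw s i + ~~ bit pw (nth 0 s i).
Proof. by move=> Hi; rewrite /zeros (take_nth 0) // -cats1 count_cat /= addn0. Qed.

Lemma leq_zerosD pw s i j : i <= j -> zeros pw s i <= zeros pw s j.
Proof.
move=> Hij; rewrite /zeros -(subnKC Hij) takeD count_cat; exact: leq_addr.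
Qed.

Lemma zeros_segment pw s i j : i <= j ->
  zeros pw s j - zeros pw s i = count (fun x => ~~ bit pw x) (segment s i j).
Proof.
move=> Hij; rewrite /zeros /segment -{1}(cat_take_drop i (take j s)) count_cat.
by rewrite take_takel // addKn.
Qed.

Lemma nth_filter_take (a : pred nat) s i : i < size s -> a (nth 0 s i) ->
  nth 0 (filter a s) (count a (take i s)) = nth 0 s i.
Proof.
move=> Hi Ha; rewrite -{1}(cat_take_drop i s) filter_cat nth_cat size_filter.
by rewrite ltnn subnn (drop_nth 0) //= Ha.
Qed.

Lemma nth_split_bit0 pw s i : i < size s -> ~~ bit pw (nth 0 s i) ->
  nth 0 (split_bit pw s) (zeros pw s i) = nth 0 s i.
Proof.
move=> Hi H0; rewrite nth_cat size_filter.
have H := zerosS pw Hi; rewrite H0 in H.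
have -> : zeros pw s i < count (fun x => ~~ bit pw x) s.
  have := @leq_zerosD pw s i.+1 (size s) Hi.
  by rewrite H {2}/zeros take_size; lia.
exact: (nth_filter_take (a := fun x => ~~ bit pw x)).
Qed.

Lemma nth_split_bit1 pw s i : i < size s -> bit pw (nth 0 s i) ->
  nth 0 (split_bit pw s) (size s - (i - zeros pw s i)).-1 = nth 0 s i.
Proof.
move=> Hi H1; rewrite nth_cat size_filter -(ones_zeros pw (ltnW Hi)).
have C1 : count (bit pw) (take i s) < count (bit pw) s.
  have := count_cat (bit pw) (take i s) (drop i s).
  by rewrite cat_take_drop (drop_nth 0 Hi) /= H1; lia.
have C2 : count (bit pw) s + count (fun x => ~~ bit pw x) s = size s.
  exact: count_predC.
rewrite ltnNge (_ : count _ s <= _) /=; last by lia.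
have C3 : size [seq x <- s | bit pw x] = count (bit pw) s := size_filter _ _.
rewrite nth_rev C3; last by lia.
by rewrite -[RHS](nth_filter_take Hi H1); congr nth; lia.
Qed.

(** Filtering keeps consecutive elements consecutive, and counts give their new positions. An
    interval can therefore be followed from level to level by the ranks of its two ends. *)
Lemma segment_filter (a : pred nat) s i j : i <= j ->
  drop (count a (take i s)) (take (count a (take j s)) (filter a s))
  = filter a (segment s i j).
Proof.
move=> Hij.
have take_filter k : take (count a (take k s)) (filter a s) = filter a (take k s).
  by rewrite -{2}(cat_take_drop k s) filter_cat take_cat size_filter ltnn subnn take0 cats0.
rewrite take_filter /segment -{1}(cat_take_drop i (take j s)) filter_cat.
by rewrite drop_cat take_takel // size_filter ltnn subnn drop0.
Qed.

Lemma segment_split_bit0 pw s i j : i <= j ->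
  segment (split_bit pw s) (zeros pw s i) (zeros pw s j)
  = [seq x <- segment s i j | ~~ bit pw x].
Proof.
move=> Hij; rewrite -segment_filter // /segment take_cat size_filter.
case: ltnP => // H; rewrite (_ : zeros pw s j = count (fun x => ~~ bit pw x) s).
  by rewrite subnn take0 cats0 (@take_oversize _ _ [seq x <- s | ~~ _]) // size_filter.
move: H; have := count_cat (fun x => ~~ bit pw x) (take j s) (drop j s).
by rewrite cat_take_drop /zeros; lia.
Qed.

(** The ones are stored backwards: the images of the two ends are swapped, and the elements agree
    only up to order, which suffices for counting. *)
Lemma segment_split_bit1 pw s i j : i <= j -> j <= size s ->
  perm_eq (segment (split_bit pw s) (size s - (j - zeros pw s j))
             (size s - (i - zeros pw s i)))
    [seq x <- segment s i j | bit pw x].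
Proof.
move=> Hij Hj; rewrite -segment_filter // !(ones_zeros pw) //; last by lia.
rewrite /segment /split_bit.
set f0 := filter _ s; set f1 := filter _ s.
have Hsz : size f0 + size f1 = size s.
  by rewrite !size_filter addnC (count_predC (bit pw)).
have Hf1 : size f1 = count (bit pw) s := size_filter _ _.
set oi := i - _; set oj := j - _.
have Hoij : oi <= oj.
  rewrite /oi /oj -!ones_zeros //; last by lia.
  by rewrite -(subnKC Hij) takeD count_cat leq_addr.
have Hoj : oj <= size f1.
  have := count_cat (bit pw) (take j s) (drop j s).
  by rewrite cat_take_drop /oj -ones_zeros // Hf1; lia.
rewrite take_cat ltnNge (_ : size f0 <= _) /=; last by lia.
rewrite drop_cat ltnNge (_ : size f0 <= _) /=; last by lia.
have -> : size s - oi - size f0 = size f1 - oi by lia.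
have -> : size s - oj - size f0 = size f1 - oj by lia.
rewrite take_rev drop_rev size_drop perm_rev.
rewrite (_ : size f1 - (size f1 - oi) = oi); last by lia.
by rewrite (_ : _ - _ - _ = oj - oi) ?take_drop ?subnK //; lia.
Qed.

(** Prefixes of binary expansions are quotients: the bit of weight [pw] extends the prefix [q] to
    [q + q + b]. *)
Lemma bit_div pw x q b : 0 < pw -> (x %/ (pw + pw) == q) && (bit pw x == b)
  = (x %/ pw == q + q + b).
Proof.
move=> Hpw; rewrite /bit (_ : pw + pw = pw * 2) -?divnMA; last by lia.
by rewrite divnMA; case: b => /=; lia.
Qed.

Definition successor (S : seq nat) (lo q : nat) : Prop :=
  [/\ q \in S, lo <= q & forall x, x \in S -> lo <= x -> q <= x].

(** The successor of [lo] is the element whose rank is the number of elements below [lo]; [k] is its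
    rank among the copies of its value. *)
Lemma successor_rank (S : seq nat) lo q k :
  count (fun x => x < q) S + k = count (fun x => x < lo) S ->
  k < count (fun x => x == q) S -> successor S lo q.
Proof.
move=> Hk Hq.
have mono a b : a <= b -> count (fun x => x < a) S <= count (fun x => x < b) S.
  by move=> Hab; apply: sub_count => x /= Hx; apply: leq_trans Hx Hab.
have step a : count (fun x => x < a.+1) S
    = count (fun x => x < a) S + count (fun x => x == a) S.
  by elim: S {Hk Hq mono} => //= x S ->; rewrite ltnS leq_eqVlt; case: ltngtP => /=; lia.
split.
- have : 0 < count (fun x => x == q) S by lia.
  by rewrite -has_count => /hasP[x xS /eqP<-].
- by rewrite leqNgt; apply/negP=> /mono; rewrite step; lia.
- move=> x xS lox; rewrite leqNgt; apply/negP=> /mono; rewrite step.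
  have : 0 < count (fun y => y == x) S by rewrite -has_count; apply/hasP; exists x.
  by have := mono _ _ lox; lia.
Qed.

(** * Successor search by ranking and selection *)

Definition start_descent : cmd :=
  q_pw <~ var a_pw0;; q_base <~ Cst 0;;
  q_i <~ var q_lower;; q_j <~ var q_upper.

Definition read_ranks : cmd :=
  q_ri <~ Get a_rank (var q_base [+] var q_i);;
  q_rj <~ Get a_rank (var q_base [+] var q_j).

Definition go_zeros : cmd := q_i <~ var q_ri;; q_j <~ var q_rj.

Definition go_ones : cmd :=
  q_ri <~ var a_m [-] (var q_i [-] var q_ri);;
  q_i <~ var a_m [-] (var q_j [-] var q_rj);;
  q_j <~ var q_ri.

Definition next_level : cmd :=
  q_base <~ var q_base [+] (var a_m [+] Cst 1);;
  q_pw <~ var q_pw [/] Cst 2.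

(** The parity of the quotient is the next bit of [q_lo]. If it is 1, the elements with the same
    prefix and next bit 0 are smaller than [q_lo]; they number [q_rj - q_ri]. *)
Definition rank_step : cmd :=
  read_ranks;;
  q_bit <~ var q_lo [/] var q_pw;;
  q_bit <~ var q_bit [-] (var q_bit [/] Cst 2) [*] Cst 2;;
  If (var q_bit)
    (q_k <~ var q_k [+] (var q_rj [-] var q_ri);; go_ones)
    go_zeros;;
  next_level.

Definition select_step : cmd :=
  read_ranks;;
  If (var q_k [<] var q_rj [-] var q_ri)
    (q_res <~ var q_res [+] var q_res;; go_zeros)
    (q_res <~ var q_res [+] var q_res [+] Cst 1;;
     q_k <~ var q_k [-] (var q_rj [-] var q_ri);; go_ones);;
  next_level.

Definition find_successor : cmd :=
  (start_descent;; q_k <~ Cst 0);;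
  While (var q_pw) rank_step;;
  (start_descent;; q_res <~ Cst 0);;
  While (var q_pw) select_step.

(** A row has one cell more than there are points, for the ranks of all prefixes including the full
    one. Searches rebuild values from the bits of their descent. *)
Definition wavelet_mem (h : nat) (pts : seq nat) (s : memory) : Prop :=
  [/\ s a_m 0 = size pts, s a_pw0 0 = 2 ^ h &
   forall t i, t <= h -> i <= size pts ->
     s a_rank (t * (size pts).+1 + i) = zeros (2 ^ (h - t)) (wlevel h pts t) i].

Section Successor.

Context (w : nat) (w_ge6 : 5 < w).
Context (h : nat) (pts : seq nat) (s0 : memory).
Context (wav : wavelet_mem h pts s0).
Context (h_word : 2 ^ h.+2 <= 2 ^ w) (S_word : h.+2 * (size pts).+1 < 2 ^ w).
Context (l u : nat) (le_lu : l <= u) (le_u : u <= size pts).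

Definition range : seq nat := segment pts l u.

(* The weight of the lowest bit that has been decided before level t. *)
Definition weight (t : nat) : nat := 2 ^ (h.+1 - t).

(** The invariant of a descent: a binary prefix [q] corresponds to an interval of level [t], with no
    claim on the order inside. *)
Definition at_level (t q i j : nat) : Prop :=
  [/\ t <= h.+1, i <= j, j <= size pts &
   perm_eq (segment (wlevel h pts t) i j) [seq x <- range | x %/ weight t == q]].

Lemma weightS t : t <= h -> weight t = weight t.+1 + weight t.+1.
Proof. by move=> Ht; rewrite /weight subSS subSn // expnS mul2n addnn. Qed.

Lemma at_level_step t q i j (b : bool) : t <= h -> at_level t q i j ->
  let z := zeros (2 ^ (h - t)) (wlevel h pts t) in
  at_level t.+1 (q + q + b) (if b then size pts - (j - z j) else z i)
    (if b then size pts - (i - z i) else z j).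
Proof.
move=> Ht [_ Hij Hj Hp] z.
have E : [seq x <- range | x %/ weight t.+1 == q + q + b]
   = [seq x <- [seq x <- range | x %/ weight t == q] | bit (weight t.+1) x == b].
  rewrite -filter_predI; apply: eq_filter => x /=.
  by rewrite andbC (weightS Ht) bit_div // expn_gt0.
have Hz := leq_zerosD (2 ^ (h - t)) (wlevel h pts t) Hij.
have Hzi : z i <= i by rewrite leq_zeros // size_wlevel; lia.
have Hzj : z j <= j by rewrite leq_zeros // size_wlevel; lia.
have Hoij : i - z i <= j - z j.
  rewrite -!ones_zeros ?size_wlevel //; last by lia.
  by rewrite -(subnKC Hij) takeD count_cat leq_addr.
split=> //; [by rewrite -/z in Hz; case: (b); lia| by case: (b); lia|].
rewrite E; apply: perm_trans (perm_filter _ Hp).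
have -> : weight t.+1 = 2 ^ (h - t) by rewrite /weight subSS.
case: b {E} => /=.
  rewrite -(size_wlevel h pts t).
  rewrite (eq_filter (a2 := bit (2 ^ (h - t)))); last by move=> x; rewrite eqb_id.
  by apply: segment_split_bit1; rewrite ?size_wlevel.
rewrite (eq_filter (a2 := fun x => ~~ bit (2 ^ (h - t)) x)); last by move=> x; rewrite eqbF_neg.
by rewrite segment_split_bit0.
Qed.

Lemma at_level0 : all (fun x => x < 2 ^ h.+1) pts -> at_level 0 0 l u.
Proof.
move=> /allP HS; split=> //.
rewrite (eq_in_filter (a2 := predT)) ?filter_predT // => x.
move=> /mem_drop/mem_take/HS Hx.
by rewrite divn_small.
Qed.

Lemma count_level t q i j : t <= h -> at_level t q i j ->
  let z := zeros (2 ^ (h - t)) (wlevel h pts t) in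
  z j - z i = count (fun x => x %/ weight t.+1 == q + q) range.
Proof.
move=> Ht [_ Hij Hj Hp] z; rewrite zeros_segment //.
rewrite (permP Hp) count_filter; apply: eq_count => x /=.
have := @bit_div (weight t.+1) x q false; rewrite addn0 => <-; rewrite ?expn_gt0 //.
by rewrite andbC -(weightS Ht) eqbF_neg /weight subSS.
Qed.

Lemma count_lt_step t q (b : bool) : t <= h ->
  count (fun x => x %/ weight t.+1 < q + q + b) range
  = count (fun x => x %/ weight t < q) range
    + (if b then count (fun x => x %/ weight t.+1 == q + q) range else 0).
Proof.
move=> Ht; rewrite (_ : weight t = weight t.+1 * 2); last first.
  by rewrite weightS // muln2 addnn.
move: (weight t.+1) => W; elim: range => [|x S1 /= ->]; first by case: b.
by rewrite divnMA; case: b; lia.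
Qed.

Context (lo : nat) (lo_lt : lo < 2 ^ h.+1).
Context (pts_lt : all (fun x => x < 2 ^ h.+1) pts).


Lemma weight_half t : t <= h -> weight t %/ 2 = weight t.+1.
Proof. by move=> Ht; rewrite weightS // addnn divn2 doubleK. Qed.

Lemma weight_last t : t <= h.+1 -> weight t %/ 2 = 0 -> t = h.+1.
Proof.
move=> Ht; case: ltngtP Ht => // lt_t _; rewrite weight_half // => /eqP.
by rewrite expn_eq0.
Qed.

Let z t := zeros (2 ^ (h - t)) (wlevel h pts t).

Lemma div_weightS x t : t <= h -> x %/ weight t.+1
  = x %/ weight t + x %/ weight t + bit (weight t.+1) x.
Proof.
move=> Ht; apply/eqP; rewrite -bit_div ?expn_gt0 // -(weightS Ht).
by rewrite !eqxx.
Qed.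

Lemma range_word : size range + size pts < 2 ^ w.
Proof.
apply: leq_ltn_trans S_word; rewrite mulSn.
have : size range <= size pts by rewrite size_drop size_takel //; lia.
have : (size pts).+1 <= h.+1 * (size pts).+1 by rewrite leq_pmull.
by lia.
Qed.

Lemma level_facts s t q i j : frame (modified find_successor) s0 s ->
  t <= h -> at_level t q i j ->
  [/\ s a_m 0 = size pts,
      s a_rank (times t (size pts).+1 + i) = z t i
      /\ s a_rank (times t (size pts).+1 + j) = z t j,
      times t (size pts).+1 + (size pts).+1 < 2 ^ w,
      z t i <= z t j & z t i <= i <= j /\ z t j <= j <= size pts].
Proof.
move=> F Ht [_ Hij Hj _]; have [Hm _ Hr] := wav.
rewrite !F // Hm !Hr //; try lia.
split=> //.
- apply: leq_ltn_trans S_word; rewrite /times addnC -mulSn leq_mul2r; lia.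
- exact: leq_zerosD.
- by rewrite !leq_zeros ?size_wlevel ?Hij ?Hj //; lia.
Qed.

Lemma run_rank s K : K = max_cost rank_step + 3 ->
  frame (modified find_successor) s0 s ->
  s q_pw 0 = 2 ^ h -> s q_base 0 = 0 -> s q_i 0 = l -> s q_j 0 = u ->
  s q_k 0 = 0 -> s q_lo 0 = lo ->
  run w (While (var q_pw) rank_step) (times h.+1 K + 3) s
    (fun _ s' => s' q_k 0 = count (fun x => x < lo) range).
Proof.
(* In the invariant [q_pw] is [weight t %/ 2], the weight of the bit examined next. After the last
   level this is [1 %/ 2 = 0], which ends the loop. *)
move=> EK F Hpw Hb Hi Hj Hk Hlo.
pose I (phi : nat) (s1 : memory) := exists t i j,
  [/\ at_level t (lo %/ weight t) i j,
   s1 q_pw 0 = weight t %/ 2 /\ s1 q_base 0 = times t (size pts).+1,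
   s1 q_i 0 = i /\ s1 q_j 0 = j,
   s1 q_k 0 = count (fun x => x %/ weight t < lo %/ weight t) range
   & times (h.+1 - t) K + 3 <= phi].
apply: (@run_while w w_ge6 _ _ I) => //.
  exists 0, l, u; rewrite Hpw Hk Hb Hi Hj subn0 weight_half ?/weight ?subSS ?subn0 //.
  split=> //; first by rewrite divn_small //; apply: at_level0.
  rewrite (divn_small lo_lt) (eq_count (a2 := pred0)) ?count_pred0 //.
move=> phi1 s1 [t [i [j [Hlev [Hpw1 Hb1] [Hi1 Hj1] Hk1 Hphi]]]] F1.
split=> //; exists (phi1 - 3) => /=; first by lia.
rewrite Hpw1; case: ifPn => [Hw|]; last first.
  rewrite negbK => /eqP/weight_last Ht; case: (Hlev) => /Ht e _ _ _.
  rewrite Hk1 e /weight subnn; apply: eq_count => x.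
  by rewrite !divn1.
have Ht : t <= h.
  case: Hlev Hw => Ht _ _ _; rewrite leqNgt; apply: contraNN => lt_ht.
  by rewrite (_ : t = h.+1) ?/weight ?subnn //; lia.
rewrite weight_half // in Hpw1 *.
apply: (run_block w_ge6 (phi' := phi1 - K)) => //.
  by move: Hphi; rewrite subSn // timesS; lia.
have F2 : frame (modified find_successor) s0 s1 by apply: frame_trans F F1.
have Hlo1 : s1 q_lo 0 = lo by rewrite F1.
have [Hm [Hri Hrj] Hw1 Hz [/andP[? ?] /andP[? ?]]] := level_facts F2 Ht Hlev.
have HI b k s2 : s2 q_pw 0 = weight t.+1 %/ 2 ->
  s2 q_base 0 = times t (size pts).+1 + (size pts + 1) ->
  b = bit (weight t.+1) lo ->
  s2 q_i 0 = (if b then size pts - (j - z t j) else z t i) ->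
  s2 q_j 0 = (if b then size pts - (i - z t i) else z t j) ->
  s2 q_k 0 = s1 q_k 0 + k ->
  k = (if b then z t j - z t i else 0) -> I (phi1 - K) s2.
  move=> E1 E2 Eb E3 E4 E5 Ek.
  exists t.+1, (if b then size pts - (j - z t j) else z t i),
    (if b then size pts - (i - z t i) else z t j).
  split; last by move: Hphi; rewrite subSS subSn // timesS; lia.
  - rewrite (div_weightS lo Ht) -Eb; exact: at_level_step Hlev.
  - by rewrite E1 E2 timesS; split=> //; lia.
  - by rewrite E3 E4; split.
  - rewrite E5 Hk1 Ek (div_weightS lo Ht) -Eb count_lt_step //.
    by case: (b) => //; rewrite (count_level Ht Hlev).
set B := 2 ^ w in Hw1 *; have HB : 2 ^ h.+2 <= B := h_word.
have lo_B : lo < B by apply: leq_trans HB; apply: leq_trans lo_lt _; rewrite leq_exp2l.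
have w_B : weight t.+1 < B.
  by apply: leq_trans HB; rewrite ltn_exp2l //; lia.
have bitE : (lo %/ weight t.+1 - (lo %/ weight t.+1) %/ 2 * 2 != 0) = bit (weight t.+1) lo.
  by rewrite /bit; lia.
have lo_div : lo %/ weight t.+1 <= lo by exact: leq_div.
have k_B : s1 q_k 0 + size pts < B.
  by rewrite Hk1; apply: leq_ltn_trans range_word; rewrite leq_add2r count_size.
clearbody B.
rewrite /= Hb1 Hi1 Hj1 Hpw1 Hri Hrj Hm Hlo1 bitE; vc; try lia.
case: ifP => b1; vc; try lia.
  by apply: (HI true (z t j - z t i)).
by apply: (HI false 0); rewrite //= addn0.
Qed.

Lemma run_select s K k : K = max_cost select_step + 3 ->
  frame (modified find_successor) s0 s ->
  s q_pw 0 = 2 ^ h -> s q_base 0 = 0 -> s q_i 0 = l -> s q_j 0 = u ->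
  s q_k 0 = k -> s q_res 0 = 0 -> k < size range ->
  run w (While (var q_pw) select_step) (times h.+1 K + 3) s
    (fun _ s' => exists2 k', count (fun x => x < s' q_res 0) range + k' = k &
       k' < count (fun x => x == s' q_res 0) range).
Proof.
move=> EK F Hpw Hb Hi Hj Hk Hq lt_k.
(* The element of rank [k] has prefix [q], and [k'] is its rank among the elements with this
   prefix. *)
pose I (phi : nat) (s1 : memory) := exists t i j q k',
  [/\ at_level t q i j,
   [/\ s1 q_pw 0 = weight t %/ 2, s1 q_base 0 = times t (size pts).+1
     & s1 q_res 0 = q],
   [/\ s1 q_i 0 = i, s1 q_j 0 = j & s1 q_k 0 = k'],
   count (fun x => x %/ weight t < q) range + k' = k
   /\ k' < count (fun x => x %/ weight t == q) range
   & times (h.+1 - t) K + 3 <= phi].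
apply: (@run_while w w_ge6 _ _ I) => //.
  exists 0, l, u, 0, k; rewrite Hpw Hk Hb Hi Hj subn0 weight_half ?/weight ?subSS ?subn0 //.
  split=> //; first exact: at_level0.
  split; first by rewrite (eq_count (a2 := pred0)) ?count_pred0.
  have [_ _ _ /perm_size] := at_level0 pts_lt.
  by rewrite size_filter => /eq_leq; apply: (leq_trans lt_k).
move=> phi1 s1 [t [i [j [q [k' [Hlev [Hpw1 Hb1 Hq1] [Hi1 Hj1 Hk1] [Hk2 Hk3] Hphi]]]]]] F1.
split=> //; exists (phi1 - 3) => /=; first by lia.
rewrite Hpw1; case: ifPn => [Hw|]; last first.
  rewrite negbK => /eqP/weight_last Ht; case: (Hlev) => /Ht e _ _ _.
  exists k'; [rewrite -Hk2; congr addn|apply: leq_trans Hk3 _; apply: sub_count];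
    rewrite ?e /weight ?subnn ?Hq1; last by move=> x; rewrite divn1.
  by apply: eq_count => x; rewrite divn1.
have Ht : t <= h.
  case: Hlev Hw => Ht _ _ _; rewrite leqNgt; apply: contraNN => lt_ht.
  by rewrite (_ : t = h.+1) ?/weight ?subnn //; lia.
rewrite weight_half // in Hpw1 *.
apply: (run_block w_ge6 (phi' := phi1 - K)) => //.
  by move: Hphi; rewrite subSn // timesS; lia.
have F2 : frame (modified find_successor) s0 s1 by apply: frame_trans F F1.
have [Hm [Hri Hrj] Hw1 Hz [/andP[? ?] /andP[? ?]]] := level_facts F2 Ht Hlev.
have HI (b : bool) s2 : s2 q_pw 0 = weight t.+1 %/ 2 ->
  s2 q_base 0 = times t (size pts).+1 + (size pts + 1) ->
  s2 q_res 0 = q + q + b ->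
  s2 q_i 0 = (if b then size pts - (j - z t j) else z t i) ->
  s2 q_j 0 = (if b then size pts - (i - z t i) else z t j) ->
  s2 q_k 0 = k' - (if b then z t j - z t i else 0) ->
  b = ~~ (k' < z t j - z t i) -> I (phi1 - K) s2.
  move=> E1 E2 E3 E4 E5 E6 Eb.
  exists t.+1, (if b then size pts - (j - z t j) else z t i),
    (if b then size pts - (i - z t i) else z t j), (q + q + b),
    (k' - (if b then z t j - z t i else 0)).
  have Hz' := count_level Ht Hlev; rewrite -/(z t) /= in Hz'.
  split; last by move: Hphi; rewrite subSS subSn // timesS; lia.
  - exact: at_level_step b Ht Hlev.
  - by rewrite E1 E2 timesS; split=> //; lia.
  - by rewrite E4 E5 E6; split.
  - split; first by rewrite count_lt_step // -Hz' -Hk2 Eb; case: ltnP => /=; lia.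
    case: b Eb {E3 E4 E5 E6} => Eb; last by rewrite addn0 -Hz'; lia.
    have : count (fun x => x %/ weight t == q) range
      = count (fun x => x %/ weight t.+1 == q + q) range
        + count (fun x => x %/ weight t.+1 == q + q + true) range.
      have Hwt := weightS Ht.
      elim: (range) => //= x r ->.
      by rewrite (div_weightS x Ht); case: bit; lia.
    by rewrite -Hz' /=; lia.
set B := 2 ^ w in Hw1 *; have HB : 2 ^ h.+2 <= B := h_word.
have w_B : weight t.+1 < B.
  by apply: leq_trans HB; rewrite ltn_exp2l //; lia.
have q_B : q + q + 1 < B.
  have : 0 < count (fun x => x %/ weight t == q) range by lia.
  rewrite -has_count => /hasP[x x_in /eqP<-].
  have : x < 2 ^ h.+1.
    by move/allP: pts_lt; apply; apply: mem_take (mem_drop x_in).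
  have := leq_div x (weight t).
  by move: HB; rewrite expnS; lia.
have k_B : k' < B.
  apply: leq_ltn_trans range_word.
  by have := count_size (fun x => x %/ weight t == q) range; lia.
clearbody B.
rewrite /= Hb1 Hi1 Hj1 Hpw1 Hri Hrj Hm Hk1 Hq1; vc; try lia.
case: ifP => b1; vc; try lia.
  by apply: (HI false); rewrite //= ?b1 ?addn0 ?subn0.
by apply: (HI true); rewrite //= b1.
Qed.

Lemma run_find_successor K :
  K = max_cost rank_step + 3 + (max_cost select_step + 3) + 40 ->
  s0 q_lower 0 = l -> s0 q_upper 0 = u -> s0 q_lo 0 = lo ->
  has (fun x => lo <= x) range ->
  run w find_successor (times h.+2 K) s0
    (fun _ s' => successor range lo (s' q_res 0)).
Proof.
move=> EK Hl Hu Hlo Hhas; have [Hm Hpw _] := wav.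
(* An element that is at least [lo] makes the number of smaller ones a valid rank for the
   selection. *)
have k_lt : count (fun x => x < lo) range < size range.
  rewrite -(count_predC (fun x => lo <= x)) -[X in X < _]add0n -addSn.
  by apply: leq_add; [rewrite -has_count | apply: sub_count => x /=; lia].
have HB : 0 < 2 ^ w by rewrite expn_gt0.
set K1 := max_cost rank_step + 3 in EK; set K2 := max_cost select_step + 3 in EK.
(* Each loop takes [h + 1] turns; the further [K] is available for the initialisations and the final
   tests. *)
have Hphi : times h.+2 K = times h.+1 K1 + times h.+1 K2 + times h.+1 40 + K.
  by rewrite timesS {1}EK !timesD.
have HK : 46 <= K by lia.
apply: (run_block_seq w_ge6 (phi1 := times h.+2 K - 20)) => //; first by rewrite /=; lia.
rewrite /=; vc => //; set s1 := upd _ _ _ _ => F0.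
have F1 : frame (modified find_successor) s0 s1 by apply: frame_trans F0.
apply: (run_call w_ge6 (run_rank (erefl K1) F1 _ _ _ _ _ _)
  (phi2 := times h.+2 K - 20 - (times h.+1 K1 + 3))) => //=; first by lia.
move=> s2 Hk2 F2; have F3 : frame (modified find_successor) s0 s2 by apply: frame_trans F1 F2.
apply: (run_block_seq w_ge6 (phi1 := times h.+1 K2 + 3)) => //=; first by lia.
vc => // F4.
apply: (run_last w_ge6 (run_select (erefl K2) _ _ _ _ _ _ _ k_lt) (phi2 := 0));
  rewrite ?addn0 //; first by apply: (frame_trans _ F3 F4).
1-3: by rewrite /= ?F2 ?F3.
by move=> s' [k' H1 H2] _; apply: successor_rank H1 H2.
Qed.

End Successor.

(** * Rerooting with explicit stacks *)

Section Walk.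

Context (n : nat) (E : rel nat) (p fin : nat -> nat).
Context (tree : preorder_tree n E p fin).
Context (y w a : nat) (yn : y < n) (w_in : y <= w < fin y).

(* The request to reroot at [it.1.2] the subtree of [it.1.1], with [it.2] as the
   parent of the new root. *)
Definition request : Type := nat * nat * nat.

Notation on := (on_path fin y w).

(* State of the walk from w up to y: the path vertices from lim on are done, v is
   the next one and prev the one before it. *)
Definition walking (lim v prev : nat) : Prop :=
  [/\ lim = w.+1, v = w & prev = a] \/ [/\ on lim, v = p lim & prev = lim].

Let fin_y : fin y <= n := leq_fin tree yn.

Lemma on_bound u : on u -> y <= u < n.
Proof. by rewrite /on_path; lia. Qed.

Lemma on_parent u : on u -> u != y -> on (p u).
Proof.
move=> onu ne; have un : u < n by have := on_bound onu; lia.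
move: onu; rewrite /on_path => onu.
have pu : p u < u by apply: (parent_lt tree); lia.
have : y <= p u < fin y by rewrite -(subtree_parent tree) //; lia.
have pun : p u < n by lia.
have : p u <= u < fin (p u).
  by rewrite (subtree_parent tree pun) ?leqnn ?(ltn_fin tree pun); lia.
by move=> Hu; have := @subtree_trans _ _ _ _ tree (p u) u w pun Hu; lia.
Qed.

Lemma walking_on lim v prev : walking lim v prev -> prev != y -> on v.
Proof.
case=> [[_ -> _]|[onl -> ->]] ne; last exact: on_parent.
by rewrite /on_path; have := ltn_fin tree (k := w); lia.
Qed.

(** Path vertices form a chain, so one that precedes [lim] is a proper ancestor of [lim], hence at
    most its parent. *)
Lemma path_gap lim x : on lim -> lim != y -> on x -> p lim < x -> lim <= x.
Proof.
move=> onl ne onx lt; rewrite leqNgt; apply/negP=> lt'.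
have := on_bound onl; have xn : x < n by have := on_bound onx; lia.
have : x <= lim < fin x by move: onl onx; rewrite /on_path; lia.
by move=> H ?; move: H; rewrite (subtree_parent tree xn); lia.
Qed.

Lemma on_path_child lim x : on lim -> lim != y -> on x -> x != y -> p x = p lim ->
  x = lim.
Proof.
move=> onl nel onx nex e.
have ltl : p lim < lim by apply: (parent_lt tree); have := on_bound onl; lia.
have ltx : p x < x by apply: (parent_lt tree); have := on_bound onx; lia.
have le1 : x <= lim by apply: path_gap; rewrite // e.
have le2 : lim <= x by apply: path_gap; rewrite // -e.
by lia.
Qed.

Definition path_written (out0 : nat -> nat) (lim : nat) (out : nat -> nat) : Prop :=
  [/\ forall u, on u -> u != y -> lim <= p u -> out (p u) = u,
      lim <= w -> out w = a
    & forall u, ~~ (on u && (lim <= u)) -> out u = out0 u].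

Lemma path_written_step out0 lim v prev out out' : walking lim v prev ->
  prev != y -> path_written out0 lim out ->
  (forall u, out' u = if u == v then prev else out u) ->
  path_written out0 v out'.
Proof.
move=> W nep [H1 H2 H3] Hout.
have onv := walking_on W nep; have := on_bound onv => v_in.
split.
- move=> u onu neu le_v; rewrite Hout.
  have onpu := on_parent onu neu.
  have [e|ne] := eqVneq (p u) v.
    case: W => [[_ ev _]|[onl ev ep]].
      have := parent_lt tree (k := u); have := on_bound onu.
      by move: onu; rewrite /on_path; lia.
    by rewrite (@on_path_child lim u) // ?e ?ev // -ep.
  apply: H1 => //; case: W => [[_ ev _]|[onl ev ep]].
    by move: onpu; rewrite /on_path; lia.
  by apply: path_gap => //; [rewrite -ep | rewrite -ev; lia].
- move=> le_vw; rewrite Hout; case: eqP => [e|ne].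
    case: W => [[_ _ ->]//|[onl ev ep]].
    move: onv onl; rewrite /on_path => onv onl.
    by have := parent_lt tree (k := lim); rewrite -ev -ep in nep *; lia.
  case: W => [[_ ev _]|[onl ev _]]; first by rewrite ev in ne.
  by apply: H2; move: onl; rewrite /on_path; lia.
- move=> u Hu; rewrite Hout; case: eqP => [e|ne].
    by move: Hu; rewrite e onv leqnn.
  apply: H3; apply: contraNN Hu => /andP[-> Hl] /=.
  case: W => [[el ev _]|[onl ev ep]]; first by lia.
  apply: leq_trans Hl; rewrite ev ltnW // (parent_lt tree) //.
  by rewrite ep in nep; have := on_bound onl; lia.
Qed.

Definition disjoint_requests (it it' : request) : bool :=
  (fin it.1.1 <= it'.1.1) || (fin it'.1.1 <= it.1.1).

Definition requests_for (R : pred nat) (its : seq request) : Prop :=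
  [/\ forall it, it \in its ->
        [/\ hanging p fin y w it.1.1, R it.1.1
          & top_edge E fin y it.1.1 it.1.2 it.2],
      forall c, hanging p fin y w c -> R c -> c \in [seq it.1.1 | it <- its]
    & pairwise disjoint_requests its].

(** Which hanging subtrees have been met: those at finished path vertices and, among the children of
    the current vertex [v], those before [c]. *)
Definition before (lim v c c' : nat) : bool :=
  (lim <= p c') || ((p c' == v) && (c' < c)).

Lemma eq_requests_for (R R' : pred nat) its :
  (forall c, hanging p fin y w c -> R c = R' c) ->
  requests_for R its -> requests_for R' its.
Proof.
move=> eqR [H1 H2 H3]; split=> //.
- by move=> it /H1[Hh HR Ht]; rewrite -eqR.
- by move=> c Hh; rewrite -eqR // => HR; apply: H2.
Qed.

Lemma hanging_bound c : hanging p fin y w c -> 0 < c < n.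
Proof. by rewrite /hanging; lia. Qed.

Lemma requests_start lim v its :
  requests_for (fun c => lim <= p c) its ->
  requests_for (before lim v v.+1) its.
Proof.
apply: eq_requests_for => c /hanging_bound c_in; rewrite /before.
by have := parent_lt tree c_in; lia.
Qed.

(** Nothing is missed between [v] and [lim]: by [path_gap] there is no path vertex strictly between
    them. *)
Lemma requests_stop lim v prev its : walking lim v prev -> prev != y ->
  requests_for (before lim v (fin v)) its ->
  requests_for (fun c => v <= p c) its.
Proof.
move=> W nep; apply: eq_requests_for => c Hh; rewrite /before.
have c_in := hanging_bound Hh; have pc := parent_lt tree c_in.
case/and3P: Hh => [Hc _ onpc]; have onv := walking_on W nep.
have vn := on_bound onv; have vn' : v < n by lia.
have [e|ne] /= := eqVneq (p c) v.
  have : v <= c < fin v.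
    by rewrite (subtree_parent tree vn') ?e ?leqnn ?(ltn_fin tree vn'); lia.
  by rewrite e; lia.
rewrite orbF; case: W => [[el ev _]|[onl ev ep]].
  by move: onpc; rewrite /on_path; lia.
have := path_gap onl _ onpc; rewrite -ev -ep nep => /(_ isT).
have := parent_lt tree (k := lim); rewrite -ev.
by have := on_bound onl; lia.
Qed.

(** The child of [v] on the path roots no hanging subtree, so passing it calls for no request. *)
Lemma requests_skip lim v its : on lim -> lim != y -> v = p lim ->
  requests_for (before lim v lim) its ->
  requests_for (before lim v (fin lim)) its.
Proof.
move=> onl nel ev; apply: eq_requests_for => c Hh; rewrite /before.
have c_in := hanging_bound Hh; have pc := parent_lt tree c_in.
have := on_bound onl => l_in.
have [//|nlim] := leqP lim (p c); rewrite /=.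
have [e|//] /= := eqVneq (p c) v.
have [lt|lt|el] := ltngtP lim c.
- by have := @siblings_disjoint _ _ _ _ tree lim c; rewrite e -ev; lia.
- by have := ltn_fin tree (k := lim); lia.
- by move: Hh; rewrite /hanging -el onl andbF.
Qed.

(** The new subtree is disjoint from the earlier ones, since these are rooted at smaller siblings of
    [c] or lie inside the subtree of the sibling [lim] of [c]. *)
Lemma requests_push lim v prev c its it : walking lim v prev -> prev != y ->
  v < c < fin v -> p c = v -> c != prev -> it.1.1 = c ->
  top_edge E fin y c it.1.2 it.2 ->
  requests_for (before lim v c) its ->
  requests_for (before lim v (fin c)) (rcons its it).
Proof.
move=> W nep Hc epc ncp eit top [H1 H2 H3].
have onv := walking_on W nep; have vn := on_bound onv.
have vn' : v < n by lia.
have fv : fin v <= fin y.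
  by apply: (fin_subtree tree) => //; move: onv; rewrite /on_path; lia.
have cfin := @ltn_fin _ _ _ _ tree c; have cn : c < n by lia.
have lim_ne : lim <= w -> [/\ on lim, prev = lim, v = p lim & lim != y].
  by case: W => [[-> _ _]|[onl ev ep]]; rewrite ?ltnn // => _; split=> //; rewrite -ep.
have hc : hanging p fin y w c.
  rewrite /hanging epc onv andbT; apply/andP; split; first by lia.
  apply: contraNN ncp => onc; case: W => [[_ ev _]|[onl ev ep]].
    by move: onc; rewrite /on_path; lia.
  by rewrite ep; apply/eqP; apply: on_path_child; rewrite // ?epc // -?ep //; lia.
split.
- move=> it'; rewrite mem_rcons inE => /predU1P[->|/H1[h R t]].
    by split; rewrite ?eit // /before epc eqxx (cfin cn) orbT.
  by split=> //; move: R; rewrite /before; have := cfin cn; lia.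
- move=> c' h' R'; rewrite map_rcons mem_rcons inE eit; apply/orP.
  have [->|ne] := eqVneq c' c; [by left | right].
  apply: H2 => //; move: R'; rewrite /before => /orP[->//|/andP[/eqP e lt]].
  rewrite e eqxx /=; apply/orP; right; have [//|lt'] := ltnP c' c.
  have := @siblings_disjoint _ _ _ _ tree c c'.
  by have := hanging_bound h'; rewrite e epc; lia.
- rewrite -cats1 pairwise_cat H3 /= andbT allrel1r; apply/allP => it' /H1[].
  rewrite /disjoint_requests eit; move: it'.1.1 => c' h' R' _.
  have c'_in := hanging_bound h'.
  have pc' := parent_lt tree c'_in.
  move: R'; rewrite /before => /orP[le_lim|/andP[/eqP e lt]]; last first.
    by have := @siblings_disjoint _ _ _ _ tree c' c; rewrite e epc; lia.
  case/and3P: h' => h1 _ onpc'.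
  have [|onl ep ev nel] := lim_ne; first by move: onpc'; rewrite /on_path; lia.
  have l_in := on_bound onl; have ln : lim < n by lia.
  have in_lim : lim <= c' < fin lim.
    rewrite (subtree_parent tree ln) //; last by lia.
    by move: onpc' onl; rewrite /on_path; lia.
  have flim := fin_subtree tree ln in_lim.
  have [lt|lt|el] := ltngtP lim c.
  + by have := @siblings_disjoint _ _ _ _ tree lim c; rewrite -ev epc; lia.
  + by have := @siblings_disjoint _ _ _ _ tree c lim; rewrite -ev epc; lia.
  + by rewrite ep el eqxx in ncp.
Qed.

End Walk.

Definition push_child : cmd :=
  (q_lower <~ Get a_ps (var v_c);;
   q_upper <~ Get a_ps (Get a_fin (var v_c));;
   q_lo <~ var v_y [*] var a_n);;
  find_successor;;
  (Assign r_y (var r_sp) (var v_c);;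
   Assign r_a (var r_sp) (var q_res [/] var a_n);;
   Assign r_w (var r_sp)
     (var q_res [-] (var q_res [/] var a_n) [*] var a_n);;
   r_sp <~ var r_sp [+] Cst 1).

(** The child on the path is recognised as [v_prev]. At the start of a walk [v_prev] is the
    attachment, which lies outside the subtree and so equals no child. *)
Definition child_step : cmd :=
  If (var v_c [==] var v_prev) Skip push_child;;
  v_c <~ Get a_fin (var v_c).

Definition path_step : cmd :=
  (Assign a_out (var v_v) (var v_prev);; v_c <~ var v_v [+] Cst 1);;
  While (var v_c [<] Get a_fin (var v_v)) child_step;;
  (v_prev <~ var v_v;; v_v <~ Get a_pp (var v_v)).

Definition serve_request : cmd :=
  (r_sp <~ var r_sp [-] Cst 1;;
   v_y <~ Get r_y (var r_sp);;
   v_v <~ Get r_w (var r_sp);;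
   v_prev <~ Get r_a (var r_sp));;
  While ((var v_prev [==] var v_y) [==] Cst 0) path_step.

Definition serve_requests : cmd := While (var r_sp) serve_request.

Definition query_cost (h : nat) : nat :=
  times h.+2 (max_cost rank_step + 3 + (max_cost select_step + 3) + 40).

(* An edge from k to u is listed as the number u * n + k, by increasing k; the
   edges from k start at index ps k. *)
Definition points_listed (n h : nat) (E : rel nat) (ps : nat -> nat)
    (pts : seq nat) : Prop :=
  [/\ forall i j, i <= j <= n -> ps i <= ps j <= size pts,
      forall i j x, i <= j <= n -> (x \in segment pts (ps i) (ps j))
        = (i <= x %% n < j) && E (x %% n) (x %/ n)
    & all (fun x => x < 2 ^ h.+1) pts].

Section Serve.

Context (n : nat) (E : rel nat) (p fin : nat -> nat).
Context (tree : preorder_tree n E p fin).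
Context (h : nat) (ps : nat -> nat) (pts : seq nat).
Context (listed : points_listed n h E ps pts).

(** Codes compare upper endpoints first. The edge from [c] to its parent bounds the minimum, so the
    endpoint found is smaller than [c]; the search bound [y * n] keeps it at least [y]. *)
Lemma top_edge_successor y c q : 0 < c < n -> y <= p c ->
  successor (segment pts (ps c) (ps (fin c))) (y * n) q ->
  top_edge E fin y c (q %% n) (q %/ n).
Proof.
move=> c_in le_y; have cn : c < n by lia.
have c_fin := ltn_fin tree cn; have fin_n := leq_fin tree cn.
have [_ mem_pts _] := listed; have cc : c <= fin c <= n by lia.
have code u b : u < n -> ((b * n + u) %% n = u) * ((b * n + u) %/ n = b).
  by move=> un; split; [rewrite modnMDl modn_small | rewrite divnMDl ?divn_small ?addn0 //; lia].
case; rewrite mem_pts // => /andP[q_in Eq] le_lo q_min.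
have le_q u b : c <= u < fin c -> E u b -> y <= b -> q %/ n <= b.
  move=> Hu Eub le_yb; have un : u < n by lia.
  rewrite -[leqRHS](code u b un).2; apply: leq_div2r; apply: q_min.
    by rewrite mem_pts // !code // Hu.
  by apply: leq_trans (leq_addr _ _); rewrite leq_mul2r le_yb orbT.
have pc := parent_lt tree c_in.
split=> //.
- have := le_q c (p c); rewrite leqnn c_fin (edge_parent tree) //.
  move=> /(_ isT isT le_y) le_pc; apply/andP; split; last by lia.
  by rewrite leq_divRL //; lia.
Qed.

Definition tree_mem (s : memory) : Prop :=
  [/\ s a_n 0 = n, forall k, k < n -> s a_pp k = p k /\ s a_fin k = fin k,
      forall k, k <= n -> s a_ps k = ps k & wavelet_mem h pts s].

Lemma tree_mem_frame l s s1 :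
  all (fun a => a \notin l) [:: a_n; a_pp; a_fin; a_ps; a_rank; a_m; a_pw0] ->
  frame l s s1 -> tree_mem s -> tree_mem s1.
Proof.
case/and5P=> H1 H2 H3 H4 /and4P[H5 H6 H7 _] F [M1 M2 M3 [M4 M5 M6]].
split; [|by move=> k kn; rewrite !F //; apply: M2|by move=> k kn; rewrite F //; apply: M3|].
  by rewrite F.
by split; rewrite ?F // => t i Ht Hi; rewrite F //; apply: M6.
Qed.

Context (w : nat) (w_ge6 : 5 < w).
Context (h_word : 2 ^ h.+2 <= 2 ^ w) (pts_word : h.+2 * (size pts).+1 < 2 ^ w).
Context (n_word : n * n <= 2 ^ h) (n2_word : n + n + 8 < 2 ^ w).

Lemma run_push_child s y c : tree_mem s -> 0 < c < n -> y <= p c ->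
  s v_y 0 = y -> s v_c 0 = c -> s r_sp 0 + 1 < 2 ^ w ->
  run w push_child (query_cost h + 60) s (fun _ s' => exists it : request,
    [/\ it.1.1 = c, top_edge E fin y c it.1.2 it.2, s' r_sp 0 = s r_sp 0 + 1,
      forall j, s' r_y j = (if j == s r_sp 0 then it.1.1 else s r_y j)
      & forall j, s' r_w j = (if j == s r_sp 0 then it.1.2 else s r_w j)
         /\ s' r_a j = (if j == s r_sp 0 then it.2 else s r_a j)]).
Proof.
move=> M c_in le_y Hy Hc sp_word; have [Mn Mp Mps Mw] := M.
have cn : c < n by lia.
have c_fin := ltn_fin tree cn; have fin_n := leq_fin tree cn.
have pc := parent_lt tree c_in.
have yn_lt : y * n < 2 ^ h.
  by apply: leq_trans n_word; rewrite ltn_mul2r; lia.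
have h1 : 2 ^ h < 2 ^ h.+1 by rewrite ltn_exp2l.
have h2 : 2 ^ h.+1 < 2 ^ h.+2 by rewrite ltn_exp2l.
have yn_word : y * n < 2 ^ w by apply: leq_trans h_word; lia.
apply: (run_block_seq w_ge6 (phi1 := query_cost h + 40)) => //.
  by rewrite /=; lia.
rewrite /= Hy Hc Mn; vc => //; set s1 := upd _ _ _ _ => F1.
have [_ Mf] := Mp c cn; rewrite Mf !Mps // in s1 F1 *; last by lia.
have M1 : tree_mem s1 by apply: tree_mem_frame F1 M.
have [ps_mono mem_pts pts_lt] := listed.
have /andP[H1 H2] : ps c <= ps (fin c) <= size pts by apply: ps_mono; lia.
(* The edge from [c] to its parent, which is at least [y], is a candidate, so the search never
   fails. *)
have Hhas : has (fun x => y * n <= x) (segment pts (ps c) (ps (fin c))).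
  apply/hasP; exists (p c * n + c); last by rewrite -[y * n]addn0 leq_add // leq_mul2r le_y orbT.
  rewrite mem_pts; last by lia.
  rewrite modnMDl modn_small // divnMDl; last by lia.
  by rewrite divn_small // addn0 leqnn c_fin (edge_parent tree).
have [_ _ _ M1w] := M1.
have lo_lt : y * n < 2 ^ h.+1 by lia.
have R := run_find_successor w_ge6 M1w h_word pts_word H1 H2 lo_lt pts_lt (erefl _)
  (erefl _) (erefl _) (erefl _) Hhas.
apply: (run_call w_ge6 R (phi2 := 40)); first by rewrite /query_cost; lia.
move=> s2 /(top_edge_successor c_in le_y) top F2.
have M2 : tree_mem s2 by apply: tree_mem_frame F2 M1.
have [M2n _ _ _] := M2.
apply: (run_block w_ge6 (phi' := 0)) => //.
have := top; case=> _ _ /andP[_ q_div] _.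
have q_n : s2 q_res 0 < n * n by rewrite -ltn_divLR; lia.
have q_word : s2 q_res 0 < 2 ^ w by apply: leq_trans h_word; lia.
have q_div' := leq_trunc_div (s2 q_res 0) n.
rewrite /= M2n; vc; try lia.
- by rewrite F2.
exists (c, s2 q_res 0 %% n, s2 q_res 0 %/ n); rewrite /= (F2 r_sp) // (F2 v_c) //=.
have modE : s2 q_res 0 - s2 q_res 0 %/ n * n = s2 q_res 0 %% n.
  by rewrite {1}(divn_eq (s2 q_res 0) n) addKn.
by split=> // j; rewrite ?modE ?(F2 r_y) ?(F2 r_w) ?(F2 r_a) // /s1 /= ?Hc.
Qed.


(* Amortisation: a pending request for the subtree of c carries 2 K |T(c)| - K
   credits.  Serving it costs O(K) per path vertex and per hanging subtree, K being
   more than the cost of a query, and leaves the credits of the new requests. *)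
Let K := query_cost h + 200.
Let cr (m : nat) : nat := times m (K + K).
Let wt (its : seq request) : nat :=
  sumn [seq cr (fin it.1.1 - it.1.1) - K | it : request <- its].

Definition stack_mem (its : seq request) (s : memory) : Prop :=
  s r_sp 0 = size its /\
  forall i, i < size its -> let it := nth (0, 0, 0) its i in
    [/\ s r_y i = it.1.1, s r_w i = it.1.2 & s r_a i = it.2].

Lemma wt_cat its its' : wt (its ++ its') = wt its + wt its'.
Proof. by rewrite /wt map_cat sumn_cat. Qed.

Lemma wt_rcons its it : wt (rcons its it) = wt its + (cr (fin it.1.1 - it.1.1) - K).
Proof. by rewrite -cats1 wt_cat /wt /= addn0. Qed.

Lemma crD a b : cr (a + b) = cr a + cr b.
Proof. exact: mulnDl. Qed.

Lemma leq_cr a b : a <= b -> cr a <= cr b.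
Proof. by move=> ab; rewrite -(subnK ab) crD leq_addl. Qed.

Lemma cr_gt0 a : 0 < a -> K + K <= cr a.
Proof. by move=> a0; rewrite -[K + K]mul1n leq_mul2r a0 orbT. Qed.

(** Every pending request holds at least [K] credits, so a bound on the credits bounds the length of
    the stack. This keeps the stack pointer within a word. *)
Lemma stack_bound its : all (fun it : request => it.1.1 < n) its ->
  wt its <= cr n + K + K -> size its <= n + n + 2.
Proof.
move=> Hits Hwt; have K0 : 0 < K by rewrite /K; lia.
have : size its * K <= wt its.
  elim: its Hits {Hwt} => //= it its IH /andP[it_n /IH le_its].
  rewrite mulSn /wt /= leq_add // -/(wt _).
  have := @cr_gt0 (fin it.1.1 - it.1.1); have := ltn_fin tree it_n.
  by lia.
move=> Hs; have : size its * K <= (n + n + 2) * K.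
  by apply: leq_trans Hs (leq_trans Hwt _); rewrite /cr /times; lia.
by rewrite leq_mul2r; lia.
Qed.

Lemma stack_push its s s' it : stack_mem its s ->
  s' r_sp 0 = s r_sp 0 + 1 ->
  (forall j, s' r_y j = (if j == s r_sp 0 then it.1.1 else s r_y j)) ->
  (forall j, s' r_w j = (if j == s r_sp 0 then it.1.2 else s r_w j)
     /\ s' r_a j = (if j == s r_sp 0 then it.2 else s r_a j)) ->
  stack_mem (rcons its it) s'.
Proof.
move=> [Hsp Hst] Hsp' H1 H2; split; first by rewrite Hsp' Hsp size_rcons addn1.
move=> i; rewrite size_rcons ltnS nth_rcons H1 (H2 i).1 (H2 i).2 Hsp.
by case: ltngtP => // lt_i _; apply: Hst.
Qed.

Lemma stack_mem_frame l its s s1 :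
  all (fun a => a \notin l) [:: r_sp; r_y; r_w; r_a] ->
  frame l s s1 -> stack_mem its s -> stack_mem its s1.
Proof.
case/and5P=> H1 H2 H3 H4 _ F [M1 M2].
by split; [rewrite F | move=> i /M2; rewrite !F].
Qed.

Lemma subn_shift A b c f d : b <= c <= f -> f - b + d <= A ->
  A - (c - b) - d = A - (f - b) - d + (f - c).
Proof. by lia. Qed.

Section Request.

Context (y wv a : nat) (yn : y < n) (w_in : y <= wv < fin y).
Context (a_off : ~~ (y <= a < fin y)).
Context (stk : seq request) (stk_n : all (fun it : request => it.1.1 < n) stk).

(* What a request lacks to carry 2 K credits per vertex is made up for by the
   first path vertex. *)
Let debt lim := if wv < lim then K + 100 else 0.
Let covered lim := if lim <= wv then fin lim - lim else 0.
(** The vertices whose credits are still unspent. The children before [c] are gone with their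
    subtrees, and so is the finished subtree of [lim]; the latter is subtracted separately only
    until the scan passes [lim], lest it count twice. *)
Let uncovered lim v c :=
  fin y - y - (c - v.+1) - (if c <= lim then covered lim else 0).
(* Pays for skipping the child on the path, which leaves no request. *)
Let slack lim c := if c <= lim <= wv then 20 else 0.

Lemma run_children lim v prev its s phi :
  walking p fin y wv a lim v prev -> prev != y ->
  tree_mem s -> stack_mem (stk ++ its) s ->
  s v_y 0 = y -> s v_v 0 = v -> s v_prev 0 = prev -> s v_c 0 = v.+1 ->
  requests_for E p fin y wv (before p lim v v.+1) its ->
  wt (stk ++ its) + cr (uncovered lim v v.+1) + slack lim v.+1 + 10
    <= phi + debt lim ->
  phi <= cr n + 10 ->
  run w (While (var v_c [<] Get a_fin (var v_v)) child_step) phi s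
    (fun phi' s' => exists its',
      [/\ requests_for E p fin y wv (before p lim v (fin v)) its',
          stack_mem (stk ++ its') s',
          wt (stk ++ its') + cr (fin y - y - (fin v - v.+1)) + 3 <= phi' + debt lim
        & phi' <= cr n + 10]).
Proof.
move=> W nep M Hst Hy Hv Hprev Hc Hreq Hphi Hphi_n.
have onv := walking_on tree yn w_in W nep.
have v_in := on_bound tree yn w_in onv; have vn : v < n by lia.
have v_fin := ltn_fin tree vn; have fin_vn := leq_fin tree vn.
have fin_v : fin v <= fin y.
  by apply: (fin_subtree tree) => //; move: onv; rewrite /on_path; lia.
have K200 : 200 <= K by rewrite /K; lia.
have debt_K : debt lim <= K + 100 by rewrite /debt; case: ifP; lia.
have lim_on : lim <= wv -> [/\ on_path fin y wv lim, prev = lim, v = p lim,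
    lim != y & v < lim < fin lim /\ fin lim <= fin v].
  case: W => [[-> _ _]|[onl ev ep]]; rewrite ?ltnn // => _.
  have := on_bound tree yn w_in onl => lim_in.
  have neq : lim != y by rewrite -ep.
  have ln : lim < n by lia.
  have := parent_lt tree (k := lim); rewrite -ev => pl.
  have l_fin := ltn_fin tree ln.
  split=> //; split; first by lia.
  by apply: (fin_subtree tree) => //; rewrite (subtree_parent tree vn) -?ev; lia.
(* The vertex [v] itself stays uncovered throughout the scan. Its [K + K] credits exceed the debt,
   so the loop test can always be paid. *)
have unc_gt0 c : v < c <= fin v -> K + K <= cr (uncovered lim v c).
  move=> Hvc; apply: cr_gt0; rewrite /uncovered /covered.
  case: (leqP lim wv) => le2; last by case: ifP; lia.
  by have [_ _ _ _ ?] := lim_on le2; case: ifP; lia.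
pose I (phi1 : nat) (s1 : memory) := exists c its1,
  [/\ c = fin v \/ v < c < fin v /\ p c = v,
   s1 v_c 0 = c /\ stack_mem (stk ++ its1) s1,
   requests_for E p fin y wv (before p lim v c) its1,
   wt (stk ++ its1) + cr (uncovered lim v c) + slack lim c + 10 <= phi1 + debt lim
   & phi1 <= cr n + 10].
apply: (@run_while w w_ge6 _ _ I) => //.
  exists v.+1, its; split=> //.
  have [lt|] := ltnP v.+1 (fin v); last by left; lia.
  by right; rewrite (first_child tree vn lt); split=> //; lia.
move=> phi1 s1 [c [its1 [Hc1 [Ec Hst1] Hreq1 Hphi1 Hphi1_n]]] F1.
have M1 : tree_mem s1 by apply: tree_mem_frame F1 M.
have [_ Mf _ _] := M1.
have cr_unc : K + K <= cr (uncovered lim v c) by apply: unc_gt0; case: Hc1; lia.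
split=> //; exists (phi1 - 7) => /=; first by lia.
have s1_v : s1 v_v 0 = v by rewrite F1.
rewrite Ec s1_v (Mf v vn).2; case: Hc1 => [ec|[Hcv epc]].
  rewrite ec ltnn; exists its1; rewrite -ec; split=> //; last by lia.
  suff -> : fin y - y - (c - v.+1) = uncovered lim v c by lia.
  rewrite /uncovered /covered; case: (leqP lim wv) => le2; last by case: ifP; lia.
  by have [_ _ _ _ ?] := lim_on le2; case: ifP; lia.
have cv : c < fin v by lia.
rewrite cv; have cn : c < n by lia.
have c_fin := ltn_fin tree cn.
have fin_c : fin c <= fin v.
  by apply: (fin_subtree tree) => //; lia.
have fc_child : fin c = fin v \/ v < fin c < fin v /\ p (fin c) = v.
  have [lt|] := ltnP (fin c) (fin v); last by left; lia.
  by right; rewrite (next_sibling tree vn _ epc lt) //; split=> //; lia.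
have s1_prev : s1 v_prev 0 = prev by rewrite F1.
(* Passing a hanging subtree releases [K + K] credits for each of its vertices: [K] in all pay for
   the search and the loop overhead, the rest goes to the request pushed. *)
have uncD : c != prev -> uncovered lim v c = uncovered lim v (fin c) + (fin c - c)
    /\ slack lim (fin c) <= slack lim c.
  move=> ncp; rewrite /uncovered /slack /covered.
  have shift d : fin c - v.+1 + d <= fin y - y ->
    fin y - y - (c - v.+1) - d = fin y - y - (fin c - v.+1) - d + (fin c - c).
    by apply: subn_shift; clear -Hcv c_fin; lia.
  have le_A : fin c - v.+1 <= fin y - y by clear -fin_c fin_v v_in; lia.
  have [le2|_] := leqP lim wv; last first.
    by rewrite !andbF !if_same shift ?addn0.
  have [onl ep ev nel [l1 l2]] := lim_on le2; rewrite !andbT.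
  have l_in := on_bound tree yn w_in onl.
  have [lt|lt|el] := ltngtP c lim.
  - have le_f : fin c <= lim.
      by apply: (siblings_disjoint tree) => //; rewrite ?epc //; clear -Hcv l_in; lia.
    by rewrite le_f shift //; clear -l1 l2 le_f fin_v v_in; lia.
  - have lt_f : lim < fin c by clear -lt c_fin; lia.
    by rewrite leqNgt lt_f /= shift ?addn0.
  - by rewrite el ep eqxx in ncp.
apply: (run_seq w_ge6 (R := fun phi2 s2 => phi2 <= cr n + 10 /\ exists its2,
  [/\ stack_mem (stk ++ its2) s2, requests_for E p fin y wv (before p lim v (fin c)) its2,
    s2 v_c 0 = c & wt (stk ++ its2) + cr (uncovered lim v (fin c)) + slack lim (fin c) + 15
      <= phi2 + debt lim])).
  apply: (run_if w_ge6 (phi1 := phi1 - 13)) => //=; first by lia.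
  rewrite Ec s1_prev; case: eqP => [e|/eqP ncp].
    apply: (run_block w_ge6 (phi' := phi1 - 14)) => //=; first by lia.
    split; first by lia.
    (* This is not the start of the walk: there [prev = a] lies outside the subtree of [y], so no
       child equals it. *)
    have le2 : lim <= wv.
      case: W => [[_ _ ep]|[onl _ _]].
        by move: a_off; rewrite -ep -e; clear -Hcv v_in fin_v; lia.
      by move: onl; rewrite /on_path => /and3P[].
    have [onl ep ev nel [l1 l2]] := lim_on le2.
    have el : c = lim by rewrite e ep.
    have l1' : lim < fin lim by case/andP: l1.
    (* The subtree of [lim] moves from the separate term to the scanned children, so no credits are
       released; [slack] pays for this turn. *)
    have EU : uncovered lim v (fin c) = uncovered lim v c.
      by rewrite /uncovered /covered le2 el leqnn leqNgt l1' /=; clear -l1; lia.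
    have ES : slack lim c = slack lim (fin c) + 20.
      by rewrite /slack el leqnn le2 (leqNgt (fin lim)) l1'.
    exists its1; split=> //; last first.
      by rewrite EU; clear -Hphi1 cr_unc debt_K K200 ES; lia.
    by move: Hreq1; rewrite el; apply: (requests_skip tree yn w_in).
  have [EU ES] := uncD ncp.
  have s1_y : s1 v_y 0 = y by rewrite F1.
  have c_in : 0 < c < n by lia.
  have le_yp : y <= p c by lia.
  have sp_word : s1 r_sp 0 + 1 < 2 ^ w.
    rewrite (proj1 Hst1); apply: ltn_trans n2_word.
    suff : size (stk ++ its1) <= n + n + 2 by clear; lia.
    apply: stack_bound; last by clear -Hphi1 Hphi1_n debt_K cr_unc K200; lia.
    rewrite all_cat stk_n; apply/allP => it it_in; case: Hreq1 => /(_ it it_in)[+ _ _] _ _.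
    by move/(hanging_bound tree yn w_in)/andP=> [].
  apply: (run_last w_ge6 (run_push_child M1 c_in le_yp s1_y Ec sp_word)
    (phi2 := phi1 - 13 - (query_cost h + 60))).
    by move: Hphi1; rewrite EU crD /K; have := cr_gt0 (a := fin c - c); rewrite /K; lia.
  move=> s2 [it [eit top Hsp Hpy Hpw]] F2; split; first by lia.
  exists (rcons its1 it); split.
  - by rewrite -rcons_cat; apply: stack_push Hst1 Hsp Hpy Hpw.
  - by apply: (requests_push tree yn w_in W).
  - by rewrite F2.
  - rewrite -rcons_cat wt_rcons eit; move: Hphi1; rewrite EU crD.
    by have := cr_gt0 (a := fin c - c); rewrite /K; lia.
move=> phi2 s2 [Hphi2 [its2 [Hst2 Hreq2 Ec2 Hphi2']]] F2.
have cr_unc2 : K + K <= cr (uncovered lim v (fin c)).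
  by apply: unc_gt0; clear -Hcv c_fin fin_c; lia.
apply: (run_block w_ge6 (phi' := phi2 - 5)) => //=.
  by clear -cr_unc2 Hphi2' debt_K K200; lia.
vc => //; rewrite /= Ec2; have M2 : tree_mem s2 by apply: tree_mem_frame F2 M1.
have [_ Mf2 _ _] := M2.
exists (fin c), its2; split=> //; last by clear -Hphi2; lia.
- by rewrite /= (Mf2 c cn).2.
- by clear -cr_unc2 Hphi2' debt_K K200; lia.
Qed.

Lemma run_path s phi : tree_mem s -> stack_mem stk s ->
  s v_y 0 = y -> s v_v 0 = wv -> s v_prev 0 = a ->
  wt stk + cr (fin y - y) <= phi + K + 50 -> phi <= cr n + 10 ->
  run w (While ((var v_prev [==] var v_y) [==] Cst 0) path_step) phi s
    (fun phi' s' => exists its,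
      [/\ requests_for E p fin y wv (fun c => y <= p c) its,
          stack_mem (stk ++ its) s',
          path_written p fin y wv a (s a_out) y (s' a_out),
          wt (stk ++ its) + 10 <= phi'
        & phi' <= cr n + 10]).
Proof.
move=> M Hst Hy Hv Hprev Hphi Hphi_n.
have fin_y : fin y <= n := leq_fin tree yn.
have K200 : 200 <= K by rewrite /K; lia.
pose I (phi1 : nat) (s1 : memory) := exists lim v prev its,
  [/\ walking p fin y wv a lim v prev /\ (s1 v_v 0 = v /\ s1 v_prev 0 = prev),
   requests_for E p fin y wv (fun c => lim <= p c) its,
   stack_mem (stk ++ its) s1 /\ path_written p fin y wv a (s a_out) lim (s1 a_out),
   wt (stk ++ its) + cr (fin y - y - covered lim) + 50 <= phi1 + debt lim
   & phi1 <= cr n + 10].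
apply: (@run_while w w_ge6 _ _ I) => //.
  exists wv.+1, wv, a, [::]; rewrite cats0 /covered /debt leqnn ltnn subn0.
  split=> //; [by split=> //; left | | | by clear -Hphi K200; lia].
    split=> // c /and3P[_ _]; rewrite /on_path => /and3P[_ le_w _] lt_w.
    by move: lt_w; rewrite ltnNge le_w.
  split=> //; split=> // [u onu ne|]; last by rewrite ltnn.
  have := on_parent tree yn w_in onu ne; rewrite /on_path => /and3P[_ le_w _] lt_w.
  by move: lt_w; rewrite ltnNge le_w.
move=> phi1 s1 [lim [v [prev [its [[W [Ev Ep]] Hreq [Hst1 Hout] Hphi1 Hphi1_n]]]]] F1.
have M1 : tree_mem s1 by apply: tree_mem_frame F1 M.
have [_ Mf _ _] := M1.
have debt_K : debt lim <= K + 100 by rewrite /debt; case: ifP; lia.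
have Ey : s1 v_y 0 = y by rewrite F1.
have cov : (lim <= wv /\ debt lim = 0) \/ K + K <= cr (fin y - y - covered lim).
  have [le2|lt2] := leqP lim wv; first by left; rewrite /debt ltnNge le2.
  right; apply: cr_gt0; rewrite /covered (leqNgt lim) lt2 /=.
  by clear -w_in; lia.
have phi8 : 8 <= phi1 by clear -cov Hphi1 debt_K K200; lia.
split=> //; exists (phi1 - 8) => /=; first by clear -phi8; lia.
rewrite Ep Ey; case: (eqVneq prev y) => [e|nep] /=.
  have el : lim = y.
    by case: W => [[_ _ ep]|[_ _ <-//]]; move: a_off; rewrite -ep e leqnn (ltn_fin tree).
  exists its; rewrite -{2 4}el; split=> //; last by clear -Hphi1_n; lia.
  have d0 : debt lim = 0 by rewrite /debt el ltnNge; case/andP: w_in => ->.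
  by clear -Hphi1 d0; lia.
have onv := walking_on tree yn w_in W nep.
have v_in := on_bound tree yn w_in onv; have vn : v < n by case/andP: v_in.
have v_fin := ltn_fin tree vn.
have fin_v : fin v <= fin y.
  by apply: (fin_subtree tree) => //; move: onv; rewrite /on_path; clear -w_in; lia.
have le_vw : v <= wv by case/and3P: onv.
have phi19 : 19 <= phi1 by clear -cov Hphi1 debt_K K200; lia.
apply: (run_block_seq w_ge6 (phi1 := phi1 - 19)) => //=; first by clear -phi19; lia.
rewrite Ev Ep; vc => //; first by clear -vn n2_word; lia.
set s2 := upd _ _ _ _ => F2; have M2 : tree_mem s2 by apply: tree_mem_frame F2 M1.
have Hst2 : stack_mem (stk ++ its) s2 by apply: stack_mem_frame F2 Hst1.
have P2 : path_written p fin y wv a (s a_out) v (s2 a_out).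
  by apply: (path_written_step tree yn w_in W nep Hout).
apply: (run_seq w_ge6 (run_children W nep M2 Hst2 _ _ _ _ (its := its) _ _ _));
  rewrite /s2 /= ?addn1 //.
- exact: (requests_start tree yn w_in).
- rewrite /uncovered subnn subn0 /slack.
  have -> : (if v.+1 <= lim then covered lim else 0) = covered lim.
    case: ifP => // /negbT le1; rewrite /covered; case: ifP => // le2.
    case: W => [[el ev _]|[onl ev ep]]; first by clear -el le2; lia.
    have := parent_lt tree (k := lim); rewrite -ev; rewrite ep in nep.
    by have := on_bound tree yn w_in onl; clear -le1 nep; lia.
  by clear -Hphi1 phi19; case: ifP; lia.
- by clear -Hphi1_n; lia.
move=> phi2 s3 [its2 [H1 H2 H4 H5]] F3; rewrite -/s2 in F3.
have M3 : tree_mem s3 by apply: tree_mem_frame F3 M2.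
have [_ Mf3 _ _] := M3.
have Ev3 : s3 v_v 0 = v by rewrite F3.
have P3 : path_written p fin y wv a (s a_out) v (s3 a_out).
  have E3 : s3 a_out =1 s2 a_out by apply: F3.
  by case: P2 => P2a P2b P2c; split=> [u ? ? ?|?|u ?]; rewrite E3; auto.
(* The step frees the [K + K] credits of [v] itself. The first time they also settle the debt, which
   is at most [K + 100]. *)
have Hcr : cr (fin y - y - (fin v - v.+1)) = cr (fin y - y - (fin v - v)) + (K + K).
  rewrite (_ : _ - (fin v - v.+1) = fin y - y - (fin v - v) + 1); last first.
    by clear -v_fin fin_v v_in; lia.
  by rewrite crD {2}/cr /times mul1n.
have phi10 : 10 <= phi2 by clear -H4 Hcr debt_K K200; lia.
apply: (run_block w_ge6 (phi' := phi2 - 10)) => //=; first by clear -phi10; lia.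
vc => //; rewrite /= Ev3 (Mf3 v vn).1.
exists v, (p v), v, its2; split=> //.
- by split=> //; right.
- exact: (requests_stop tree yn w_in W nep).
- rewrite /debt /covered ltnNge le_vw /=.
  by clear -H4 Hcr debt_K K200; lia.
- by clear -H5; lia.
Qed.

End Request.

Definition valid_request (it : request) : bool :=
  [&& it.1.1 < n, it.1.1 <= it.1.2 < fin it.1.1 & ~~ (it.1.1 <= it.2 < fin it.1.1)].

Definition pending (its : seq request) (u : nat) : bool :=
  has (fun it : request => it.1.1 <= u < fin it.1.1) its.

(* The loop invariant: serving the pending requests in any way completes out to a
   rerooted tree. *)
Definition will_reroot (its : seq request) (x r' : nat) (out : nat -> nat) : Prop :=
  forall out', (forall u, ~~ pending its u -> out' u = out u) ->
    (forall it, it \in its ->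
       rerooted E p fin out' it.1.1 it.1.2 /\ out' it.1.2 = it.2) ->
    rerooted E p fin out' x r'.

(** The path avoids all remaining requests, those in [stk] by disjointness and those in [its]
    because hanging subtrees miss it. Its entries are therefore final, and the requests in [its]
    supply exactly the hanging subtrees. *)
Lemma will_reroot_step stk its y wv a x r' out0 out :
  y < n -> y <= wv < fin y ->
  all (fun it => disjoint_requests fin it (y, wv, a)) stk ->
  requests_for E p fin y wv (fun c => y <= p c) its ->
  path_written p fin y wv a out0 y out ->
  will_reroot (rcons stk (y, wv, a)) x r' out0 ->
  will_reroot (stk ++ its) x r' out.
Proof.
move=> yn w_in /allP dis [H1 H2 _] [P1 P2 P3] will out' same req.
have fin_y := leq_fin tree yn.
have off_path u : on_path fin y wv u -> ~~ pending (stk ++ its) u.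
  move=> onu; have := on_bound tree yn w_in onu => u_in.
  rewrite /pending has_cat negb_or; apply/andP; split; apply/hasPn => it it_in.
    have := dis it it_in; rewrite /disjoint_requests /=.
    by move: onu; rewrite /on_path; case: it {it_in} => [[c ?] ?] /=; clear -w_in; lia.
  by have [Hh _ _] := H1 it it_in; apply: (hanging_off_path tree yn fin_y Hh onu).
have same_path u : on_path fin y wv u -> out' u = out u.
  by move=> onu; rewrite same // off_path.
apply: will.
  move=> u; rewrite /pending -cats1 has_cat /= orbF negb_or => /andP[Nu Ny].
  rewrite same; last first.
    rewrite /pending has_cat negb_or Nu; apply/hasPn => it it_in.
    have [/and3P[Hc _ _] _ _] := H1 it it_in; apply: contraNN Ny => Hu.
    apply: (subtree_trans tree yn _ Hu); move: Hc; move: it.1.1 => c; clear; lia.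
  apply: P3; apply: contraNN Ny => /andP[]; rewrite /on_path.
  by clear -w_in; lia.
move=> it; rewrite mem_rcons inE => /predU1P[->|it_in]; last first.
  by apply: req; rewrite mem_cat it_in.
have onw : on_path fin y wv wv.
  rewrite /on_path; have wn : wv < n by clear -w_in fin_y; lia.
  by have := ltn_fin tree wn; clear -w_in; lia.
split=> /=; last first.
  by rewrite same_path // P2 //; case/andP: w_in.
constructor=> // [v onv ne|c hc].
  have onp := on_parent tree yn w_in onv ne.
  by rewrite same_path // P1 //; move: onp; rewrite /on_path => /and3P[].
have le_y : y <= p c by case/and3P: hc => _ _; rewrite /on_path => /and3P[].
have /mapP[it' it'_in ec] := H2 c hc le_y.
have [_ _ top] := H1 it' it'_in.
have [|R e] := req it'; first by rewrite mem_cat it'_in orbT.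
by exists it'.1.2; rewrite ?e ec.
Qed.

Lemma run_serve_requests x r' s : x < n -> x <= r' < fin x ->
  tree_mem s -> stack_mem [:: (x, r', n)] s ->
  run w serve_requests (cr (fin x - x) + 10) s
    (fun _ s' => rerooted E p fin (s' a_out) x r').
Proof.
move=> xn r'_in M Hst; have fin_x := leq_fin tree xn.
have K200 : 200 <= K by rewrite /K; lia.
pose I (phi1 : nat) (s1 : memory) := exists its,
  [/\ stack_mem its s1, all valid_request its, pairwise (disjoint_requests fin) its,
      will_reroot its x r' (s1 a_out) & wt its + 10 <= phi1 <= cr n + 10].
apply: (@run_while w w_ge6 _ _ I) => //.
  (* The number [n] is no vertex, so as an attachment it lies outside every subtree, as
     [valid_request] demands. *)
  exists [:: (x, r', n)]; split=> //.
  - rewrite /= /valid_request /= xn r'_in andbT /=; clear -fin_x; lia.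
  - by move=> out' _ H; have [] := H (x, r', n); rewrite ?inE.
  - have : cr (fin x - x) <= cr n by apply: leq_cr; clear -fin_x; lia.
    by move=> le; rewrite !leq_add2r le andbT /wt /= addn0 leq_subr.
move=> phi1 s1 [its [Hst1 valid dis will /andP[Hphi1 Hphi1_n]]] F1.
have M1 : tree_mem s1 by apply: tree_mem_frame F1 M.
split=> //; exists (phi1 - 3) => /=; first by clear -Hphi1; lia.
case: (lastP its) Hst1 valid dis will Hphi1 => [|stk [[y wv] a]] [Esp Hst1] valid dis will Hphi1.
  rewrite Esp /=; apply: will => // u.
rewrite Esp size_rcons /=.
move: valid; rewrite all_rcons => /andP[/and3P[/= yn w_in a_off] valid].
move: dis; rewrite -cats1 pairwise_cat allrel1r andbT => /andP[dis_y dis].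
have y_fin := ltn_fin tree yn.
have cr_y : K + K <= cr (fin y - y) by apply: cr_gt0; clear -y_fin; lia.
rewrite wt_rcons /= in Hphi1.
have phi30 : 30 <= phi1 by clear -Hphi1 cr_y K200; lia.
have [] := Hst1 (size stk); first by rewrite size_rcons.
rewrite nth_rcons ltnn eqxx /= => Ey Ew Ea.
apply: (run_block_seq w_ge6 (phi1 := phi1 - 24)) => //=; first by clear -phi30; lia.
have stk_n : all (fun it : request => it.1.1 < n) stk.
  by apply: sub_all valid => it /and3P[].
have sz : size stk <= n + n + 2.
  by apply: stack_bound => //; clear -Hphi1 Hphi1_n cr_y; lia.
rewrite Esp size_rcons subn1 /= Ey Ew Ea; vc => //; first by clear -sz n2_word; lia.
set s2 := upd _ _ _ _ => F2; have M2 : tree_mem s2 by apply: tree_mem_frame F2 M1.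
have Hst2 : stack_mem stk s2.
  split=> // i lt_i; have := Hst1 i; rewrite size_rcons nth_rcons lt_i; apply.
  by rewrite ltnS ltnW.
apply: (run_conseq w_ge6 (run_path (phi := phi1 - 24) yn w_in a_off stk_n M2 Hst2
  _ _ _ _ _)) => //.
- by clear -Hphi1 phi30 cr_y K200; lia.
- by clear -Hphi1_n; lia.
move=> phi2 s3 [its' [Hreq Hst3 Hout Hphi2 Hphi2_n]] F3.
rewrite subnn addn0; exists (stk ++ its'); split=> //.
- rewrite all_cat valid; apply/allP => it it_in; have [+ + _] := Hreq.
  move=> /(_ it it_in)[/(hanging_bound tree yn w_in)/andP[_ cn] _ [H1 _ H2 _]] _.
  rewrite /valid_request cn H1 /=; case/andP: H2 => _ H2.
  by rewrite leqNgt H2.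
- have [H1 _ H3] := Hreq; rewrite pairwise_cat dis H3 !andbT.
  apply/allrelP => it it' it_in it'_in; have [/and3P[Hc _ _] _ _] := H1 it' it'_in.
  have Hfc : fin it'.1.1 <= fin y.
    by apply: (fin_subtree tree yn); move: Hc; move: it'.1.1 => c; clear; lia.
  have := allP dis_y it it_in; rewrite /disjoint_requests /=.
  move: Hc Hfc; move: it.1.1 it'.1.1 => c c'; clear; lia.
- apply: (will_reroot_step yn w_in dis_y Hreq Hout will).
- by rewrite Hphi2 Hphi2_n.
Qed.

End Serve.

(** * Preorder numbering *)

Section Preorder.

Context (n : nat) (e : rel 'I_n) (r : 'I_n) (T : 'I_n -> 'I_n).
Context (adj : 'I_n -> seq 'I_n).
Context (e_sym : symmetric e) (e_irr : irreflexive e).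
Context (adjP : adjacency_lists e adj) (dfs : dfs_tree e [set: 'I_n] r T).

Notation anc := (ancestor T).

Lemma anc_refl v : anc v v. Proof. exact: connect0. Qed.

Lemma anc_trans u v x : anc u v -> anc v x -> anc u x.
Proof. by move=> uv vx; apply: connect_trans vx uv. Qed.

Lemma anc_parent v : anc (T v) v. Proof. exact: fconnect1. Qed.

Lemma anc_iter u v : anc u v -> exists k, iter k T v = u.
Proof. by move=> uv; exists (findex T v u); apply: iter_findex. Qed.

Lemma iter_anc k v : anc (iter k T v) v. Proof. exact: fconnect_iter. Qed.

Lemma parent_anc v x : v != x -> anc v x -> anc v (T x).
Proof.
move=> ne /anc_iter[[|k] /= e1]; first by rewrite e1 eqxx in ne.
by rewrite -e1 -iterS iterSr; apply: iter_anc.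
Qed.

Lemma anc_parentE v x : v != x -> anc v x = anc v (T x).
Proof.
move=> ne; apply/idP/idP; first exact: parent_anc.
by move=> H; apply: anc_trans H (anc_parent x).
Qed.

(** A vertex on a cycle returns to itself after [m] periods, [m] being its distance from the root;
    but [m] steps already lead to the root, where iteration stays. *)
Lemma acyclic v : v != r -> ~~ anc v (T v).
Proof.
move=> vr; apply/negP=> /anc_iter[k cyc]; rewrite -iterSr in cyc.
have [m rm] : exists m, iter m T v = r by apply/anc_iter/(dfs_spanning dfs).
have per j : iter (j * k.+1) T v = v.
  by elim: j => // j IH; rewrite mulSn iterD IH.
have stable j : iter j T r = r by elim: j => //= j ->; apply: dfs_root dfs.
by have := per m; rewrite mulnS addnC iterD rm stable => rv; rewrite rv eqxx in vr.
Qed.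

Definition children (v : 'I_n) : seq 'I_n := [seq u <- adj v | T u == v].

Lemma mem_children u v : (u \in children v) = (u != r) && (T u == v).
Proof.
rewrite mem_filter (adjP v).2 andbC; have [<-|] := eqVneq (T u) v; last by rewrite !andbF.
rewrite !andbT -topredE /=; have [->|ur] := eqVneq u r.
  (* The root is its own parent; irreflexivity of [e] keeps it out of its own list of children. *)
  by rewrite (dfs_root dfs) e_irr.
by have := dfs_edge dfs (in_setT u) ur; rewrite e_sym => /andP[].
Qed.

Lemma anc_children v x : anc v x = (x == v) || has (anc^~ x) (children v).
Proof.
apply/idP/orP => [/anc_iter[k]|[/eqP->|/hasP[c]]].
- elim: k x => [|k IH] x /=; first by move=> ->; left.
  rewrite -iterS iterSr => /IH[/eqP e1|/hasP[c c_v cx]]; last first.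
    by right; apply/hasP; exists c => //; apply: anc_trans cx (anc_parent x).
  have [->|nx] := eqVneq x v; [by left | right].
  apply/hasP; exists x; last exact: anc_refl.
  rewrite mem_children e1 eqxx andbT; apply: contraNneq nx => xr.
  by rewrite -e1 xr (dfs_root dfs).
- exact: anc_refl.
- rewrite mem_children => /andP[_ /eqP<-]; apply: anc_trans; exact: anc_parent.
Qed.

(* [visits b o]: an exploration whose stack, from the bottom, is b takes the
   vertices of o from the stack, in this order. *)
Inductive visits : seq 'I_n -> seq 'I_n -> Prop :=
  | VisitsNil : visits [::] [::]
  | VisitsPop b v o : visits (b ++ children v) o -> visits (rcons b v) (v :: o).

Lemma visits_cat b1 b2 o1 o2 : visits b1 o1 -> visits b2 o2 ->
  visits (b1 ++ b2) (o2 ++ o1).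
Proof.
move=> V1; elim=> {b2 o2} [|b v o _ IH] /=; first by rewrite cats0.
by rewrite -rcons_cat; apply: VisitsPop; rewrite -catA.
Qed.

Lemma visits_split b1 b2 o : visits (b1 ++ b2) o ->
  exists o1 o2, [/\ o = o2 ++ o1, visits b1 o1 & visits b2 o2].
Proof.
move e0 : (b1 ++ b2) => b V; elim: V b1 b2 e0 => {b o} [|b v o V IH] b1 b2.
  by case: b1 b2 => [|? ?] [|? ?] //= _; exists [::], [::]; split=> //; constructor.
case: (lastP b2) => [|b2' v']; first rewrite cats0 => e1.
  exists (v :: o), [::]; rewrite e1; split=> //; by constructor.
rewrite -rcons_cat => /rcons_inj[e1 ->].
have [|o1 [o2 [-> V1 V2]]] := IH b1 (b2' ++ children v); first by rewrite catA e1.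
by exists o1, (v :: o2); split=> //; constructor.
Qed.

Lemma visits_pop b v o : visits (rcons b v) o ->
  exists2 o', o = v :: o' & visits (b ++ children v) o'.
Proof.
move e1 : (rcons b v) => b' V; case: V e1 => [|b2 v2 o2 V] e1.
  by case: b e1.
by case/rcons_inj: e1 => -> ->; exists o2.
Qed.

Lemma visits_nil o : visits [::] o -> o = [::].
Proof. by move e1 : [::] => b V; case: V e1 => // b' v o' _; case: b'. Qed.

(** Induction on the size of the subtree: that of a child is smaller, because a parent is no
    descendant of its child. *)
Lemma visits_total b : exists o, visits b o.
Proof.
suff one v : exists o, visits [:: v] o.
  elim/last_ind: b => [|b v [o V]]; first by exists [::]; constructor.
  by have [o' V'] := one v; exists (o' ++ o); rewrite -cats1; apply: visits_cat.
clear b; have [m] := ubnP #|subtree T v|; elim: m v => // m IH v lt.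
suff [o V] : exists o, visits (children v) o by exists (v :: o); apply: (@VisitsPop [::]).
have : {subset children v <= children v} by [].
elim/last_ind: {1 3}(children v) => [|b c IHb] sub; first by exists [::]; constructor.
have [|o V] := IHb; first by move=> x x_b; apply: sub; rewrite mem_rcons inE x_b orbT.
have c_v : c \in children v by apply: sub; rewrite mem_rcons mem_head.
move: c_v; rewrite mem_children => /andP[cr /eqP Tc].
have [|o' V'] := IH c; last by exists (o' ++ o); rewrite -cats1; apply: visits_cat.
rewrite ltnS in lt; apply: leq_trans lt; apply: proper_card; apply/properP; split.
  apply/subsetP => x; rewrite !inE; apply: anc_trans.
  by rewrite -Tc anc_parent.
by exists v; rewrite inE ?anc_refl // -Tc acyclic.
Qed.

Lemma visits_mem b o x : visits b o -> (x \in o) = has (anc^~ x) b.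
Proof.
elim=> {b o} // b v o _ IH.
rewrite has_rcons /= (anc_children v) inE IH has_cat.
by rewrite -orbA [has _ b || _]orbC.
Qed.

(** Whatever is on the stack is still to be visited; hence the stack pointer never exceeds the
    number of vertices. *)
Lemma visits_size b o : visits b o -> size b <= size o.
Proof.
by elim=> {b o} // b v o _; rewrite size_cat size_rcons /= ltnS; lia.
Qed.

Definition incomparable (u v : 'I_n) : bool := ~~ anc u v && ~~ anc v u.

(** The stack remains an antichain of the ancestor order: [v] is replaced by its children, which are
    incomparable with each other and with the rest, so no vertex can be reached twice. *)
Lemma visits_uniq b o : visits b o -> pairwise incomparable b -> uniq o.
Proof.
elim=> {b o} // b v o V IH; rewrite -cats1 pairwise_cat allrel1r.
move=> /and3P[/allP bv inc_b _] /=.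
have strict c : c \in children v -> ~~ anc c v.
  by rewrite mem_children => /andP[cr /eqP<-]; apply: acyclic.
have child c : c \in children v -> anc v c.
  by rewrite mem_children => /andP[_ /eqP<-]; apply: anc_parent.
apply/andP; split.
  rewrite (visits_mem v V) has_cat; apply/norP; split; apply/hasPn => u u_in.
    by case/andP: (bv _ u_in).
  exact: strict.
apply: IH; rewrite pairwise_cat inc_b /=; apply/andP; split.
  apply/allrelP => u c u_b c_v; case/andP: (bv _ u_b) => nuv nvu.
  apply/andP; split; apply/negP => H; last first.
    by case/negP: nvu; apply: anc_trans (child c c_v) H.
  have [euc|nuc] := eqVneq u c; first by case/negP: nvu; rewrite euc child.
  move: c_v; rewrite mem_children => /andP[_ /eqP Tc].
  by case/negP: nuv; rewrite -Tc; apply: parent_anc.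
have uniq_ch : uniq (children v) by rewrite filter_uniq // (adjP v).1.
have inc c c' : c \in children v -> c' \in children v -> c != c' -> ~~ anc c c'.
  move=> c_v c'_v ne; apply/negP => /(parent_anc ne).
  by move: c'_v; rewrite mem_children => /andP[_ /eqP->]; apply/negP/strict.
elim: (children v) uniq_ch inc => //= c s IHs /andP[c_s s_u] inc.
rewrite IHs // => [|c1 c2 H1 H2]; last by apply: inc; rewrite inE ?H1 ?H2 orbT.
rewrite andbT; apply/allP => c' c'_s.
have ne : c != c' by apply: contraNneq c_s => ->.
by rewrite /incomparable !inc ?mem_head ?inE ?c'_s ?orbT // eq_sym.
Qed.

(** The children of a popped vertex lie on top of the stack and are exhausted before anything below
    them. This is why subtrees become intervals. *)
Lemma visits_block b o y : visits b o -> y \in o ->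
  exists o1 oy o2, o = o1 ++ oy ++ o2 /\ visits [:: y] oy.
Proof.
elim=> {b o} // b v o V IH; rewrite inE => /predU1P[->|/IH[o1 [oy [o2 [-> Vy]]]]].
  have [o1 [o2 [-> _ V2]]] := visits_split V.
  by exists [::], (v :: o2), o1; split=> //; apply: (@VisitsPop [::]).
by exists (v :: o1), oy, o2.
Qed.

Context (o : seq 'I_n) (Vo : visits [:: r] o).

Lemma mem_order v : v \in o.
Proof. by rewrite (visits_mem _ Vo) /= orbF (dfs_spanning dfs). Qed.

Lemma uniq_order : uniq o.
Proof. exact: visits_uniq Vo _. Qed.

Lemma size_order : size o = n.
Proof.
have /card_uniqP <- := uniq_order.
by rewrite -[RHS](card_ord n); apply: eq_card => v; rewrite mem_order.
Qed.

Lemma index_order v : index v o < n.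
Proof. by rewrite -[X in _ < X]size_order index_mem mem_order. Qed.

Lemma order_block y : exists o1 oy o2, [/\ o = o1 ++ y :: oy ++ o2,
  index y o = size o1, (size oy).+1 = #|subtree T y| &
  y :: oy =i subtree T y].
Proof.
have [o1 [oy [o2 [Eo Vy]]]] := visits_block Vo (mem_order y).
have U := visits_uniq Vy isT; have Hm x : x \in oy = (x \in subtree T y).
  by rewrite (visits_mem x Vy) /= orbF inE.
have [oy' Ey _] := visits_pop (b := [::]) Vy.
have := uniq_order; rewrite Eo Ey => Uo.
exists o1, oy', o2; split=> //; last by rewrite -Ey.
  rewrite index_cat index_head addn0 ifN //; apply/negP => y_o1.
  by move: Uo; rewrite cat_uniq /= => /and3P[_ /norP[/negP[]]].
by rewrite -(eq_card Hm) (card_uniqP U) Ey.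
Qed.

Lemma index_subtree y x :
  (index y o <= index x o < index y o + #|subtree T y|) = anc y x.
Proof.
have [o1 [oy [o2 [Eo -> <- Hm]]]] := order_block y.
have <- : (x \in y :: oy) = anc y x by rewrite Hm inE.
have := uniq_order; rewrite Eo -cat_cons -[(size oy).+1]/(size (y :: oy)).
move: (y :: oy) => blk; rewrite cat_uniq => /and3P[_ /hasPn disj _].
rewrite !index_cat; case: ifP => [x1|_].
  have -> : x \in blk = false.
    by apply/negP => x2; have := disj x; rewrite mem_cat x2 /= x1 => /(_ isT).
  by apply/negbTE; rewrite negb_and -ltnNge index_mem x1.
case: ifP => [|_]; last by rewrite leq_addr ltn_add2l ltnNge leq_addr.
by rewrite -index_mem leq_addr ltn_add2l.
Qed.

Definition label_edge : rel nat := fun j k =>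
  [&& j < n, k < n & e (nth r o j) (nth r o k)].

Definition label_parent (k : nat) : nat := index (T (nth r o k)) o.

Definition label_fin (k : nat) : nat := k + #|subtree T (nth r o k)|.

Lemma index_label k : k < n -> index (nth r o k) o = k.
Proof. by move=> kn; rewrite index_uniq ?size_order // uniq_order. Qed.

Lemma label_index v : nth r o (index v o) = v.
Proof. by rewrite nth_index // mem_order. Qed.

Lemma label_root k : k < n -> (nth r o k == r) = (k == 0).
Proof.
move=> kn; have [o' Eo _] := visits_pop (b := [::]) Vo.
apply/eqP/eqP => [E|->]; last by rewrite Eo.
by rewrite -(index_label kn) E Eo index_head.
Qed.

Lemma label_subtree j k : j < n -> k < n ->
  (j <= k < label_fin j) = anc (nth r o j) (nth r o k).
Proof. by move=> jn kn; rewrite -index_subtree !index_label. Qed.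

Lemma label_preorder_tree : preorder_tree n label_edge label_parent label_fin.
Proof.
have lab_parent k : k < n -> nth r o (label_parent k) = T (nth r o k).
  by move=> _; rewrite label_index.
have par_n k : label_parent k < n by apply: index_order.
have par_lt k : 0 < k < n -> label_parent k < k.
  case/andP=> k0 kn; rewrite ltn_neqAle; apply/andP; split; last first.
    have := label_subtree (par_n k) kn; rewrite lab_parent // anc_parent.
    by case/andP.
  apply: contraTneq k0 => e1; rewrite -eqn0Ngt -(label_root kn).
  apply: contraT => /acyclic; rewrite -lab_parent // e1.
  by rewrite anc_refl.
split=> //.
- by move=> k kn; have := label_subtree kn kn; rewrite anc_refl => /andP[].
- move=> k kn; rewrite /label_fin.
  have [o1 [oy [o2 [Eo]]]] := order_block (nth r o k).
  rewrite index_label // => -> <- _.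
  have := size_order; rewrite {1}Eo size_cat /= size_cat; lia.
- move=> k j kn /andP[j0 jn] ne; rewrite !label_subtree // lab_parent //.
  apply: anc_parentE; apply: contraNneq ne => e1.
  by rewrite -(index_label jn) -(index_label kn) e1.
- by move=> j k /and3P[].
- by move=> j k; rewrite /label_edge e_sym andbCA.
- move=> j k lt /and3P[jn kn ejk].
  suff : j <= k < label_fin j by case/andP.
  have notanc : ~~ anc (nth r o k) (nth r o j).
    by rewrite -label_subtree // leqNgt lt.
  (* [dfs_nontree] speaks of non-tree edges only; tree edges of either direction are dealt with
     directly. *)
  rewrite label_subtree //; have [e1|ne1] := eqVneq (T (nth r o j)) (nth r o k).
    by case/negP: notanc; rewrite -e1 anc_parent.
  have [<-|ne2] := eqVneq (T (nth r o k)) (nth r o j); first exact: anc_parent.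
  have := dfs_nontree dfs (in_setT _) (in_setT _) ejk ne1 ne2.
  by rewrite (negPf notanc) orbF.
- move=> k /andP[k0 kn]; rewrite /label_edge kn par_n lab_parent //=.
  have kr : nth r o k != r by rewrite label_root // -lt0n.
  by have /andP[] := dfs_edge dfs (in_setT _) kr.
Qed.

End Preorder.

(** The input does not name the root; it is the only vertex that is its own parent. *)
Definition find_root : cmd :=
  p_v <~ Cst 0;;
  While ((Get a_par (var p_v) [==] var p_v) [==] Cst 0) (p_v <~ var p_v [+] Cst 1).

Definition push_neighbour : cmd :=
  p_u <~ Get a_adj (var p_k);;
  If (Get a_par (var p_u) [==] var p_v)
    (Assign p_st (var p_sp) (var p_u);; p_sp <~ var p_sp [+] Cst 1) Skip;;
  p_k <~ var p_k [+] Cst 1.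

Definition visit : cmd :=
  (p_sp <~ var p_sp [-] Cst 1;;
   p_v <~ Get p_st (var p_sp);;
   Assign a_ord (var p_cnt) (var p_v);;
   Assign a_pre (var p_v) (var p_cnt);;
   p_cnt <~ var p_cnt [+] Cst 1;;
   p_k <~ Get a_off (var p_v);;
   p_end <~ Get a_off (var p_v [+] Cst 1));;
  While (var p_k [<] var p_end) push_neighbour.

Definition number_vertices : cmd :=
  find_root;;
  (Assign p_st (Cst 0) (var p_v);; p_sp <~ Cst 1;; p_cnt <~ Cst 0);;
  While (var p_sp) visit.

Definition offset n (adj : 'I_n -> seq 'I_n) (k : nat) : nat :=
  sumn (take k [seq size (adj v) | v <- enum 'I_n]).

Section Offset.

Context (n : nat) (adj : 'I_n -> seq 'I_n).

Lemma nth_sizes d (v : 'I_n) :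
  nth d [seq size (adj u) | u <- enum 'I_n] v = size (adj v).
Proof. by rewrite (nth_map v) ?size_enum_ord // nth_ord_enum. Qed.

Lemma size_sizes : size [seq size (adj v) | v <- enum 'I_n] = n.
Proof. by rewrite size_map size_enum_ord. Qed.

Lemma offsetS (v : 'I_n) : offset adj v.+1 = offset adj v + size (adj v).
Proof.
have lt_v : v < size [seq size (adj u) | u <- enum 'I_n] by rewrite size_sizes.
by rewrite /offset (take_nth 0 lt_v) -cats1 sumn_cat /= addn0 nth_sizes.
Qed.

Lemma leq_offset k l : k <= l -> offset adj k <= offset adj l.
Proof. by move=> kl; rewrite /offset -(subnKC kl) takeD sumn_cat leq_addr. Qed.

Lemma offset_last : offset adj n = \sum_v size (adj v).
Proof.
by rewrite /offset take_oversize ?size_sizes // sumnE big_map big_enum.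
Qed.

Lemma nth_flatten_offset (v : 'I_n) i : i < size (adj v) ->
  nth 0 (flatten [seq [seq val u | u <- adj v] | v <- enum 'I_n])
    (offset adj v + i) = nth v (adj v) i.
Proof.
move=> Hi; set ss := [seq _ | v <- _].
have sz : size ss = n by rewrite size_map size_enum_ord.
have Esh : shape ss = [seq size (adj u) | u <- enum 'I_n].
  by rewrite /shape -map_comp; apply: eq_map => u /=; rewrite size_map.
have Eoff : offset adj v = size (flatten (take v ss)).
  by rewrite size_flatten /shape map_take -/(shape ss) Esh.
rewrite -(cat_take_drop v ss) flatten_cat nth_cat Eoff ltnNge leq_addr addKn.
rewrite (drop_nth [::]) ?sz //= (nth_map v) ?size_enum_ord // nth_ord_enum.
by rewrite nth_cat size_map Hi (nth_map v).
Qed.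

Context (T : 'I_n -> 'I_n).

Definition input_ok (s : memory) : Prop :=
  [/\ s a_n 0 = n, forall k, k <= n -> s a_off k = offset adj k,
      forall (v : 'I_n) i, i < size (adj v) ->
        s a_adj (offset adj v + i) = nth v (adj v) i
    & forall v : 'I_n, s a_par v = T v].

Lemma input_mem_ok : input_ok (input_mem adj T).
Proof.
split=> // [k kn|v i Hi|v].
- have -> : input_mem adj T a_off k = nth 0 [seq sumn (take k (shape
    [seq [seq val u | u <- adj v] | v <- enum 'I_n])) | k <- iota 0 n.+1] k by [].
  rewrite (nth_map 0) ?size_iota // nth_iota // /offset /shape -map_comp.
  by congr (sumn (take _ _)); apply: eq_map => u /=; rewrite size_map.
- exact: nth_flatten_offset.
- have -> : input_mem adj T a_par v = nth 0 [seq val (T u) | u <- enum 'I_n] v by [].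
  by rewrite (nth_map v) ?size_enum_ord // nth_ord_enum.
Qed.

Lemma input_mem0 a i : 3 < a -> input_mem adj T a i = 0.
Proof. by case: a => [|[|[|[|a]]]] // _; rewrite /input_mem /= !nth_nil. Qed.

Lemma input_ok_frame l s s1 :
  all (fun a => a \notin l) [:: a_n; a_off; a_adj; a_par] ->
  frame l s s1 -> input_ok s -> input_ok s1.
Proof.
case/and5P=> H1 H2 H3 H4 _ F [M1 M2 M3 M4].
by split=> [|k|v i|v]; rewrite F //; auto.
Qed.

End Offset.

Section Number.

Context (n : nat) (e : rel 'I_n) (r : 'I_n) (T : 'I_n -> 'I_n).
Context (adj : 'I_n -> seq 'I_n).
Context (e_sym : symmetric e) (e_irr : irreflexive e).
Context (adjP : adjacency_lists e adj) (dfs : dfs_tree e [set: 'I_n] r T).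
Context (o : seq 'I_n) (Vo : visits T adj [:: r] o).
Context (w : nat) (w_ge6 : 5 < w).
Context (n_word : n + n + 8 < 2 ^ w) (off_word : offset adj n + 1 < 2 ^ w).

Lemma run_find_root s : input_ok adj T s ->
  run w find_root (times n 20 + 20) s (fun _ s' => s' p_v 0 = r).
Proof.
move=> M; apply: (run_block_seq w_ge6 (phi1 := times n 20 + 14)) => //=.
  by clear; lia.
vc => // F1.
have [_ _ _ Hpar] : input_ok adj T (upd s p_v 0 0) by apply: input_ok_frame F1 M.
pose J i (s : memory) := s p_v 0 = i.
set s1 := upd _ _ _ _ in F1 *.
apply: (run_last w_ge6 (run_for w_ge6 (J := J) (i := 0) (m := r) (K := 6) _ _ _ _)
  (phi2 := 0)) => //=; last by have := ltn_ord r; rewrite /times; lia.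
  move=> j s2 /= le_jr Ej F2.
  have jn : j < n by apply: leq_ltn_trans le_jr (ltn_ord r).
  have Epar : s2 a_par j = T (Ordinal jn) by rewrite F2 //; apply: (Hpar (Ordinal jn)).
  have n_w := n_word; split=> //=.
    rewrite Ej Epar ltn_neqAle le_jr andbT eqb0; congr (~~ _).
    apply/eqP/eqP => [E|jr]; last first.
      have -> : Ordinal jn = r by apply: val_inj.
      by rewrite (dfs_root dfs).
    have TE : T (Ordinal jn) = Ordinal jn by apply: val_inj.
    suff -> : r = Ordinal jn by [].
    by apply/esym/eqP; apply: contraT => /(acyclic dfs); rewrite TE anc_refl.
  move=> _; apply: (run_block w_ge6 (phi' := 0)) => //=.
  rewrite Ej; vc => //; first by lia.
  by rewrite /J /= addn1.
Qed.

Lemma sum_order (f : 'I_n -> nat) : \sum_(v <- o) f v = \sum_v f v.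
Proof.
rewrite big_uniq /=; last exact: (uniq_order e_sym e_irr adjP dfs Vo).
by apply: eq_bigl => v; rewrite (mem_order e_sym e_irr adjP dfs Vo).
Qed.

(** Charges per visited vertex and per listed neighbour add up to a bound by [n] and the total
    degree. *)
Lemma sum_order_cost k l : \sum_(v <- o) (times (size (adj v)) k + l)
  = times (offset adj n) k + times n l.
Proof.
rewrite sum_order big_split /= sum_nat_const card_ord.
by rewrite offset_last /times -big_distrl.
Qed.

Definition stack_is (b : seq 'I_n) (s : memory) : Prop :=
  s p_sp 0 = size b /\ forall i, i < size b -> s p_st i = nth r b i.

Lemma size_adj v : size (adj v) <= n.
Proof.
have /card_uniqP <- := (adjP v).1.
by rewrite -[X in _ <= X](card_ord n) max_card.
Qed.

Lemma run_push_neighbour b v j s : input_ok adj T s -> j < size (adj v) ->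
  stack_is (b ++ [seq u <- take j (adj v) | T u == v]) s ->
  size b + size (adj v) + 1 < 2 ^ w ->
  s p_k 0 = offset adj v + j -> s p_v 0 = v ->
  run w push_neighbour 30 s (fun _ s' =>
    stack_is (b ++ [seq u <- take j.+1 (adj v) | T u == v]) s'
    /\ s' p_k 0 = offset adj v + j.+1).
Proof.
move=> [_ Hoff Hadj Hpar] Hj [Esp Hst] sz_word Ek Ev.
apply: (run_block w_ge6 (phi' := 0)) => //=.
have k_word : offset adj v + j + 1 < 2 ^ w.
  apply: leq_ltn_trans off_word; rewrite leq_add2r.
  have := offsetS adj v; have := @leq_offset _ adj v.+1 n (ltn_ord v).
  by clear -Hj; lia.
rewrite Ek (Hadj v j Hj) Ev Hpar (take_nth v Hj) filter_rcons; vc => //.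
have sz : size [seq u <- take j (adj v) | T u == v] <= size (adj v).
  by rewrite size_filter (leq_trans (count_size _ _)) // size_take_min geq_minr.
have -> : (T (nth v (adj v) j) == v :> nat) = (T (nth v (adj v) j) == v) by [].
case: (T (nth v (adj v) j) == v); vc => //=; rewrite ?addn1 ?addnS //.
- by rewrite Esp size_cat; clear -sz sz_word; lia.
- rewrite -rcons_cat; split=> /=; first by rewrite Esp size_rcons.
  move=> i; rewrite size_rcons ltnS nth_rcons Esp.
  by case: ltngtP => // lt_i _; apply: Hst.
Qed.

Lemma run_number_vertices s : input_ok adj T s ->
  run w number_vertices (times n 200 + times (offset adj n) 60 + 60) s
    (fun _ s' =>
      (forall k, k < n -> s' a_ord k = nth r o k) /\
      forall v : 'I_n, s' a_pre v = index v o).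
Proof.
move=> M; apply: (run_call w_ge6 (run_find_root M)
  (phi2 := times n 180 + times (offset adj n) 60 + 40)).
  by rewrite /times; clear; lia.
move=> s1 Ev F1; have M1 : input_ok adj T s1 by apply: input_ok_frame F1 M.
apply: (run_block_seq w_ge6 (phi1 := times n 180 + times (offset adj n) 60 + 20)) => //=.
  by clear; lia.
rewrite Ev; vc => //; set s2 := upd _ _ _ _ => F2.
have M2 : input_ok adj T s2 by apply: input_ok_frame F2 M1.
pose wt (o' : seq 'I_n) := \sum_(v <- o') (times (size (adj v)) 36 + 60).
(* [visits] ties the stack to the rest of the order, so the program reproduces the order [o] fixed
   in advance. Each vertex still to come carries credits linear in its degree. *)
pose I (phi : nat) (s3 : memory) := exists vis b o',
  [/\ o = vis ++ o' /\ visits T adj b o', stack_is b s3 /\ s3 p_cnt 0 = size vis,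
   forall i, i < size vis -> s3 a_ord i = nth r vis i,
   forall v : 'I_n, v \in vis -> s3 a_pre v = index v o
   & wt o' + 3 <= phi].
apply: (@run_while w w_ge6 _ _ I) => //.
  exists [::], [:: r], o; split=> //.
    by split=> //; split=> // -[|i].
  by rewrite /wt sum_order_cost /times; clear; lia.
move=> phi s3 [vis [b [o' [[Eo V] [[Esp Hst] Ecnt] Hord Hpre Hphi]]]] F3.
have M3 : input_ok adj T s3 by apply: input_ok_frame F3 M2.
split=> //; exists (phi - 3) => /=; first by clear -Hphi; lia.
rewrite Esp; case: (lastP b) V Hst Esp => [|b' v] V Hst Esp /=.
  have Eo' := visits_nil V.
  have Evis : vis = o by rewrite Eo Eo' cats0.
  rewrite Evis (size_order e_sym e_irr adjP dfs Vo) in Hord Hpre.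
  by split=> // v; apply: Hpre; apply: (mem_order e_sym e_irr adjP dfs Vo).
rewrite size_rcons /=.
have [o1 Eo' V1] := visits_pop V.
have on := size_order e_sym e_irr adjP dfs Vo.
rewrite Eo Eo' size_cat /= in on.
have sz_vis : size vis < n by clear -on; lia.
have sz_b : size b' + size (children T adj v) <= n.
  by have := visits_size V1; rewrite size_cat; clear -on; lia.
have wt_o' : wt o' = wt o1 + (times (size (adj v)) 36 + 60) by rewrite Eo' /wt big_cons addnC.
have Ev3 : s3 p_st (size b') = v.
  by rewrite Hst ?size_rcons // nth_rcons ltnn eqxx.
have [_ Hoff _ _] := M3.
apply: (run_block_seq w_ge6 (phi1 := phi - 3 - 39)) => //=.
  by clear -Hphi wt_o'; lia.
rewrite Esp size_rcons subn1 /= Ev3 Ecnt; vc => //.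
- by clear -sz_b n_word; lia.
- by clear -sz_vis n_word; lia.
- by have := ltn_ord v; clear -n_word; lia.
rewrite (addn1 v) (Hoff v) ?(ltnW (ltn_ord v)) // (Hoff v.+1) ?ltn_ord //.
set s4 := upd _ _ _ _ => F4; have M4 : input_ok adj T s4 by apply: input_ok_frame F4 M3.
pose J j s5 := stack_is (b' ++ [seq u <- take j (adj v) | T u == v]) s5
  /\ s5 p_k 0 = offset adj v + j.
have offS := offsetS adj v.
apply: (run_last w_ge6 (run_for w_ge6 (J := J) (i := 0) (m := size (adj v)) (K := 30)
  _ _ _ _) (phi2 := wt o1 + 3)) => //=.
- rewrite /J take0 cats0 addn0 /s4 /=; split=> //; split=> //= i lt_i.
  by rewrite Hst ?size_rcons ?nth_rcons ?lt_i // ltnW.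
- move=> j s5 le_j [Hst5 Ek5] F5; have M5 : input_ok adj T s5.
    by apply: input_ok_frame F5 M4.
  rewrite Ek5 (_ : s5 p_end 0 = offset adj v.+1); last by rewrite F5.
  rewrite offS ltn_add2l; split=> // lt_j.
  apply: (run_push_neighbour M5 lt_j Hst5) => //; last by rewrite F5.
  by have := size_adj v; clear -sz_b n_word; lia.
- by rewrite subn0 -[30 + _ + 1]/36; clear -Hphi wt_o'; lia.
move=> s5 [Hst5 Ek5] F5.
exists (rcons vis v), (b' ++ children T adj v), o1; split=> //.
- by rewrite cat_rcons -Eo'; split.
- split; first by move: Hst5; rewrite take_size.
  by rewrite F5 // /s4 /= size_rcons addn1.
- move=> i; rewrite size_rcons ltnS => le_i; rewrite F5 // /s4 /= nth_rcons.
  by case: ltngtP le_i => // lt_i _; apply: Hord.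
- move=> u; rewrite mem_rcons inE F5 // /s4 /= => Hu.
  have [euv|ne] := eqVneq u v; last first.
    by rewrite (inj_eq val_inj) (negPf ne); apply: Hpre; rewrite (negPf ne) in Hu.
  rewrite euv eqxx Eo Eo' index_cat; case: ifP => [v_vis|_].
    have := uniq_order e_sym e_irr adjP dfs Vo.
    by rewrite Eo Eo' cat_uniq /= v_vis andbF.
  by rewrite index_head addn0.
Qed.

End Number.

(** * Preprocessing *)

(** Zeros fill the next row from the left and ones from the right; the counter [w_z], together with
    [w_i], gives both positions. *)
Definition place : cmd :=
  w_x <~ Get a_code (var w_base [+] var w_i);;
  w_bit <~ var w_x [/] var w_pw;;
  w_bit <~ var w_bit [-] (var w_bit [/] Cst 2) [*] Cst 2;;
  If (var w_bit)
    (Assign a_code (var w_next [+] (var a_m [-] (var w_i [-] var w_z) [-] Cst 1))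
       (var w_x))
    (Assign a_code (var w_next [+] var w_z) (var w_x);; w_z <~ var w_z [+] Cst 1);;
  w_i <~ var w_i [+] Cst 1;;
  Assign a_rank (var w_base [+] var w_i) (var w_z).

Definition build_level : cmd :=
  (w_i <~ Cst 0;;
   w_z <~ Cst 0;;
   Assign a_rank (var w_base) (Cst 0);;
   w_next <~ var w_base [+] (var a_m [+] Cst 1));;
  While (var w_i [<] var a_m) place;;
  (w_base <~ var w_next;; w_pw <~ var w_pw [/] Cst 2).

Definition build_wavelet : cmd :=
  (w_pw <~ Cst 1;; w_nn <~ var a_n [*] var a_n);;
  While (var w_pw [<] var w_nn) (w_pw <~ var w_pw [+] var w_pw);;
  (a_pw0 <~ var w_pw;; w_base <~ Cst 0);;
  While (var w_pw) build_level.

Section Build.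

Context (w : nat) (w_ge6 : 5 < w).
Context (n : nat) (pts : seq nat).

Notation h := (up_log 2 (n * n)).
Notation m := (size pts).

Context (h_word : 2 ^ h.+2 <= 2 ^ w) (pts_word : h.+2 * m.+1 < 2 ^ w).
Context (pts_lt : all (fun x => x < 2 ^ h.+1) pts).

Definition code_level (t : nat) (s : memory) : Prop :=
  forall i, i < m -> s a_code (times t m.+1 + i) = nth 0 (wlevel h pts t) i.

Definition rank_level (t : nat) (s : memory) : Prop :=
  forall i, i <= m ->
    s a_rank (times t m.+1 + i) = zeros (2 ^ (h - t)) (wlevel h pts t) i.

Lemma wlevel_lt t i : i < m -> nth 0 (wlevel h pts t) i < 2 ^ h.+1.
Proof.
move=> lt_i; have /allP := pts_lt; apply.
by rewrite -(perm_mem (perm_wlevel h pts t)) mem_nth // size_wlevel.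
Qed.

Lemma level_word t : t <= h -> times t m.+1 + m.+1 + m.+1 < 2 ^ w.
Proof.
move=> th; apply: leq_ltn_trans pts_word.
have : t * m.+1 <= h * m.+1 by rewrite leq_mul2r th orbT.
by rewrite /times !mulSn; clear; lia.
Qed.

Definition placed (t i : nat) (s : memory) : Prop :=
  let lv := wlevel h pts t in let z := zeros (2 ^ (h - t)) lv in
  [/\ s w_i 0 = i, s w_z 0 = z i,
      forall k, k < z i \/ m - (i - z i) <= k < m ->
        s a_code (times t.+1 m.+1 + k) = nth 0 (wlevel h pts t.+1) k,
      forall k, k <= i -> s a_rank (times t m.+1 + k) = z k
    & code_level t s /\ forall t', t' < t -> rank_level t' s].

Lemma run_place t i s : t <= h -> i < m -> placed t i s ->
  s w_base 0 = times t m.+1 -> s w_next 0 = times t.+1 m.+1 ->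
  s w_pw 0 = 2 ^ (h - t) -> s a_m 0 = m ->
  run w place 70 s (fun _ => placed t i.+1).
Proof.
move=> th im [Ei Ez Hcode Hrank [Hlev Hrk]] Eb En Ep Em.
set lv := wlevel h pts t in Ez Hcode Hrank Hlev *.
set pw := 2 ^ (h - t) in Ez Hcode Hrank Ep *.
set z := zeros pw lv in Ez Hcode Hrank *.
have szl : size lv = m by rewrite size_wlevel.
have pw0 : 0 < pw by rewrite expn_gt0.
have z_le : z i <= i by apply: leq_zeros; rewrite szl ltnW.
have zS : z i.+1 = z i + ~~ bit pw (nth 0 lv i) by apply: zerosS; rewrite szl.
have x_word : nth 0 lv i < 2 ^ w.
  apply: leq_trans h_word; apply: ltn_trans (wlevel_lt t im) _.
  by rewrite ltn_exp2l.
have Hword := level_word th; have tS := timesS t m.+1.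
have n0 : bit pw (nth 0 lv i) = false ->
  nth 0 lv i = nth 0 (wlevel h pts t.+1) (z i).
  by move=> b0; rewrite -(nth_split_bit0 (pw := pw)) ?szl ?b0.
have n1 : bit pw (nth 0 lv i) ->
  nth 0 lv i = nth 0 (wlevel h pts t.+1) (m - (i - z i) - 1).
  by move=> b1; rewrite -(nth_split_bit1 (pw := pw)) ?szl // subn1.
apply: (run_block w_ge6 (phi' := 0)) => //=.
rewrite Eb Ei (Hlev i im) -/lv Ep En Em Ez.
have bitE : (nth 0 lv i %/ pw - nth 0 lv i %/ pw %/ 2 * 2 != 0) = bit pw (nth 0 lv i).
  by rewrite /bit; clear; lia.
have div_le : nth 0 lv i %/ pw <= nth 0 lv i by apply: leq_div.
have off_ne k l : k < m.+1 -> (times t m.+1 + k == times t.+1 m.+1 + l) = false.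
  by rewrite tS; clear; lia.
have rank_ne t' k i' : t' < t -> k <= m ->
    (times t' m.+1 + k == times t m.+1 + i') = false.
  by move=> lt_t' km; have := leq_times m.+1 lt_t'; rewrite timesS; clear -km; lia.
rewrite bitE; vc => //; try by clear -im Hword x_word div_le; lia.
case: ifP => b; vc => //; try by clear -im z_le Hword tS; lia.
- split; rewrite /= ?addn1 -/lv -/pw -/z ?zS ?b ?addn0 //.
  + move=> k Hk; rewrite eqn_add2l; case: eqP => [->|ne]; first exact: n1.
    by apply: Hcode; clear -Hk ne im z_le; lia.
  + move=> k le_k; rewrite eqn_add2l; case: eqP => [->|ne].
      by rewrite zS b addn0.
    by apply: Hrank; clear -ne le_k; lia.
  + split=> [k km|t' lt_t' k km] /=; first by rewrite off_ne ?Hlev // ltnW.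
    by rewrite rank_ne // Hrk.
- split; rewrite /= ?addn1 -/lv -/pw -/z ?zS ?b ?addn1 //.
  + move=> k Hk; rewrite eqn_add2l; case: eqP => [->|ne]; first exact: n0.
    by apply: Hcode; clear -Hk ne im z_le; lia.
  + move=> k le_k; rewrite eqn_add2l; case: eqP => [->|ne].
      by rewrite zS b addn1.
    by apply: Hrank; clear -ne le_k; lia.
  + split=> [k km|t' lt_t' k km] /=; first by rewrite off_ne ?Hlev // ltnW.
    by rewrite rank_ne // Hrk.
Qed.

Lemma run_build_level t s : t <= h -> code_level t s ->
  (forall t', t' < t -> rank_level t' s) ->
  s w_base 0 = times t m.+1 -> s w_pw 0 = 2 ^ (h - t) -> s a_m 0 = m ->
  run w build_level (times m 80 + 60) s (fun _ s' =>
    [/\ code_level t.+1 s', forall t', t' < t.+1 -> rank_level t' s',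
        s' w_base 0 = times t.+1 m.+1 & s' w_pw 0 = 2 ^ (h - t) %/ 2]).
Proof.
move=> th Hlev Hrk Eb Ep Em; have Hword := level_word th.
apply: (run_block_seq w_ge6 (phi1 := times m 80 + 30)) => //=.
  by clear; lia.
rewrite Eb Em; vc => //; try by clear -Hword; lia.
set s1 := upd _ _ _ _ => F1.
have P1 : placed t 0 s1.
  have z0 : zeros (2 ^ (h - t)) (wlevel h pts t) 0 = 0 by rewrite /zeros take0.
  rewrite /placed z0; split=> //.
  - by move=> k; rewrite ltn0 subn0; clear; lia.
  - by move=> k; rewrite leqn0 => /eqP->; rewrite /s1 /= addn0 eqxx z0.
  - split=> // t' lt_t' k km; rewrite /s1 /= ifN ?Hrk //.
    have := leq_times m.+1 lt_t'; rewrite timesS; clear -km; lia.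
apply: (run_call w_ge6 (run_for w_ge6 (J := placed t) (i := 0) (m := m) (K := 70) _ _ P1 _)
  (phi2 := 14)) => //=.
- move=> j s2 le_j [Ej Ez H1 H2 H3] F2; rewrite Ej (_ : s2 a_m 0 = m); last by rewrite F2.
  split=> // lt_j; apply: run_place => //; rewrite F2 // /s1 /= timesS.
  by clear; lia.
- by rewrite subn0 -[70 + _ + 1]/(76) /times; clear; lia.
move=> s2 [_ _ H1 H2 [H3 H4]] F2.
apply: (run_block w_ge6 (phi' := 0)) => //=.
have Ep2 : s2 w_pw 0 = 2 ^ (h - t) by rewrite F2.
rewrite Ep2 F2 // (_ : s1 w_next 0 = times t.+1 m.+1); last first.
  by rewrite /s1 /= timesS; clear; lia.
vc => //.
  by apply: leq_trans h_word; rewrite ltn_exp2l //; clear; lia.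
split=> //.
- move=> i im; rewrite /= H1 //.
  set z := zeros _ _ _ in H1 *; have z_le : z <= m by apply: leq_zeros; rewrite size_wlevel.
  (* After all [m] elements the two filled ends meet, so every cell is written. *)
  by case: (ltnP i z) => Hi; [left | right; rewrite subKn // Hi im].
- move=> t'; rewrite ltnS leq_eqVlt => /predU1P[->|/H4//] k km; exact: H2.
Qed.

Lemma run_build_wavelet s : s a_n 0 = n -> n * n < 2 ^ w -> s a_m 0 = m ->
  (forall i, i < m -> s a_code i = nth 0 pts i) ->
  run w build_wavelet (times h.+2 (times m 80 + 100) + 60) s
    (fun _ => wavelet_mem h pts).
Proof.
move=> En nn_word Em Hcode.
apply: (run_block_seq w_ge6 (phi1 := times h.+2 (times m 80 + 100) + 40)) => //=.
  by clear; lia.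
rewrite En; vc => //; set s1 := upd _ _ _ _ => F1.
(* [up_log] is the least exponent whose power reaches [n * n], so the doubling stops exactly at
   [2 ^ h]. *)
pose J i (s : memory) := s w_pw 0 = 2 ^ i.
apply: (run_call w_ge6 (run_for w_ge6 (J := J) (i := 0) (m := h) (K := 8) _ _ _ _)
  (phi2 := times h.+1 (times m 80 + 63) + 20)) => //=.
- move=> j s2 jh Ej F2; rewrite (_ : s2 w_nn 0 = n * n); last by rewrite F2.
  rewrite Ej; split=> //.
    rewrite !ltnNge; congr (~~ _); apply/idP/idP => [|hj]; first exact: up_log_min.
    by apply: leq_trans (up_logP _ (ltnSn 1)) _; rewrite leq_exp2l.
  move=> lt_j; apply: (run_block w_ge6 (phi' := 0)) => //=.
  rewrite Ej addnn -mul2n -expnS; vc => //.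
  by apply: leq_trans h_word; rewrite ltn_exp2l //; clear -jh; lia.
- rewrite subn0 -[8 + _ + 1]/(14) timesS (_ : 100 = 63 + 37) // addnA timesD.
  by rewrite timesS /times; clear; nia.
move=> s2 Ep2 F2.
apply: (run_block_seq w_ge6 (phi1 := times h.+1 (times m 80 + 63) + 10)) => //=.
  by clear; lia.
rewrite Ep2; vc => //; set s3 := upd _ _ _ _ => F3.
pose L t (s : memory) := [/\ code_level t s, forall t', t' < t -> rank_level t' s,
  s w_base 0 = times t m.+1 & s w_pw 0 = 2 ^ (h.+1 - t) %/ 2].
have half t : t <= h -> 2 ^ (h.+1 - t) %/ 2 = 2 ^ (h - t).
  by move=> th; rewrite subSn // expnS mulKn.
apply: (run_last w_ge6 (run_for w_ge6 (J := L) (i := 0) (m := h.+1)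
  (K := times m 80 + 60) _ _ _ _) (phi2 := 0)) => //=.
- split=> //; last by rewrite half ?subn0.
  move=> i im; rewrite -(Hcode i im) /s3 /= F2 //.
- move=> t s4 t_le [H1 H2 H3 H4] F4; rewrite H4; split=> //.
    have [lt_t|] := ltnP t h.+1; first by rewrite half // -lt0n expn_gt0.
    move=> ge_t; have -> : t = h.+1 by clear -t_le ge_t; lia.
    by rewrite subnn.
  move=> lt_t; rewrite half // in H4.
  have Em4 : s4 a_m 0 = m by rewrite F4 // /s3 /= F2.
  apply: (run_last w_ge6 (run_build_level lt_t H1 H2 H3 H4 Em4) (phi2 := 0)).
    by rewrite addn0.
  by move=> s5 H5 _; rewrite /L subSS.
- by rewrite subn0 addn0 (_ : _ + 60 + 2 + 1 = times m 80 + 63); clear; lia.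
move=> s4 [_ H2 _ _] F4; split; rewrite ?F4 // /s3 /= ?F2 //.
by move=> t i th im; rewrite -(H2 t) // ltnS.
Qed.

End Build.

(** * Listing the edges and finding the ends of subtrees *)

Definition list_point : cmd :=
  Assign a_code (var p_q)
    (Get a_pre (Get a_adj (var p_i)) [*] var a_n [+] var p_k);;
  p_q <~ var p_q [+] Cst 1;;
  p_i <~ var p_i [+] Cst 1.

Definition list_points_of : cmd :=
  (p_v <~ Get a_ord (var p_k);;
   Assign a_ps (var p_k) (var p_q);;
   Assign a_pp (var p_k) (Get a_pre (Get a_par (var p_v)));;
   p_i <~ Get a_off (var p_v);;
   p_end <~ Get a_off (var p_v [+] Cst 1));;
  While (var p_i [<] var p_end) list_point;;
  p_k <~ var p_k [+] Cst 1.

(** The sentinel at index [n] lets the edges of a subtree that ends at [n] be delimited like any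
    others. *)
Definition list_points : cmd :=
  (p_k <~ Cst 0;; p_q <~ Cst 0);;
  While (var p_k [<] var a_n) list_points_of;;
  (Assign a_ps (var a_n) (var p_q);; a_m <~ var p_q).

(** Vertices are scanned downwards, 0 marking an unknown end. A vertex still unmarked when reached
    is a leaf; the child met first is the last child of its parent, so that both subtrees have the
    same end. *)
Definition close_subtree : cmd :=
  (p_k <~ var p_k [-] Cst 1;;
   If (Get a_fin (var p_k) [==] Cst 0)
     (Assign a_fin (var p_k) (var p_k [+] Cst 1)) Skip);;
  If (Get a_fin (Get a_pp (var p_k)) [==] Cst 0)
    (Assign a_fin (Get a_pp (var p_k)) (Get a_fin (var p_k))) Skip.

Definition close_subtrees : cmd :=
  p_k <~ var a_n;; While (var p_k) close_subtree.

Section Close.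

Context (n : nat) (E : rel nat) (p fin : nat -> nat).
Context (tree : preorder_tree n E p fin) (p0 : p 0 = 0).
Context (w : nat) (w_ge6 : 5 < w) (n_word : n + n + 8 < 2 ^ w).

Definition has_child_from (k j : nat) : bool :=
  has (fun c => [&& 0 < c, k <= c & p c == j]) (iota 0 n).

Lemma has_child_fromP k j : reflect
  (exists c, [/\ 0 < c, k <= c, c < n & p c = j]) (has_child_from k j).
Proof.
apply: (iffP hasP) => [[c]|[c [c0 kc cn pc]]].
  rewrite mem_iota => /andP[_ cn] /and3P[c0 kc /eqP pc].
  by exists c.
by exists c; [rewrite mem_iota | rewrite c0 kc pc eqxx].
Qed.

(* The subtrees of k, ..., n-1 are closed; the smaller vertices with a child among
   these have their final value already. *)
Definition closed_from (k : nat) (s : memory) : Prop :=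
  forall j, j < n ->
    s a_fin j = if (k <= j) || has_child_from k j then fin j else 0.

Lemma run_close_subtree c s : c < n -> closed_from c.+1 s ->
  s p_k 0 = c.+1 -> (forall k, k < n -> s a_pp k = p k) ->
  run w close_subtree 50 s (fun _ s' => closed_from c s' /\ s' p_k 0 = c).
Proof.
move=> cn Hcl Ek Epp; have c_fin := ltn_fin tree cn.
have pn : p c < n.
  by case: (posnP c) => [->|c0]; [rewrite p0; lia | have := parent_lt tree (k := c); lia].
have leaf : has_child_from c.+1 c = false -> fin c = c.+1.
  move=> /has_child_fromP H; apply/eqP; rewrite eqn_leq c_fin andbT leqNgt.
  apply/negP => lt; apply: H; exists c.+1; split=> //.
    by have := leq_fin tree cn; lia.
  exact: (first_child tree).
(* If the subtree of the parent went on beyond [fin c], then [fin c] would be a later child by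
   [next_sibling]. *)
have last_ch : 0 < c -> has_child_from c.+1 (p c) = false -> fin (p c) = fin c.
  move=> c0 /has_child_fromP H.
  have c_in : 0 < c < n by rewrite c0.
  have pc := parent_lt tree c_in.
  have c_sub : p c <= c < fin (p c).
    by rewrite (subtree_parent tree pn) ?leqnn ?(ltn_fin tree pn) //; lia.
  have le := fin_subtree tree pn c_sub.
  apply/eqP; rewrite eqn_leq le andbT leqNgt; apply/negP => lt; apply: H.
  exists (fin c); split=> //; first by lia.
    by have := leq_fin tree pn; lia.
  by apply: (next_sibling tree pn) => //; lia.
have childS j : has_child_from c j = has_child_from c.+1 j || (0 < c) && (p c == j).
  apply/has_child_fromP/orP => [[d [d0 cd dn pd]]|].
    have [<-|ne] := eqVneq d c; first by right; rewrite d0 pd eqxx.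
    by left; apply/has_child_fromP; exists d; split=> //; lia.
  case=> [/has_child_fromP[d [d0 cd dn pd]]|/andP[c0 /eqP pc]].
    by exists d; split=> //; lia.
  by exists c.
have fin_c : s a_fin c = if has_child_from c.+1 c then fin c else 0.
  by rewrite Hcl // ltnn.
pose R (phi : nat) s1 := [/\ phi = 25, s1 p_k 0 = c &
  forall j, j < n -> s1 a_fin j = if (c <= j) || has_child_from c.+1 j then fin j else 0].
apply: (run_seq w_ge6 (R := R)).
  apply: (run_block w_ge6 (phi' := 25)) => //=; rewrite Ek subn1 /= fin_c.
  vc => //; first by lia.
  case: ifP => Hc; vc => //; try by lia.
    have leaf_c : fin c = c.+1.
      by apply: leaf; apply/negP => H; move: Hc; rewrite H => /eqP; lia.
    split=> //= j jn; rewrite Hcl // addn1; case: eqP => [->|ne].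
      by rewrite leqnn leaf_c.
    by rewrite (_ : (c <= j) = (c < j)) //; lia.
  split=> //= j jn; rewrite Hcl //; have [ejc|ne] := eqVneq j c.
    by rewrite ejc leqnn ltnn /=; move: Hc; case: ifP.
  by rewrite (_ : (c <= j) = (c < j)) //; lia.
move=> phi s1 [-> Ek1 H1] F1.
have Epp1 : s1 a_pp c = p c by rewrite F1 ?Epp.
apply: (run_block w_ge6 (phi' := 0)) => //=; rewrite Ek1 Epp1 !H1 // leqnn /=.
have closed j : (c <= j) || has_child_from c j
   = (c <= j) || has_child_from c.+1 j || (p c == j).
  rewrite childS; case: (posnP c) => [->|c0]; first by rewrite p0.
  by rewrite orbA.
case: ifP => Hc; vc => //=.
  move=> j jn; rewrite closed /=; have [e1|ne] := eqVneq j (p c); last first.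
    by rewrite H1 // orbF.
  rewrite e1 orbT last_ch //.
    case: (posnP c) => // c_0; move: Hc; rewrite c_0 p0 leqnn /=.
    by have := ltn_fin tree cn; rewrite c_0; lia.
  apply/negP => H; move: Hc; rewrite H orbT.
  by have := ltn_fin tree pn; lia.
move=> j jn; rewrite closed H1 //; case: (p c =P j) => [<-|]; last by rewrite orbF.
rewrite orbT; case: ifP Hc => // -> /eqP; lia.
Qed.

Lemma run_close_subtrees s : s a_n 0 = n -> (forall j, s a_fin j = 0) ->
  (forall k, k < n -> s a_pp k = p k) ->
  run w close_subtrees (times n 60 + 20) s
    (fun _ s' => forall k, k < n -> s' a_fin k = fin k).
Proof.
move=> En Efin Epp.
apply: (run_block_seq w_ge6 (phi1 := times n 60 + 10)) => //=; first by lia.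
rewrite En; vc => // F1; set s1 := upd _ _ _ _ in F1 *.
pose J i s := closed_from (n - i) s /\ s p_k 0 = n - i.
apply: (run_last w_ge6 (run_for w_ge6 (J := J) (i := 0) (m := n) (K := 50) _ _ _ _)
  (phi2 := 0)) => //=.
- split; last by rewrite subn0.
  move=> j jn; rewrite /s1 /= Efin subn0 leqNgt jn /=.
  by case: has_child_fromP => // -[c [_ le lt _]]; lia.
- move=> j s2 jn [H1 H2] F2; rewrite H2; split=> //; first by lia.
  move=> lt_j; rewrite -(subnSK lt_j) in H1 H2.
  apply: (run_last w_ge6 (run_close_subtree _ H1 H2 _) (phi2 := 0)) => //; first by lia.
  by move=> k kn; rewrite F2 // /s1 /= Epp.
- by rewrite subn0 -[50 + _ + 1]/(53) /times; lia.
- by move=> s2 [H _] _ k kn; rewrite H // subnn.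
Qed.

End Close.

Section Points.

Context (n : nat) (e : rel 'I_n) (r : 'I_n) (T : 'I_n -> 'I_n).
Context (adj : 'I_n -> seq 'I_n).
Context (e_sym : symmetric e) (e_irr : irreflexive e).
Context (adjP : adjacency_lists e adj) (dfs : dfs_tree e [set: 'I_n] r T).
Context (o : seq 'I_n) (Vo : visits T adj [:: r] o).

Definition points_of (k : nat) : seq nat :=
  [seq index u o * n + k | u <- adj (nth r o k)].

Definition points_between (i j : nat) : seq nat :=
  flatten [seq points_of k | k <- iota i (j - i)].

Definition points : seq nat := points_between 0 n.

Definition points_start (k : nat) : nat := size (points_between 0 k).

Lemma points_between_cat i j k : i <= j <= k ->
  points_between i k = points_between i j ++ points_between j k.
Proof.
move=> ijk; rewrite /points_between -flatten_cat -map_cat.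
rewrite (_ : k - i = (j - i) + (k - j)); last by lia.
by rewrite iotaD subnKC //; lia.
Qed.

Lemma points_between1 k : points_between k k.+1 = points_of k.
Proof. by rewrite /points_between subSnn /= cats0. Qed.

Lemma points_startS k :
  points_start k.+1 = points_start k + size (adj (nth r o k)).
Proof.
rewrite /points_start (@points_between_cat 0 k k.+1) ?leqnSn //.
by rewrite points_between1 size_cat size_map.
Qed.

Lemma segment_points i j : i <= j <= n ->
  segment points (points_start i) (points_start j) = points_between i j.
Proof.
move=> ij; rewrite /points (@points_between_cat 0 j) /segment; last by lia.
rewrite take_size_cat // (@points_between_cat 0 i) ?drop_size_cat //; lia.
Qed.

Lemma nth_points k i : k < n -> i < size (adj (nth r o k)) ->
  nth 0 points (points_start k + i) = index (nth r (adj (nth r o k)) i) o * n + k.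
Proof.
move=> kn Hi; rewrite /points (@points_between_cat 0 k); last by lia.
rewrite (@points_between_cat k k.+1); last by lia.
rewrite nth_cat ltnNge leq_addr addKn points_between1 nth_cat size_map Hi.
by rewrite (nth_map r).
Qed.

Lemma size_points : size points = offset adj n.
Proof.
rewrite offset_last -(sum_order e_sym e_irr adjP dfs Vo) (big_nth r).
rewrite (size_order e_sym e_irr adjP dfs Vo) /points /points_between subn0.
rewrite size_flatten /shape -map_comp sumnE big_map.
by rewrite /index_iota subn0; apply: eq_bigr => k _; rewrite /= size_map.
Qed.

Lemma points_listed_order :
  points_listed n (up_log 2 (n * n)) (label_edge e r o) points_start points.
Proof.
have idx := index_order e_sym e_irr adjP dfs Vo.
have lab v : nth r o (index v o) = v by exact: (label_index e_sym e_irr adjP dfs Vo).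
have code k u : k < n -> ((index u o * n + k) %% n = k)
    * ((index u o * n + k) %/ n = index u o).
  by move=> kn; split; [rewrite modnMDl modn_small | rewrite divnMDl ?divn_small ?addn0 //; lia].
have mem_between i j x : i <= j <= n ->
  (x \in points_between i j) = (i <= x %% n < j) && label_edge e r o (x %% n) (x %/ n).
  move=> ij; apply/flattenP/idP => [[s /mapP[k]]|/andP[x_in /and3P[kn bn Eab]]].
    rewrite mem_iota => k_in -> /mapP[u u_adj ->].
    have kn : k < n by lia.
    rewrite !code // /label_edge kn idx lab -[e _ _]((adjP (nth r o k)).2 u).
    by rewrite u_adj !andbT; lia.
  exists (points_of (x %% n)); first by apply: map_f; rewrite mem_iota; lia.
  apply/mapP; exists (nth r o (x %/ n)).
    by rewrite (adjP _).2; exact: Eab.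
  by rewrite (index_label e_sym e_irr adjP dfs Vo) // -divn_eq.
split.
- move=> i j ij; apply/andP; split; last first.
    by rewrite /points_start /points (@points_between_cat 0 j n) ?size_cat ?leq_addr //; lia.
  by rewrite /points_start (@points_between_cat 0 i j) ?size_cat ?leq_addr //; lia.
- by move=> i j x ij; rewrite segment_points // mem_between.
- apply/allP => x; rewrite mem_between ?leqnn // => /andP[_ /and3P[kn bn _]].
  have n2 : n * n <= 2 ^ up_log 2 (n * n) by exact: up_logP.
  have : x < n * n by rewrite -ltn_divLR //; lia.
  by rewrite expnS; lia.
Qed.

Context (w : nat) (w_ge6 : 5 < w).
Context (n_word : n + n + 8 < 2 ^ w) (nn_word : n * n + n < 2 ^ w).
Context (off_word : offset adj n + 1 < 2 ^ w).

Definition listed_to (k m : nat) (s : memory) : Prop :=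
  [/\ s p_q 0 = m, forall j, j < k -> s a_ps j = points_start j,
      forall j, j < k -> s a_pp j = label_parent r T o j
    & forall j, j < m -> s a_code j = nth 0 points j].

Definition numbered (s : memory) : Prop :=
  (forall k, k < n -> s a_ord k = nth r o k) /\
  forall v : 'I_n, s a_pre v = index v o.

Lemma numbered_frame l s s1 : all (fun a => a \notin l) [:: a_ord; a_pre] ->
  frame l s s1 -> numbered s -> numbered s1.
Proof.
by case/and3P=> H1 H2 _ F [M1 M2]; split=> [k kn|v]; rewrite F //; auto.
Qed.

Lemma run_list_points_of k s : k < n -> input_ok adj T s -> numbered s ->
  listed_to k (points_start k) s -> s p_k 0 = k ->
  run w list_points_of (times (size (adj (nth r o k))) 40 + 80) s
    (fun _ s' => listed_to k.+1 (points_start k.+1) s' /\ s' p_k 0 = k.+1).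
Proof.
move=> kn M [Hord Hpre] [Eq Hps Hpp Hcode] Ek; set v := nth r o k.
have [En Hoff Hadj Hpar] := M; have vn := ltn_ord v.
apply: (run_block_seq w_ge6 (phi1 := times (size (adj v)) 40 + 40)) => //=.
  by clear; lia.
rewrite Ek Hord // -/v Hpar Hpre Eq addn1 !Hoff //; last by rewrite ltnW.
vc => //; first by clear -vn n_word; lia.
set s1 := upd _ _ _ _ => F1.
have M1 : input_ok adj T s1 by apply: input_ok_frame F1 M.
have N1 : numbered s1 by apply: numbered_frame F1 _.
have offS := offsetS adj v.
have start_le i : i <= size (adj v) -> points_start k + i <= offset adj n.
  have [/(_ k.+1 k.+1) mono _ _] := points_listed_order.
  move: mono; rewrite leqnn kn => /(_ isT)/andP[_].
  by rewrite points_startS -/v size_points; clear; lia.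
pose J i s2 := [/\ s2 p_q 0 = points_start k + i, s2 p_i 0 = offset adj v + i
  & forall j, j < points_start k + i -> s2 a_code j = nth 0 points j].
apply: (run_call w_ge6 (run_for w_ge6 (J := J) (i := 0) (m := size (adj v)) (K := 34)
  _ _ _ _) (phi2 := 10)) => //=.
- by split; rewrite ?addn0.
- move=> i s2 le_i [Eq2 Ei2 Hc2] F2; have M2 : input_ok adj T s2 by apply: input_ok_frame F2 M1.
  have [En2 _ Hadj2 _] := M2; have [_ Hpre2] : numbered s2 by apply: numbered_frame F2 N1.
  rewrite Ei2 (_ : s2 p_end 0 = offset adj v.+1); last by rewrite F2.
  rewrite offS ltn_add2l; split=> // lt_i.
  apply: (run_block w_ge6 (phi' := 0)) => //=.
  rewrite Ei2 Hadj2 // Hpre2 En2 Eq2 (_ : s2 p_k 0 = k); last by rewrite F2.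
  have idx := index_order e_sym e_irr adjP dfs Vo (nth v (adj v) i).
  have code_lt : index (nth v (adj v) i) o * n + k < n * n + n.
    have : index (nth v (adj v) i) o * n <= n * n by rewrite leq_mul2r ltnW // orbT.
    by clear -kn; lia.
  have := start_le i (ltnW lt_i) => sl.
  have off_le : offset adj v + i <= offset adj n.
    by have := @leq_offset _ adj v.+1 n vn; rewrite offS; clear -lt_i; lia.
  vc => //; try by clear -code_lt nn_word sl off_le off_word; lia.
  split=> /=; rewrite ?addn1 ?addnS // => j; rewrite ltnS leq_eqVlt.
  case: eqP => [-> _|_ /= lt_j]; last exact: Hc2.
  by rewrite nth_points // (set_nth_default v).
- by rewrite subn0 -[34 + _ + 1]/(40); clear; lia.
move=> s2 [Eq2 Ei2 Hc2] F2.
apply: (run_block w_ge6 (phi' := 0)) => //=.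
rewrite (_ : s2 p_k 0 = k); last by rewrite F2.
vc => //; first by clear -kn n_word; lia.
  split=> /=.
  - by rewrite Eq2 points_startS.
  - move=> j; rewrite F2 // /s1 /= ltnS leq_eqVlt.
    by case: eqP => [->|_ /= lt_j] //; apply: Hps.
  - move=> j; rewrite F2 // /s1 /= ltnS leq_eqVlt.
    by case: eqP => [->|_ /= lt_j] //; apply: Hpp.
  - by rewrite points_startS.
by rewrite /= addn1.
Qed.

Lemma run_list_points s : input_ok adj T s -> numbered s ->
  run w list_points (times n 150 + times (offset adj n) 40 + 60) s
    (fun _ s' =>
      [/\ forall k, k <= n -> s' a_ps k = points_start k,
          forall k, k < n -> s' a_pp k = label_parent r T o k,
          s' a_m 0 = size points
        & forall j, j < size points -> s' a_code j = nth 0 points j]).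
Proof.
move=> M N; have [En _ _ _] := M.
apply: (run_block_seq w_ge6 (phi1 := times n 150 + times (offset adj n) 40 + 40)) => //=.
  by clear; lia.
vc => //; set s1 := upd _ _ _ _ => F1.
have M1 : input_ok adj T s1 by apply: input_ok_frame F1 M.
have N1 : numbered s1 by apply: numbered_frame F1 N.
pose wt k := \sum_(v <- drop k o) (times (size (adj v)) 40 + 100).
have on := size_order e_sym e_irr adjP dfs Vo.
pose I (phi : nat) (s2 : memory) := exists2 k, k <= n &
  [/\ listed_to k (points_start k) s2, s2 p_k 0 = k & wt k + 30 <= phi].
apply: (run_seq w_ge6 (R := fun phi s2 => phi = 20 /\ listed_to n (points_start n) s2)).
  apply: (@run_while w w_ge6 _ _ I) => //.
    exists 0 => //; split=> //.
    by rewrite /wt drop0 (sum_order_cost e_sym e_irr adjP dfs Vo) /times; clear; lia.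
  move=> phi s2 [k le_kn [L2 Ek Hphi]] F2.
  have M2 : input_ok adj T s2 by apply: input_ok_frame F2 M1.
  have N2 : numbered s2 by apply: numbered_frame F2 N1.
  have [En2 _ _ _] := M2.
  split=> //.
  have [lt_k|ge_k] := ltnP k n; last first.
    exists 20; first by rewrite /=; clear -Hphi; lia.
    have ek : k = n by clear -le_kn ge_k; lia.
    by rewrite /= Ek En2 ek ltnn; split=> //; rewrite -ek.
  have wtS : wt k = wt k.+1 + (times (size (adj (nth r o k))) 40 + 100).
    by rewrite /wt (drop_nth r) ?on // big_cons addnC.
  exists (phi - 6); first by rewrite /=; clear -Hphi; lia.
  rewrite /= Ek En2 lt_k.
  apply: (run_last w_ge6 (run_list_points_of lt_k M2 N2 L2 Ek) (phi2 := wt k.+1 + 30)).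
    by clear -Hphi wtS; lia.
  by move=> s3 [L3 Ek3] F3; exists k.+1.
move=> _ s2 [-> [Eq Hps Hpp Hcode]] F2.
apply: (run_block w_ge6 (phi' := 0)) => //=.
have En2 : s2 a_n 0 = n by rewrite F2 // /s1 /= En.
rewrite En2 Eq; vc => //; split=> //= k; rewrite leq_eqVlt.
by case: eqP => [->|_ /= lt_k] //; apply: Hps.
Qed.

End Points.

(** * The two programs and their specifications *)

Definition preprocess : cmd :=
  number_vertices;; list_points;; close_subtrees;; build_wavelet.

Definition answer_step : cmd :=
  Assign a_ans (Get a_ord (var p_k)) (Get a_ord (Get a_out (var p_k)));;
  p_k <~ var p_k [+] Cst 1.

(** The parent recorded for the new root is [n], which is no vertex; its translation is meaningless,
    and the last assignment overwrites it. *)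
Definition reroot : cmd :=
  (r_y <~ Get a_pre (var a_query);;
   r_w <~ Get a_pre (Get a_query (Cst 1));;
   r_a <~ var a_n;;
   r_sp <~ Cst 1);;
  serve_requests;;
  (p_k <~ Get a_pre (var a_query);;
   p_end <~ Get a_fin (Get a_pre (var a_query)));;
  While (var p_k [<] var p_end) answer_step;;
  Assign a_ans (Get a_query (Cst 1)) (Get a_query (Cst 1)).

Section Certificate.

Context (n : nat) (E : rel nat) (p fin : nat -> nat).
Context (tree : preorder_tree n E p fin).

(** The entry at the new root may change: [rerooted] does not constrain it, and [w], being on the
    path, lies in no hanging subtree. *)
Lemma rerooted_frame out out' y w : y < n ->
  (forall u, y <= u < fin y -> u != w -> out' u = out u) ->
  rerooted E p fin out y w -> rerooted E p fin out' y w.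
Proof.
have [m] := ubnP (fin y - y); elim: m y w => // m IH y w lt yn same R.
case: R lt yn same => {}y {}w w_in Hp Hh lt yn same.
have fin_y := leq_fin tree yn; constructor=> // [v onv ne|c hc].
  have onp := on_parent tree yn w_in onv ne.
  have v_in := on_bound tree yn w_in onv.
  have pv : p v < v by apply: (parent_lt tree); lia.
  rewrite same ?Hp //; first by move: onp; rewrite /on_path; lia.
  by move: onv; rewrite /on_path; lia.
have [w' top R'] := Hh c hc; have [w'_in _ _ _] := top.
have notw u : c <= u < fin c -> u != w.
  move=> u_in; apply: contraTneq u_in => ->.
  apply: (hanging_off_path tree yn fin_y hc).
  by rewrite /on_path; have := ltn_fin tree (k := w); lia.
have /and3P[c_in _ _] := hc.
have fin_c : fin c <= fin y by apply: (fin_subtree tree) => //; lia.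
have same_c u : c <= u < fin c -> out' u = out u.
  by move=> u_in; apply: same; [lia | apply: notw].
exists w'; first by rewrite same_c.
apply: IH R' => //; [by have := ltn_fin tree yn; lia | by lia |].
by move=> u u_in _; apply: same_c.
Qed.

End Certificate.

Section Graph.

Context (n : nat) (e : rel 'I_n) (r : 'I_n) (T : 'I_n -> 'I_n).
Context (adj : 'I_n -> seq 'I_n).
Context (e_sym : symmetric e) (e_irr : irreflexive e).
Context (adjP : adjacency_lists e adj) (dfs : dfs_tree e [set: 'I_n] r T).
Context (o : seq 'I_n) (Vo : visits T adj [:: r] o).

Let E := label_edge e r o.
Let p := label_parent r T o.
Let fin := label_fin r T o.

Let tree : preorder_tree n E p fin :=
  label_preorder_tree e_sym e_irr adjP dfs Vo.

Lemma rerooted_dfs_tree x r' out : r' \in subtree T x ->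
  rerooted E p fin out (index x o) (index r' o) ->
  exists2 T' : 'I_n -> 'I_n, dfs_tree e (subtree T x) r' T' &
    forall v, v \in subtree T x -> v != r' ->
      out (index v o) < n /\ T' v = nth r o (out (index v o)).
Proof.
move=> r'_in R0; set S := subtree T x; set y := index x o in R0 *.
set w := index r' o in R0 *.
have idx v : index v o < n := index_order e_sym e_irr adjP dfs Vo v.
have lab v : nth r o (index v o) = v := label_index e_sym e_irr adjP dfs Vo v.
have inS v : (v \in S) = (y <= index v o < fin y).
  by rewrite /fin /label_fin lab (index_subtree e_sym e_irr adjP dfs Vo) inE.
have yn : y < n := idx x.
(* Making the new root its own parent, in place of its attachment, keeps all iterates inside the
   subtree. *)
pose out' k := if k == w then w else out k.
have [|edge reach nontree] := rerooted_dfs tree yn (_ : rerooted E p fin out' y w).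
  by apply: (rerooted_frame tree yn) R0 => u _ /negPf; rewrite /out' => ->.
pose T' v := if v \in S then nth r o (out' (index v o)) else v.
have fin_y := leq_fin tree yn.
have w_in : y <= w < fin y by rewrite -inS.
have out_in v : v \in S -> y <= out' (index v o) < fin y.
  rewrite inS => v_in; have [ew|ne] := eqVneq (index v o) w.
    by rewrite /out' ew eqxx.
  by have [] := edge _ v_in ne.
have idxT v : v \in S -> index (T' v) o = out' (index v o).
  move=> vS; rewrite /T' vS (index_label e_sym e_irr adjP dfs Vo) //.
  by have := out_in v vS; lia.
have T'S v : v \in S -> T' v \in S by move=> vS; rewrite inS idxT ?out_in.
have iterT k v : v \in S -> iter k T' v \in S /\ index (iter k T' v) o = iter k out' (index v o).
  move=> vS; elim: k => //= k [IH1 IH2].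
  by rewrite -IH2 -idxT // T'S.
have climb u v : u \in S -> climbs out' (index u o) (index v o) -> ancestor T' v u.
  move=> uS [k Ek]; have [_ Ei] := iterT k u uS; rewrite Ek in Ei.
  have -> : v = iter k T' u by rewrite -[LHS]lab -[RHS]lab Ei.
  exact: fconnect_iter.
exists T'; last first.
  move=> v vS ne; have := out_in v vS; rewrite /T' vS /out'.
  by rewrite ifN ?(inj_eq (can_inj lab)) // => out_v; split=> //; lia.
split=> //.
- by rewrite /T' r'_in /out' eqxx lab.
- move=> v vS ne; rewrite T'S //=.
  have [||_] := edge (index v o); [by rewrite -inS|by rewrite (inj_eq (can_inj lab))|].
  by rewrite -idxT // /E /label_edge !lab => /and3P[].
- by move=> v vS; apply: (climb _ _ vS); apply: reach; rewrite -inS.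
- move=> u v uS vS euv _ _; apply/orP.
  have [||||] := nontree (index u o) (index v o); rewrite -?inS //.
  + by rewrite /E /label_edge !idx !lab.
  + by right; apply: climb.
  + by left; apply: climb.
Qed.

Let h := up_log 2 (n * n).
Let ps := points_start r adj o.
Let pts := points r adj o.

Definition built (s : memory) : Prop :=
  tree_mem n p fin h ps pts s /\ numbered r o s.

Context (w : nat) (w_ge6 : 5 < w).
Context (n_word : n + n + 8 < 2 ^ w) (nn_word : n * n + n < 2 ^ w).
Context (off_word : offset adj n + 1 < 2 ^ w) (h_word : 2 ^ h.+2 <= 2 ^ w).
Context (pts_word : h.+2 * (offset adj n).+1 < 2 ^ w).

Let size_pts : size pts = offset adj n := size_points e_sym e_irr adjP dfs Vo.

Lemma run_preprocess :
  run w preprocess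
    (times n 410 + times (offset adj n) 100
     + times h.+2 (times (offset adj n) 80 + 100) + 200)
    (input_mem adj T) (fun _ => built).
Proof.
set s0 := input_mem adj T; have M0 : input_ok adj T s0 := input_mem_ok adj T.
set D := times h.+2 _.
apply: (run_call w_ge6 (run_number_vertices e_sym e_irr adjP dfs Vo w_ge6 n_word
  off_word M0) (phi2 := times n 210 + times (offset adj n) 40 + D + 140)).
  by rewrite /times; lia.
move=> s1 N1 F1; have M1 : input_ok adj T s1 by apply: input_ok_frame F1 M0.
apply: (run_call w_ge6 (run_list_points e_sym e_irr adjP dfs Vo w_ge6 n_word
  nn_word off_word M1 N1) (phi2 := times n 60 + D + 80)).
  by rewrite /times; lia.
move=> s2 [Hps Hpp Hm Hcode] F2.
have M2 : input_ok adj T s2 by apply: input_ok_frame F2 M1.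
have N2 : numbered r o s2 by apply: numbered_frame F2 N1.
have [En2 _ _ _] := M2.
have Hfin j : s2 a_fin j = 0 by rewrite F2 // F1 // /s0 input_mem0.
have p0 : p 0 = 0.
  have n0 : 0 < n by apply: leq_ltn_trans (ltn_ord r).
  have /eqP E0 : nth r o 0 == r by rewrite (label_root e_sym e_irr adjP dfs Vo).
  have := index_label e_sym e_irr adjP dfs Vo n0.
  by rewrite /p /label_parent E0 (dfs_root dfs).
apply: (run_call w_ge6 (run_close_subtrees tree p0 w_ge6 n_word En2 Hfin Hpp)
  (phi2 := D + 60)); first by lia.
move=> s3 Hfin3 F3.
have M3 : input_ok adj T s3 by apply: input_ok_frame F3 M2.
have N3 : numbered r o s3 by apply: numbered_frame F3 N2.
have [En3 _ _ _] := M3.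
have [_ _ pts_lt] := points_listed_order e_sym e_irr adjP dfs Vo.
have pts_word' : h.+2 * (size pts).+1 < 2 ^ w by rewrite size_pts.
have nn_word' : n * n < 2 ^ w by lia.
have Hm3 : s3 13 0 = size pts by rewrite F3.
have Hc3 i : i < size pts -> s3 11 i = nth 0 pts i by move=> ?; rewrite F3 // Hcode.
apply: (run_last w_ge6 (run_build_wavelet w_ge6 h_word pts_word' pts_lt En3
  nn_word' Hm3 Hc3) (phi2 := 0)).
  by rewrite -/h size_pts /D; lia.
move=> s4 W4 F4; split; last by apply: numbered_frame F4 N3.
split=> //.
- by rewrite F4.
- by move=> k kn; rewrite !F4 // Hfin3 // F3 // Hpp.
- by move=> k kn; rewrite F4 // F3 // Hps.
Qed.

Lemma run_reroot s (x r' : 'I_n) : built s -> r' \in subtree T x ->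
  run w reroot (times #|subtree T x| (query_cost h + 200 + (query_cost h + 200) + 30)
                + 100)
    (query_mem s x r')
    (fun _ s' => answers e (subtree T x) r' s' /\ built s').
Proof.
move=> [M N] r'_in; set s0 := query_mem s x r'; set S := subtree T x in r'_in *.
set L := query_cost h + 200 + (query_cost h + 200).
have listed := points_listed_order e_sym e_irr adjP dfs Vo.
have idx v : index v o < n := index_order e_sym e_irr adjP dfs Vo v.
have lab v : nth r o (index v o) = v := label_index e_sym e_irr adjP dfs Vo v.
have inS v : (v \in S) = (index x o <= index v o < fin (index x o)).
  by rewrite /fin /label_fin lab (index_subtree e_sym e_irr adjP dfs Vo) inE.
have fin_x : fin (index x o) - index x o = #|S| by rewrite /fin /label_fin lab addKn.
have fin_n : fin (index x o) <= n := leq_fin tree (idx x).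
have F0 : frame [:: a_query] s s0.
  by move=> a; rewrite inE => ne j; rewrite /s0 /query_mem /= (negPf ne).
have M0 : tree_mem n p fin h ps pts s0 by apply: tree_mem_frame F0 M.
have N0 : numbered r o s0 by apply: numbered_frame F0 N.
have [En0 Hpf0 _ _] := M0; have [Hord0 Hpre0] := N0.
have Qx : s0 a_query 0 = x by [].
have Qr : s0 a_query 1 = r' by [].
rewrite timesD.
apply: (run_block_seq w_ge6 (phi1 := times #|S| L + times #|S| 30 + 75)) => //=.
  by lia.
rewrite /= !Hpre0 En0; vc => //; set s1 := upd _ _ _ _ => F1.
have M1 : tree_mem n p fin h ps pts s1 by apply: tree_mem_frame F1 M0.
have N1 : numbered r o s1 by apply: numbered_frame F1 N0.
have St1 : stack_mem [:: (index x o, index r' o, n)] s1 by split=> // -[].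
have r'_range : index x o <= index r' o < fin (index x o) by rewrite -inS.
have pts_word' : h.+2 * (size pts).+1 < 2 ^ w by rewrite size_pts.
have n_h : n * n <= 2 ^ h by apply: up_logP.
apply: (run_call w_ge6 (run_serve_requests tree listed w_ge6 h_word pts_word' n_h
  n_word (idx x) r'_range M1 St1) (phi2 := times #|S| 30 + 65)).
  by rewrite /= fin_x -/L -!addnA leq_add2l; lia.
move=> s2 R2 F2.
have M2 : tree_mem n p fin h ps pts s2 by apply: tree_mem_frame F2 M1.
have N2 : numbered r o s2 by apply: numbered_frame F2 N1.
have [_ Hpf2 _ _] := M2; have [Hord2 Hpre2] := N2.
have Qx2 : s2 a_query 0 = x by rewrite F2 // F1.
have Qr2 : s2 a_query 1 = r' by rewrite F2 // F1.
have [T' dfs' HT'] := rerooted_dfs_tree r'_in R2.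
apply: (run_block_seq w_ge6 (phi1 := times #|S| 30 + 40)) => //=; first by lia.
rewrite Qx2 Hpre2 (Hpf2 _ (idx x)).2; vc => //; set s3 := upd _ _ _ _ => F3.
have M3 : tree_mem n p fin h ps pts s3 by apply: tree_mem_frame F3 M2.
have N3 : numbered r o s3 by apply: numbered_frame F3 N2.
pose J i s4 := s4 p_k 0 = index x o + i /\
  forall j, index x o <= j < index x o + i ->
    s4 a_ans (nth r o j) = s2 a_ord (s2 a_out j).
apply: (run_call w_ge6 (run_for w_ge6 (J := J) (i := 0) (m := #|S|) (K := 16)
  _ _ _ _) (phi2 := 10)) => //=.
- by split=> [|j]; [rewrite addn0 | lia].
- move=> i s4 i_le [Ek H4] F4; have N4 : numbered r o s4 by apply: numbered_frame F4 N3.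
  have [Hord4 _] := N4.
  rewrite Ek (_ : s4 p_end 0 = index x o + #|S|); last first.
    by rewrite F4 // /s3 /= /fin /label_fin lab.
  rewrite ltn_add2l; split=> // lt_i.
  have kn : index x o + i < n by rewrite -fin_x in lt_i; lia.
  apply: (run_block w_ge6 (phi' := 0)) => //=.
  rewrite Ek Hord4 //; vc => //; first by lia.
  split=> /=; first by rewrite addn1 addnS.
  move=> j j_in; rewrite [s4 a_out _]F4 // [s4 a_ord _]F4 //.
  rewrite (inj_eq val_inj) nth_uniq ?(size_order e_sym e_irr adjP dfs Vo) //; first last.
  + exact: (uniq_order e_sym e_irr adjP dfs Vo).
  + by lia.
  by case: eqP => [->|ne] //; apply: H4; lia.
- by rewrite subn0 -[16 + _ + 1]/(22) /times; lia.
move=> s4 [_ H4] F4.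
have Qr4 : s4 a_query 1 = r' by rewrite F4 // F3.
have B4 : built s4.
  by split; [apply: tree_mem_frame F4 M3 | apply: numbered_frame F4 N3].
apply: (run_block w_ge6 (phi' := 0)) => //=; rewrite Qr4; vc => //.
exists T' => // v vS; rewrite /= (inj_eq val_inj).
have [->|ne] := eqVneq v r'; first by rewrite (dfs_root dfs').
have [out_n ->] := HT' v vS ne.
rewrite -{1}[v]lab H4; last by rewrite -fin_x subnKC -?inS //; move: vS; rewrite inS; lia.
by rewrite Hord2.
Qed.

End Graph.

(** * Running times *)

Section Counting.

Context (n : nat) (e : rel 'I_n) (r : 'I_n) (T : 'I_n -> 'I_n).
Context (adj : 'I_n -> seq 'I_n).
Context (e_sym : symmetric e) (e_irr : irreflexive e).
Context (adjP : adjacency_lists e adj) (dfs : dfs_tree e [set: 'I_n] r T).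

(** An ordered pair of adjacent vertices is determined by its edge and by which endpoint comes
    first, so the degrees sum to at most twice the number of edges. *)
Lemma offset_edges : offset adj n <= #|edges e| * 2.
Proof.
pose D : {set 'I_n * 'I_n} := [set q | e q.1 q.2].
have -> : offset adj n = #|D|.
  rewrite offset_last -sum1_card.
  rewrite (eq_bigl (fun q : 'I_n * 'I_n => true && e q.1 q.2)); last first.
    by move=> q; rewrite inE.
  rewrite -(pair_big_dep (fun=> true) e (fun _ _ => 1)) /=.
  apply: eq_bigr => v _; rewrite sum1_card.
  by rewrite -(card_uniqP (adjP v).1); apply: eq_card => u; rewrite (adjP v).2.
pose g (q : 'I_n * 'I_n) := ([set q.1; q.2], q.1 < q.2).
have g_inj : {in D &, injective g}.
  move=> [a b] [c d]; rewrite !inE /= => eab ecd [Eset Elt].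
  have : a \in [set c; d] by rewrite -Eset !inE eqxx.
  have : b \in [set c; d] by rewrite -Eset !inE eqxx orbT.
  have nab : a != b by apply: contraTneq eab => ->; rewrite e_irr.
  rewrite !inE => /orP[]/eqP eb /orP[]/eqP ea; subst; rewrite ?eqxx // in nab *.
  by move: Elt nab; rewrite -(inj_eq val_inj) /=; case: ltngtP.
have -> : #|edges e| * 2 = #|setX (edges e) [set: bool]|.
  by rewrite cardsX cardsT card_bool.
rewrite -(card_in_imset g_inj).
apply: subset_leq_card; apply/subsetP => _ /imsetP[q qD ->].
rewrite inE /= inE andbT; apply/imsetP; exists q => //.
by move: qD; rewrite !inE.
Qed.

(** Every vertex but the root has its parent in its adjacency list. Terms linear in [n] are thus
    absorbed by the number of edges. *)
Lemma leq_n_offset : n <= (offset adj n).+1.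
Proof.
rewrite offset_last (bigD1 r) //=.
have : \sum_(v < n | v != r) 1 <= \sum_(v < n | v != r) size (adj v).
  apply: leq_sum => v vr; have := dfs_edge dfs (in_setT v) vr => /andP[_ evT].
  have : T v \in adj v by rewrite (adjP v).2.
  by case: (adj v).
have -> : \sum_(v < n | v != r) 1 = n.-1.
  by have := cardC1 r; rewrite card_ord sum1_card => <-; apply: eq_card.
move=> le; apply: leq_trans (leqSpred n) _; rewrite ltnS.
exact: leq_trans le (leq_addl _ _).
Qed.

Lemma offset_n2 : offset adj n <= n * n.
Proof.
rewrite offset_last -[X in _ <= X * _](card_ord n) -sum_nat_const.
by apply: leq_sum => v _; apply: (size_adj adjP).
Qed.

Lemma edges_gt0 : 1 < n -> 0 < #|edges e|.
Proof. by have := offset_edges; have := leq_n_offset; lia. Qed.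

End Counting.

Lemma up_log_square n : up_log 2 (n * n) <= (log n).+1 * 2.
Proof.
apply: up_log_min => //; rewrite expnM -mulnn.
by apply: leq_mul; apply: ltnW; apply: trunc_log_ltn.
Qed.

(** All quantities are polynomial in [X = 2 ^ L], which exceeds both [n] and [L]. A word has
    [16 * L >= 5 * L + 6] bits, which leaves room for [64 * X ^ 5]. *)
Lemma word_bounds n M : M <= n * n -> let w := word_size 16 n in
  [/\ 5 < w, n + n + 8 < 2 ^ w /\ n * n + n < 2 ^ w, M + 1 < 2 ^ w,
      2 ^ (up_log 2 (n * n)).+2 <= 2 ^ w
    & (up_log 2 (n * n)).+2 * M.+1 < 2 ^ w].
Proof.
move=> le_M w; set L := (log n).+1.
have wE : w = 16 * L by [].
have Hh := up_log_square n; rewrite -/L in Hh.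
pose X := 2 ^ L; have n_X : n < X by apply: trunc_log_ltn.
have X2 : 2 <= X by rewrite -{1}(expn1 2) leq_exp2l.
have L_X : L < X by apply: ltn_expl.
have X_w : X ^ 5 * 2 ^ 6 <= 2 ^ w.
  by rewrite -expnM -expnD leq_exp2l // wE /L; lia.
have nn_X : n * n < X * X by apply: ltn_mul.
have XX4 : 4 <= X * X by apply: (@leq_mul 2 2).
have X5 : X ^ 5 = X * X * (X * X) * X by rewrite !expnS expn0; lia.
have XX_X5 : X * X <= X ^ 5.
  by rewrite X5 -mulnA leq_pmulr //; lia.
have X_XX : X <= X * X by rewrite leq_pmulr; lia.
split.
- by rewrite wE /L; lia.
- by split; lia.
- by lia.
- by rewrite leq_exp2l // wE; lia.
- have hM : (up_log 2 (n * n)).+2 * M.+1 <= (4 * X) * (X * X).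
    by apply: leq_mul; lia.
  have X3 : X * (X * X) <= X ^ 5.
    rewrite X5 (_ : X * X * (X * X) * X = X * (X * X) * (X * X)); last by rewrite !mulnA.
    by rewrite leq_pmulr //; lia.
  by lia.
Qed.

Lemma preprocess_cost n M m l h t phi q : M <= m * 2 -> n <= M.+1 -> 0 < m ->
  0 < l -> h <= 6 * l ->
  t + phi <= times n 410 + times M 100 + times h (times M 80 + 100) + 200 ->
  t <= (40 * 100 + 12 * q) * (m * l).
Proof.
rewrite /times => hM hn m0 l0 hh Ht.
have hP : h * (M * 80 + 100) <= (6 * l) * (m * 260) by apply: leq_mul; lia.
have mP : m <= m * l by rewrite leq_pmulr.
rewrite mulnDl; move: hP; rewrite (_ : 6 * l * (m * 260) = 1560 * (m * l)); last first.
  by rewrite [m * 260]mulnC mulnACA [l * m]mulnC.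
by lia.
Qed.

(** The time is in fact linear in [k * l]; the cube enters only through [l <= l ^ 3]. *)
Lemma reroot_cost k l h q : 0 < k -> 0 < l -> h <= 6 * l ->
  times k (times h q + 200 + (times h q + 200) + 30) + 100
    <= (40 * 100 + 12 * q) * (k * l ^ 3).
Proof.
rewrite /times => k0 l0 hh.
have hq : h * q <= 6 * q * l by rewrite -mulnA [q * l]mulnC mulnA leq_mul2r hh orbT.
have l3 : l <= l ^ 3 by rewrite -[X in X <= _]expn1 leq_pexp2l.
have inner : h * q + 200 + (h * q + 200) + 30 <= (430 + 12 * q) * l.
  have : 430 <= 430 * l by rewrite leq_pmulr.
  by rewrite mulnDl -(mulnA 12); rewrite -mulnA in hq; lia.
have kl : 0 < k * l by rewrite muln_gt0 k0.
apply: (@leq_trans ((40 * 100 + 12 * q) * (k * l))); last first.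
  by rewrite leq_mul2l leq_mul2l l3 !orbT.
have : k * (h * q + 200 + (h * q + 200) + 30) <= (430 + 12 * q) * (k * l).
  by rewrite mulnCA leq_mul2l inner orbT.
rewrite !mulnDl; lia.
Qed.

Theorem theorem2 :
  exists (preprocess reroot : cmd) (c C : nat),
  forall (n : nat) (e : rel 'I_n) (r : 'I_n) (T : 'I_n -> 'I_n)
      (adj : 'I_n -> seq 'I_n),
    symmetric e -> irreflexive e -> adjacency_lists e adj ->
    dfs_tree e [set: 'I_n] r T ->
  exists built : memory -> Prop,
    (exists (s : memory) (t : nat),
      [/\ exec (word_size c n) preprocess (input_mem adj T) t s,
          built s
        & 1 < n -> t <= C * (#|edges e| * log n)]) /\
    (forall (s : memory) (x r' : 'I_n), built s -> r' \in subtree T x ->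
      exists (s' : memory) (t : nat),
        [/\ exec (word_size c n) reroot (query_mem s x r') t s',
            answers e (subtree T x) r' s',
            built s'
          & 1 < n -> t <= C * (#|subtree T x| * log n ^ 3)]).
Proof.
pose q := max_cost rank_step + 3 + (max_cost select_step + 3) + 40.
(* A search is charged [q] for each of [h + 2 <= 6 * log n] levels, and a vertex carries credits for
   two searches, whence [12 * q]; the other summand absorbs the remaining costs of both programs. *)
exists preprocess, reroot, 16, (40 * 100 + 12 * q).
move=> n e r T adj e_sym e_irr adjP dfs.
have [o Vo] := visits_total e_sym e_irr adjP dfs [:: r].
exists (built r T adj o).
have [w_ge6 [n_word nn_word] off_word h_word pts_word] :=
  word_bounds (offset_n2 adjP).
set w := word_size 16 n in w_ge6 n_word nn_word off_word h_word pts_word *.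
have log_h : 1 < n -> (up_log 2 (n * n)).+2 <= 6 * log n /\ 0 < log n.
  move=> n1; have l0 : 0 < log n by rewrite /log trunc_log_gt0.
  by have := up_log_square n; lia.
split=> [|s x r' Bs r'_in].
  have [t [s [phi [Ex Ht Bs _]]]] := run_preprocess e_sym e_irr adjP dfs Vo w_ge6
    n_word nn_word off_word h_word pts_word.
  exists s, t; split=> // n1; have [h_log log0] := log_h n1.
  have m_e := offset_edges e_irr adjP; have n_m := leq_n_offset adjP dfs.
  have e0 := edges_gt0 e_irr adjP dfs n1.
  exact: (preprocess_cost _ m_e n_m e0 log0 h_log Ht).
have [t [s' [phi [Ex Ht [As Bs'] _]]]] := run_reroot e_sym e_irr adjP dfs Vo w_ge6
    n_word nn_word off_word h_word pts_word Bs r'_in.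
exists s', t; split=> // n1; have [h_log log0] := log_h n1.
have S0 : 0 < #|subtree T x| by apply/card_gt0P; exists r'.
have := reroot_cost q S0 log0 h_log.
by apply: leq_trans; move: Ht; rewrite /query_cost -/q; lia.
Qed.
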